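(* With the setting of the context, where $\alpha:Q\to[0,\infty)$ is continuous, there exists $y^*\in X$ with $\mathcal{G}(y^* )=\sup_{y\in X}\mathcal{G}(y)$. Suppose moreover that this maximizer $y^*$ is unique. Then $\|\pi^N-y^*\|_{\sup}\to0$ almost surely. In addition, for every $\delta>0$ there are constants $c,C>0$ such that $$P\bigl(\|\pi^N-y^*\|_{\sup}>\delta\bigr)<Ce^{-cN}\quad\text{for all }N\in\mathbb{N}.$$
   Context: Inhomogeneous last passage percolation. Fix $l>0$ and $b\in\mathbb{R}$ with $|b|<l$, and let $Q=\{(x,y)\in\mathbb{R}^2: 0\le x\le l,\ |y|\le x,\ |b-y|\le l-x\}$. Let $\widetilde{\mathbb{Z}}^2=\{(x,y)\in\mathbb{Z}^2: x+y\text{ even}\}$, and for $N\in\mathbb{N}$ let $S_N=Q\cap\frac1N\widetilde{\mathbb{Z}}^2$. Let $\alpha:Q\to[0,\infty)$ be continuous. For each $N$, let $(\xi_p)_{p\in S_N}$ be independent random variables with $\xi_p$ distributed as $\frac{\alpha(p)}{N}E_p$, where $E_p$ is exponential with mean $1$. $\Pi_N$ is the set of oriented paths $\pi=(p_0,\dots,p_k)$ with $p_0=(0,0)$, $p_i\in S_N$, $p_i-p_{i-1}=\frac1N(1,\pm1)$, and $p_k$ the rightmost point of $S_N$. Define $\xi_N\cdot\pi=\sum_{p\in\pi}\xi_p$. Let $\pi^N$ be the almost surely unique path in $\Pi_N$ maximizing $\xi_N\cdot\pi$. This path is identified with the function whose graph is the piecewise linear interpolation of its points, and $\|\cdot\|_{\sup}$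 denotes the sup norm. Let $\gamma(w)=1+\sqrt{1-w^2}$ for $|w|\le 1$. Let $X$ be the set of $1$-Lipschitz functions $y:[0,l]\to\mathbb{R}$ with $y(0)=0$ and $y(l)=b$. For $y\in X$, define $\mathcal{G}(y)=\int_0^l\alpha(x,y(x))\,\gamma(\dot y(x))\,dx$. *)

(* Defs.v *)
From HB Require Import structures.
From mathcomp Require Import all_boot all_order all_algebra.
From mathcomp Require Import all_classical all_reals all_analysis.
Set Implicit Arguments. Unset Strict Implicit. Unset Printing Implicit Defensive.
Import Order.TTheory GRing.Theory Num.Theory.
Import numFieldNormedType.Exports.
Local Open Scope classical_set_scope.
Local Open Scope ring_scope.

Section LPP.
Variable R : realType.

Definition inQ (l b x y : R) : Prop :=
  0 <= x <= l /\ `|y| <= x /\ `|b - y| <= l - x.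

Definition inSN (l b : R) (N : nat) (i j : int) : Prop :=
  (2 %| i + j)%Z /\ inQ l b (i%:~R / N%:R) (j%:~R / N%:R).

Definition is_rightmost (l b : R) (N : nat) (i j : int) : Prop :=
  inSN l b N i j /\ forall i' j', inSN l b N i' j' -> i' <= i.

(* An oriented path pi = (p_0,...,p_k) in Pi_N is encoded by the list
   js = [j_0; ...; j_k] of integers: p_i = (i/N, j_i/N). *)
Definition is_path (l b : R) (N : nat) (js : seq int) : Prop :=
  [/\ (0 < size js)%N,
      nth 0 js 0 = 0,
      (forall i, (i < size js)%N -> inSN l b N i%:Z (nth 0 js i)),
      (forall i, (i.+1 < size js)%N -> `|nth 0 js i.+1 - nth 0 js i| = 1)
    & is_rightmost l b N (size js).-1%:Z (nth 0 js (size js).-1)].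

(* xi_N . pi = sum of the weights of the points of the path;
   xi i j is the weight of the point (i/N, j/N). *)
Definition pweight (xi : int -> int -> R) (js : seq int) : R :=
  \sum_(i < size js) xi i%:Z (nth 0 js i).

Definition is_maxpath (l b : R) (N : nat) (xi : int -> int -> R)
    (js : seq int) : Prop :=
  is_path l b N js /\
  forall js', is_path l b N js' -> pweight xi js' <= pweight xi js.

(* The piecewise linear interpolation of the path, as a function of x;
   beyond its last point x = k/N it is extended constantly. *)
Definition path_fun (N : nat) (js : seq int) (x : R) : R :=
  let k := (size js).-1 in
  let s := N%:R * x in
  if k%:R <= s then (nth 0 js k)%:~R / N%:R
  else let i := `|Num.floor s|%N in
       ((i.+1%:R - s) * (nth 0 js i)%:~R + (s - i%:R) * (nth 0 js i.+1)%:~R)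
         / N%:R.

Definition sup_dist (l : R) (f g : R -> R) : R :=
  sup [set `|f x - g x| | x in `[0, l]].

Definition gamma (w : R) : R := 1 + Num.sqrt (1 - w ^+ 2).

Definition Xset (l b : R) : set (R -> R) :=
  [set y | y 0 = 0 /\ y l = b /\
           forall x1 x2, x1 \in `[0, l] -> x2 \in `[0, l] ->
             `|y x1 - y x2| <= `|x1 - x2|].

Definition Gfun (l : R) (alpha : R * R -> R) (y : R -> R) : \bar R :=
  (\int[@lebesgue_measure R]_(x in `[0%R, l]) (alpha (x, y x) * gamma (derive1 y x))%:E)%E.

End LPP.

(* Main.v *)
Require Import Defs.
From HB Require Import structures.
From mathcomp Require Import all_boot all_order all_algebra.
From mathcomp Require Import all_classical all_reals all_analysis.
From mathcomp Require Import measurable_realfun zify ring lra.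
Set Implicit Arguments. Unset Strict Implicit. Unset Printing Implicit Defensive.
Import Order.TTheory GRing.Theory Num.Theory.
Import numFieldNormedType.Exports.
Local Open Scope classical_set_scope.
Local Open Scope ring_scope.

(* The homogeneous model with Exp(1) weights is compared with its stationary version (Burke's
   property), whose passage times are sums of independent exponentials.  Together with Chernoff
   bounds this shows that, up to an error [eps * N] and outside an event of exponentially small
   probability, all passage times between grid points are given by the shape function
   [(sqrt m + sqrt n)^2].

   A Lipschitz curve is absolutely continuous with a density bounded by 1 (Radon-Nikodym for
   [x + y x]), so by concavity of [gamma] the functional is the limit of upper Riemann-like sums
   that depend on finitely many values of the curve.  Compactness of the set of curves then gives
   a maximizer, and shows that a curve far from a unique maximizer has one of finitely many of
   these sums bounded away from the maximum.

   On the good event, cutting a path into finitely many pieces bounds its weight from above by the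
   sums of a curve close to it, while gluing optimal paths along the maximizer yields a path whose
   weight is almost the maximum.  Hence a maximizing path stays close to the maximizer, and
   Borel-Cantelli concludes. *)

(** * Lipschitz curves and the functional *)

(** In the rotated coordinates [u = (x + y) / 2], [v = (x - y) / 2] the region [Q] is a rectangle
    and the paths become up-right lattice paths. A cell of width [h] in which the curve rises by [d]
    becomes a rectangle with sides [(h + d) / 2] and [(h - d) / 2], whose shape value
    [h + sqrt (h^2 - d^2)] is [h * gamma (d / h)]: this is the origin of [gamma]. The functional is
    only upper semicontinuous, since oscillating slopes can lose weight that their limit regains.
    The upper sums are continuous in the curve and stand in for it wherever curves converge. The
    joint law of the weights for different [N] is arbitrary, so almost sure convergence has to come
    from summable probabilities. With exponential tails, union bounds over all rectangles of the
    grid cost nothing. The lower tail is the hard side, because the stationary model bounds the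
    homogeneous one only from above. It is recovered from a quadratic gap: at the characteristic
    parameter a path that follows an axis over a macroscopic length loses too much, so an optimal
    path leaves the axis early and collects almost all its weight in the bulk. *)

Section nonmeasurable_integrand.
Context d (T : measurableType d) (R : realType) (mu : {measure set T -> \bar R}).
Import HBNNSimple.
Local Open Scope ereal_scope.

(* The junk values of [derive1] may make the integrand of [Gfun] non-measurable, so [f] is
   only compared with a measurable [h]. *)
Lemma ge0_ae_eq_integral_measurable_r (D : set T) (f h : T -> \bar R) :
  measurable D -> (forall x, D x -> 0 <= f x) -> (forall x, D x -> 0 <= h x) ->
  measurable_fun D h -> {ae mu, forall x, D x -> f x = h x} ->
  \int[mu]_(x in D) f x = \int[mu]_(x in D) h x.
Proof.
move=> mD f0 h0 mh [N [mN N0 hN]].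
have fh x : D x -> ~ N x -> f x = h x.
  by move=> Dx Nx; apply: contrapT => fhx; apply: Nx; apply: hN => /= k; apply: fhx; exact: k.
have mhD : measurable_fun setT (h \_ D) by exact/(measurable_restrictT _ mD).
have hD0 x : 0 <= (h \_ D) x by rewrite patchE; case: ifPn => // /[!inE]; exact: h0.
apply/eqP; rewrite eq_le; apply/andP; split.
  (* The integral of a nonnegative function is a supremum over simple functions below it, measurable
     or not. Off [N] a simple function below [f] is below [h], and [N] does not contribute. *)
  rewrite ge0_integralE//; apply: ge_ereal_sup => _ [s /= sf <-].
  rewrite -integralT_nnsfun (ge0_negligible_integral (N := N) mN measurableT)//; last 2 first.
  - exact/measurable_EFinP/measurable_funP.
  - by move=> x _; rewrite lee_fin.
  rewrite [leRHS]integral_mkcond [leRHS](ge0_negligible_integral (N := N) mN measurableT)//.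
  apply: ge0_le_integral => //.
  - exact: measurableD.
  - by move=> x _; rewrite lee_fin.
  - exact/measurable_EFinP/measurable_funTS/measurable_funP.
  - exact: measurable_funTS.
  - move=> x [_ Nx]; apply: le_trans (sf x) _; rewrite !patchE; case: ifPn => //.
    by rewrite inE => Dx; rewrite fh.
(* Conversely, with [N] removed from the domain, a simple function below [h] vanishes on [N], hence
   is also below [f]. *)
rewrite (ge0_negligible_integral (N := N) mN mD)//.
rewrite [in leRHS]ge0_integralE// ge0_integralE; last by move=> x [Dx _]; exact: h0.
apply: ge_ereal_sup => _ [s /= sh <-]; apply: ereal_sup_ubound; exists s => //= x.
apply: le_trans (sh x) _; rewrite !patchE; case: ifPn => [|_].
  by rewrite inE => -[Dx Nx]; rewrite mem_set// fh.
by case: ifPn => // /[!inE]; exact: f0.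
Qed.

End nonmeasurable_integrand.

(** * Absolute continuity of 1-Lipschitz functions *)

Section lipschitz_density.
Context {R : realType}.
Notation mu := (@lebesgue_measure R).
Variable f : R -> R.
Hypothesis hf : forall x y, `|f x - f y| <= `|x - y|.

Lemma lipschitz1_continuous : continuous f.
Proof.
move=> x; apply/cvgrPdist_lt => e e0; near=> y.
apply: (le_lt_trans (hf x y)); near: y.
by apply: (@cvgr_dist_lt _ R^o _ (nbhs x) _ id x) => //; exact: cvg_id.
Unshelve. all: by end_near. Qed.

Let F1 x := x + f x.
Let F2 x := x - f x.

Let lip x y : x <= y -> - (y - x) <= f y - f x <= y - x.
Proof. by move=> xy; have := hf y x; rewrite [X in _ <= X]ger0_norm ?subr_ge0// ler_norml. Qed.

Let nd1 : {homo F1 : x y / x <= y}.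
Proof. by move=> x y xy; rewrite /F1; have /andP[] := lip xy; lra. Qed.
Let nd2 : {homo F2 : x y / x <= y}.
Proof. by move=> x y xy; rewrite /F2; have /andP[] := lip xy; lra. Qed.

Let rc1 : right_continuous F1.
Proof.
apply: right_continuousW => x.
by apply: (@continuousD _ _ _ id f) => //; exact: lipschitz1_continuous.
Qed.
Let rc2 : right_continuous F2.
Proof.
apply: right_continuousW => x.
by apply: (@continuousB _ _ _ id f) => //; exact: lipschitz1_continuous.
Qed.

Let C1 : cumulative R R := HB.pack F1 (isCumulative.Build R _ R F1 nd1 rc1).
Let C2 : cumulative R R := HB.pack F2 (isCumulative.Build R _ R F2 nd2 rc2).

Let LS_itv (C : cumulative R R) (a b : R) : a <= b ->
  lebesgue_stieltjes_measure C `]a, b]%classic = (C b - C a)%:E.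
Proof.
move=> ab; rewrite /lebesgue_stieltjes_measure /measure_extension measurable_mu_extE//.
  exact: wlength_itv_bnd.
exact: is_ocitv.
Qed.

Let nu1 := lebesgue_stieltjes_measure C1.
Let nu2 := lebesgue_stieltjes_measure C2.

Let half0 : 0 <= (2^-1 : R). Proof. by rewrite invr_ge0. Qed.

(** Since [F1 x + F2 x = 2 * x], the two Stieltjes measures average to Lebesgue measure. Hence each
    is dominated by it, which is the absolute continuity required by Radon-Nikodym. *)
Let muE A : measurable A -> mu A = (2^-1%:E * (nu1 A + nu2 A))%E.
Proof.
have msE B : mscale (NngNum half0) (measure_add nu1 nu2) B = (2^-1%:E * (nu1 B + nu2 B))%E.
  by congr (_ * _)%E; exact: measure_addE.
suff : measurable A -> mu A = mscale (NngNum half0) (measure_add nu1 nu2) A by rewrite msE.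
apply: lebesgue_measure_unique => X [[a b] _ <-] /=.
have [ab|ba] := leP a b; last first.
  by rewrite set_itv_ge ?measure0// bnd_simp -leNgt ltW.
rewrite msE lebesgue_measure_itv /nu1 /nu2 !LS_itv//= /F1 /F2 -EFinD -EFinM lte_fin.
case: ltP => [_|ba]; first by congr (_%:E); field.
have -> : b = a by apply/eqP; rewrite eq_le ab ba.
by congr (_%:E); field.
Qed.

Let nu1_dom A : measurable A -> mu A = 0%E -> nu1 A = 0%E.
Proof.
move=> mA; rewrite muE// => /eqP.
rewrite mule_eq0 => /orP[|].
  by rewrite eqe invr_eq0 pnatr_eq0.
by rewrite padde_eq0 ?measure_ge0// => /andP[/eqP].
Qed.

(** The density is that of the nondecreasing function [x + f x], so that a positive measure is
    differentiated; the derivative of [f] itself is [h - 1]. *)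
Lemma lipschitz1_RN (a b : R) : a <= b ->
  exists h : R -> R, [/\ forall x, 0 <= h x, mu.-integrable setT (EFin \o h) &
    forall c e : R, a <= c -> c <= e -> e <= b ->
      (\int[mu]_(x in `]c, e]) (h x)%:E)%E = (e + f e - (c + f c))%:E].
Proof.
move=> ab.
have mD : measurable (`]a, b]%classic : set (g_sigma_algebraType R.-ocitv.-measurable)).
  exact: measurable_itv.
have fD : (nu1 `]a, b]%classic < +oo)%E by rewrite /nu1 LS_itv// ltry.
(* Restriction to []a, b]] makes the measure finite, hence the density integrable on the whole
   line. *)
pose nu := mfrestr mD fD.
have nudom : nu `<< mu.
  apply/null_content_dominatesP => A mA A0.
  rewrite /nu /mfrestr /mrestr; apply: nu1_dom; first exact: measurableI.
  apply: (subset_measure0 (measurableI _ _ mA mD) mA) A0.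
  by move=> ? [].
have [h [h0 hfin hint hE]] := radon_nikodym_sigma_finite nudom.
have eh : EFin \o (fine \o h) = h by apply/funext => x /=; rewrite fineK.
exists (fine \o h); split; [|by rewrite eh|].
  by move=> x; rewrite /= fine_ge0.
move=> c e ac ce eb.
have <- : nu `]c, e]%classic = (e + f e - (c + f c))%:E.
  have <- : nu1 `]c, e]%classic = (e + f e - (c + f c))%:E by rewrite /nu1 LS_itv.
  rewrite /nu /mfrestr /mrestr; congr (nu1 _).
  rewrite setIidl// => x/=; rewrite !in_itv/= => /andP[cx xe].
  by rewrite (le_lt_trans ac cx) (le_trans xe eb).
have H := hE `]c, e]%classic (measurable_itv _).
by rewrite -eh in H; exact: esym.
Qed.

End lipschitz_density.

Section lipschitz_density_within.
Context {R : realType}.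
Notation mu := (@lebesgue_measure R).

Lemma derive1_le1 (f : R -> R) (x e : R) : 0 < e ->
  (forall h : R, `|h| < e -> `|f (x + h) - f x| <= `|h|) ->
  derivable f x 1 -> derive1 f x <= 1.
Proof.
move=> e0 hf dfx; rewrite derive1E; apply: limr_le => //.
near=> h.
have h0 : h != 0 by near: h; exact: nbhs_dnbhs_neq.
have he : `|h| < e.
  near: h; apply: nbhs_dnbhs; exact: (@nbhs0_lt _ R^o).
apply: le_trans (ler_norm _) _.
rewrite normrZ normfV /= /shift [h%:A]mulr1 [h + x]addrC ler_pdivrMl ?normr_gt0// mulr1.
exact: hf.
Unshelve. all: by end_near. Qed.

Lemma integrable_cst_itv (i : interval R) (k : R) : (mu [set` i] < +oo)%E ->
  mu.-integrable [set` i] (cst k%:E).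
Proof.
move=> fi; apply/integrableP; split; first exact: measurable_cst.
by rewrite integral_cst//= lte_mul_pinfty.
Qed.

Definition clamp (a b x : R) : R := Num.max a (Num.min x b).

Lemma clamp_in (a b x : R) : a <= b -> clamp a b x \in `[a, b].
Proof. by move=> ab; rewrite in_itv/= /clamp le_max lexx/= ge_max ab ge_min lexx orbT. Qed.

Lemma clamp_id (a b x : R) : x \in `[a, b] -> clamp a b x = x.
Proof.
by rewrite in_itv/= /clamp => /andP[ax xb]; rewrite (min_idPl xb) (max_idPr ax).
Qed.

Lemma clamp_lip (a b : R) : a <= b ->
  forall x1 x2 : R, `|clamp a b x1 - clamp a b x2| <= `|x1 - x2|.
Proof.
move=> ab x1 x2; wlog x12 : x1 x2 / x1 <= x2.
  by move=> H; have /orP[/H//|/H] := le_total x1 x2; rewrite distrC [leRHS]distrC.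
rewrite [leRHS]ler0_norm ?subr_le0// ler_norml /clamp.
by case: (leP x1 b) => h1; case: (leP x2 b) => h2; case: (leP a x1) => h3;
  case: (leP a x2) => h4; rewrite ?(max_idPr ab); apply/andP; split; lra.
Qed.

(* [y] is extended to the whole line by composing it with the retraction on [[a, b]]. *)
Lemma lipschitz1_density (a b : R) (y : R -> R) : a < b ->
  (forall x1 x2, x1 \in `[a, b] -> x2 \in `[a, b] -> `|y x1 - y x2| <= `|x1 - x2|) ->
  exists g : R -> R, [/\ measurable_fun setT g, forall x, `|g x| <= 1,
    {ae mu, forall x, x \in `]a, b[ -> derivable y x 1 /\ derive1 y x = g x} &
    forall c e : R, a <= c -> c <= e -> e <= b ->
      (\int[mu]_(x in `]c, e]) (g x)%:E)%E = (y e - y c)%:E].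
Proof.
move=> ab ylip.
pose cl := clamp a b; have clin x := clamp_in x (ltW ab); have clid (x : R) : x \in `[a, b] -> cl x = x := @clamp_id a b x.
have cllip := clamp_lip (ltW ab).
have flip x1 x2 : `|y (cl x1) - y (cl x2)| <= `|x1 - x2|.
  exact: le_trans (ylip _ _ (clin _) (clin _)) (cllip _ _).
have [h [h0 hint hE]] := lipschitz1_RN flip (ltW ab).
have mh : measurable_fun setT h.
  by move/integrableP : hint => [/measurable_EFinP].
have loch : locally_integrable setT h.
  by apply: open_integrable_locally => //; exact: openT.
have hinty z : mu.-integrable [set` Interval (BRight a) (BRight z)] (EFin \o h).
  by apply: integrableS hint => //.
(* Almost everywhere the primitive of [h] has derivative [h]; near such a point [y] is this
   primitive minus the identity, up to a constant. *)
have ftc := FTC1 hinty loch.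
(* The truncation gives the bound by 1 everywhere. It alters [h - 1] only on a null set, because [h]
   is nonnegative and a derivative of [y] is at most 1. *)
pose g x := Num.max (- 1) (Num.min (h x - 1) 1).
have mg : measurable_fun setT g.
  apply: measurable_maxr; first exact: measurable_cst.
  apply: measurable_minr; last exact: measurable_cst.
  exact: measurable_funB.
have hy : {ae mu, forall x, x \in `]a, b[ -> derivable y x 1 /\ derive1 y x = h x - 1}.
  move: ftc => /=; apply: filterS; first exact: (ae_filter_ringOfSetsType mu).
  move=> x hx xab.
  move: (xab); rewrite in_itv/= => /andP[ax xb].
  pose F (z : R) : R := \int[mu]_(t in `]a, z]) h t.
  have [dF DF] : derivable F x 1 /\ derive1 F x = h x by exact: (hx ax).
  have dF' : is_derive x 1 F (h x) by apply: DeriveDef; [exact: dF|rewrite -derive1E; exact: DF].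
  have FE : \forall z \near x, (F z - z + (a + y a)) = y z.
    near=> z.
    have zab : z \in `]a, b[ by near: z; exact: near_in_itv.
    move: (zab); rewrite in_itv/= => /andP[az zb].
    have := hE a z (lexx _) (ltW az) (ltW zb).
    rewrite /F /Rintegral => ->/=; rewrite !clid ?in_itv/= ?lexx ?(ltW az) ?(ltW zb) ?(ltW ab)//.
    lra.
  have dy : is_derive x 1 y (h x - 1).
    apply: near_eq_is_derive FE _.
    have := is_deriveD (is_deriveB dF' (is_derive_id x 1)) (is_derive_cst (a + y a) x 1).
    by rewrite addr0.
  by split; [exact: ex_derive|rewrite derive1E; exact: derive_val].
have hg : {ae mu, forall x, x \in `]a, b[ -> h x - 1 = g x}.
  move: hy; apply: filterS; first exact: (ae_filter_ringOfSetsType mu).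
  move=> x hx xab; have [dy Dy] := hx xab.
  have : derive1 y x <= 1.
    move: (xab); rewrite in_itv/= => /andP[ax xb].
    apply: (@derive1_le1 y x (Num.min (x - a) (b - x))) => //.
      by rewrite lt_min !subr_gt0 ax.
    move=> u; rewrite lt_min !ltr_norml => /andP[/andP[u1 u2] /andP[u3 u4]].
    apply: le_trans (ylip _ _ _ _) _; rewrite ?in_itv/= ?(ltW ax) ?(ltW xb)//.
      by apply/andP; split; lra.
    by rewrite addrC addKr.
  rewrite Dy /g => le1; rewrite (min_idPl le1).
  by apply/esym/max_idPr; rewrite lerBrDr addNr.
exists g; split => //.
- by move=> x; rewrite /g ler_norml le_max lexx/= ge_max ge_min lexx orbT andbT; lra.
- move: hy hg; apply: filterS2; first exact: (ae_filter_ringOfSetsType mu).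
  move=> x /= h1 h2 xab.
  by split; [exact: (h1 xab).1|rewrite (h1 xab).2 h2].
move=> c e ac ce eb.
have [ce1|ec] := ltP c e; last first.
  have -> : c = e by apply/eqP; rewrite eq_le ce ec.
  by rewrite set_itv_ge ?bnd_simp ?ltxx// integral_set0 subrr.
have mgE : measurable_fun `]c, e[ (EFin \o g).
  exact/measurable_EFinP/measurable_funTS.
have mhE : measurable_fun `]c, e[ (EFin \o (fun x => h x - 1)).
  by apply/measurable_EFinP/measurable_funTS; exact: measurable_funB.
transitivity (\int[mu]_(x in `]c, e]) (h x - 1)%:E)%E.
  rewrite [LHS]integral_itv_bndoo// [RHS]integral_itv_bndoo//.
  apply: ae_eq_integral => //; move: hg; apply: filterS; first exact: (ae_filter_ringOfSetsType mu).
  move=> x hx /=; rewrite in_itv/= => /andP[cx xe].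
  by rewrite hx// in_itv/= (le_lt_trans ac cx) (lt_le_trans xe eb).
under eq_integral do rewrite EFinB.
rewrite integralB_EFin//; last 2 first.
- exact: integrableS hint.
- by apply: integrable_cst_itv; rewrite lebesgue_measure_itv/= lte_fin ce1 -EFinB ltry.
rewrite hE// integral_cst//= mul1e lebesgue_measure_itv/= lte_fin ce1 -EFinB.
rewrite !clid ?in_itv/= ?ac ?eb ?(le_trans ac ce) ?(le_trans ce eb)//.
by congr (_%:E); lra.
Unshelve. all: by end_near. Qed.

End lipschitz_density_within.

(** * Uniform continuity and boundedness of alpha on the compact region *)

Section alpha_regularity.
Context {R : realType}.
Variables (l b : R) (alpha : R * R -> R).
Hypothesis cont : {within [set p | inQ l b p.1 p.2], continuous alpha}.
Let Q := [set p : R * R | inQ l b p.1 p.2].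

Lemma compact_Q : compact Q.
Proof.
have cK : compact (`[0, l]%classic `*` `[- l, l]%classic : set (R * R)).
  by apply: compact_setX; exact: segment_compact.
apply: (subclosed_compact _ cK); last first.
  move=> [x y] [/= /andP[x0 xl] [yx _]]; split; rewrite /= in_itv/= ?x0//.
  by move: yx; rewrite ler_norml => /andP[? ?]; apply/andP; split; lra.
have -> : Q = [set p : R * R | 0 <= p.1] `&` [set p | 0 <= l - p.1] `&`
   [set p | 0 <= p.1 - `|p.2|] `&` [set p | 0 <= l - p.1 - `|b - p.2|].
  apply/seteqP; split => [[x y]/= [/= /andP[h1 h2] [h3 h4]]|[x y] /= [[[h1 h2] h3] h4]].
    by split; [split; [split|]|]; rewrite /= ?subr_ge0.
  by rewrite /Q /inQ /= h1 /=; split; [|split]; rewrite -subr_ge0.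
have c1 : continuous (fun p : R * R => p.1) by move=> p; exact: cvg_fst.
have c2 : continuous (fun p : R * R => p.2) by move=> p; exact: cvg_snd.
have cl (f : R * R -> R) : continuous f -> closed [set p | 0 <= f p].
  by move=> cf; apply: (@preimage_closed _ _ f [set u : R | 0 <= u]); [move=> ? _; exact: cf|exact: closed_ge].
do !apply: closedI; apply: cl => p.
- exact: c1.
- by apply: cvgB; [exact: cvg_cst|exact: c1].
- by apply: cvgB; [exact: c1|apply: cvg_norm; exact: c2].
- apply: cvgB; first by apply: cvgB; [exact: cvg_cst|exact: c1].
  by apply: cvg_norm; apply: cvgB; [exact: cvg_cst|exact: c2].
Qed.

Lemma alpha_local (p : R * R) (e : R) : Q p -> 0 < e -> exists2 r : R, 0 < r &
  forall q, Q q -> `|p.1 - q.1| < r -> `|p.2 - q.2| < r -> `|alpha p - alpha q| < e.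
Proof.
move=> Qp e0.
have := cont; move/subspace_continuousP => /(_ p Qp) /cvgrPdist_lt /(_ e e0).
rewrite near_withinE => /nbhs_ballP[r /= r0 H].
exists r => // q Qq h1 h2; apply: H => //=; split => /=; by rewrite /ball_.
Qed.

Lemma alpha_unif (e : R) : 0 < e -> exists2 r : R, 0 < r & forall p q, Q p -> Q q ->
  `|p.1 - q.1| <= r -> `|p.2 - q.2| <= r -> `|alpha p - alpha q| <= e.
Proof.
move=> e0; have /compact_near_coveringP cQ := compact_Q.
have := cQ R 0^'+ (fun r p => forall q, Q p -> Q q ->
  `|p.1 - q.1| <= r -> `|p.2 - q.2| <= r -> `|alpha p - alpha q| <= e) _.
case.
  move=> p Qp; have [r r0 H] := alpha_local Qp (divr_gt0 e0 (ltr0n _ 2)).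
  have r20 : 0 < r / 2 by rewrite divr_gt0.
  exists (ball p (r / 2), [set d : R | d < r / 2]) => /=.
    by split; [exact: nbhsx_ballx|exact: nbhs_right_lt].
  move=> [x d] /= [[x1 x2] dr] q Qx Qq h1 h2.
  rewrite /ball /= in x1 x2.
  have hx : `|alpha p - alpha x| < e / 2 by apply: H => //; lra.
  have hq : `|alpha p - alpha q| < e / 2.
    apply: H => //.
      by have := ler_distD x.1 p.1 q.1; lra.
    by have := ler_distD x.2 p.2 q.2; lra.
  by have := ler_distD (alpha p) (alpha x) (alpha q); rewrite (distrC (alpha x) (alpha p)); lra.
move=> r /= r0 H; exists (r / 2); first by rewrite divr_gt0.
move=> p q Qp Qq; apply: (H (r / 2)) => //=; rewrite ?divr_gt0//.
by rewrite sub0r normrN ger0_norm ?divr_ge0 ?ltW// ltr_pdivrMr// ltr_pMr// ltr1n.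
Qed.

Lemma alpha_bound : exists2 M : R, 0 <= M & forall p, Q p -> alpha p <= M.
Proof.
have : compact (alpha @` Q) by apply: continuous_compact => //; exact: compact_Q.
move/compact_bounded => [M [Mr HM]].
exists (`|M| + 1); first by rewrite addr_ge0.
move=> p Qp; apply: le_trans (ler_norm _) _; apply: (HM (`|M| + 1)).
  by rewrite (le_lt_trans (ler_norm M))// ltrDl.
by exists p.
Qed.

End alpha_regularity.

(** * Concavity of gamma *)

Section gamma.
Context {R : realType}.
Implicit Types w c e : R.

Lemma gamma_ge1 w : 1 <= gamma w.
Proof. by rewrite /gamma lerDl sqrtr_ge0. Qed.

Lemma gamma_ge0 w : 0 <= gamma w.
Proof. exact: le_trans (gamma_ge1 w). Qed.

Lemma gamma_le2 w : gamma w <= 2.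
Proof.
rewrite /gamma -lerBrDl; apply: le_trans (_ : Num.sqrt 1 <= _); last by rewrite sqrtr1; lra.
by rewrite ler_sqrt// lerBlDr lerDl sqr_ge0.
Qed.

(** AM-GM for the factors [c * (1 + w)] and [c^-1 * (1 - w)], whose product is [1 - w ^+ 2]. Varying
    [c] produces affine majorants of [gamma]. *)
Lemma sqrt_one_sub_le w c : `|w| <= 1 -> 0 < c ->
  Num.sqrt (1 - w ^+ 2) <= (c * (1 + w) + c^-1 * (1 - w)) / 2.
Proof.
rewrite ler_norml => /andP[h1 h2] c0; have ci : 0 < c^-1 by rewrite invr_gt0.
set B := (X in _ <= X); have B0 : 0 <= B.
  by rewrite /B divr_ge0// addr_ge0// mulr_ge0 ?(ltW c0) ?(ltW ci)//; lra.
rewrite -(ger0_norm B0) -sqrtr_sqr ler_sqrt ?sqr_ge0//.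
have -> : 1 - w ^+ 2 = (c * (1 + w)) * (c^-1 * (1 - w)) by field; rewrite gt_eqF.
rewrite /B; set u := c * _; set v := c^-1 * _.
have := sqr_ge0 (u - v); nra.
Qed.

(** AM-GM is an equality at [w0] for [c = sqrt ((1 - w0) / (1 + w0))]. At [w0 = 1] and [w0 = -1] the
    tangent is vertical, so that only an almost touching line exists; this is why [e] is there. *)
Lemma gamma_tangent (w0 e : R) : `|w0| <= 1 -> 0 < e -> exists A B : R,
  (forall w : R, `|w| <= 1 -> gamma w <= A + B * w) /\ A + B * w0 <= gamma w0 + e.
Proof.
move=> w01 e0.
suff [c c0 hc] : exists2 c : R, 0 < c & (c * (1 + w0) + c^-1 * (1 - w0)) / 2 <= Num.sqrt (1 - w0 ^+ 2) + e.
  exists (1 + (c + c^-1) / 2), ((c - c^-1) / 2); split => [w w1|].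
    by have := sqrt_one_sub_le w1 c0; rewrite /gamma; lra.
  by rewrite /gamma; lra.
move: w01; rewrite ler_norml => /andP[h1 h2].
have [->|n1] := eqVneq w0 1.
  by exists e => //; rewrite expr1n subrr sqrtr0; lra.
have [->|n2] := eqVneq w0 (-1).
  exists e^-1; rewrite ?invr_gt0// invrK sqrrN expr1n subrr sqrtr0; lra.
have p1 : 0 < 1 - w0 by rewrite subr_gt0 lt_neqAle n1.
have p2 : 0 < 1 + w0 by rewrite addrC -ltrBlDr sub0r lt_neqAle eq_sym n2.
set s1 := Num.sqrt (1 - w0); set s2 := Num.sqrt (1 + w0).
have s10 : 0 < s1 by rewrite sqrtr_gt0.
have s20 : 0 < s2 by rewrite sqrtr_gt0.
exists (s1 / s2); first exact: divr_gt0.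
have e1 : 1 - w0 = s1 ^+ 2 by rewrite sqr_sqrtr// ltW.
have e2 : 1 + w0 = s2 ^+ 2 by rewrite sqr_sqrtr// ltW.
have -> : 1 - w0 ^+ 2 = (s1 * s2) ^+ 2 by rewrite exprMn -e1 -e2; ring.
rewrite sqrtr_sqr ger0_norm ?mulr_ge0 ?(ltW s10) ?(ltW s20)// e1 e2.
have -> : (s1 / s2 * s2 ^+ 2 + (s1 / s2)^-1 * s1 ^+ 2) / 2 = s1 * s2.
  by field; rewrite !gt_eqF.
by rewrite lerDl ltW.
Qed.

Lemma gamma_continuous : continuous (@gamma R).
Proof.
have c (x : R) : {for x, continuous ((@Num.sqrt R : R -> R) \o (fun z : R => 1 - z ^+ 2))}.
  apply: continuous_comp; last exact: sqrt_continuous.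
  by apply: cvgB; [exact: cvg_cst|exact: exprn_continuous].
by move=> x; apply: cvgD; [exact: cvg_cst|exact: c].
Qed.

End gamma.

(** * Upper sums over a uniform mesh *)

Section integral_partition.
Context {R : realType}.
Notation mu := (@lebesgue_measure R).

Lemma cell_exists (h x : R) (K : nat) : 0 < h -> 0 < x -> x <= K%:R * h ->
  exists2 k, (k < K)%N & k%:R * h < x <= k.+1%:R * h.
Proof.
move=> h0 x0; elim: K => [|K IH] xK; first by move: xK; rewrite mul0r leNgt x0.
have [xk|kx] := leP x (K%:R * h).
  by have [k kK hk] := IH xk; exists k => //; exact: leqW.
by exists K => //; rewrite kx xK.
Qed.

Lemma cell_unique (h x : R) (j k : nat) : 0 < h ->
  j%:R * h < x <= j.+1%:R * h -> k%:R * h < x <= k.+1%:R * h -> j = k.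
Proof.
move=> h0 /andP[j1 j2] /andP[k1 k2].
have jk (i i' : nat) : i%:R * h < x -> x <= i'.+1%:R * h -> (i <= i')%N.
  by move=> a1 a2; have := lt_le_trans a1 a2; rewrite ltr_pM2r// ltr_nat ltnS.
by apply/eqP; rewrite eqn_leq !jk.
Qed.

Lemma ge0_integral_cells (f : R -> \bar R) (h : R) (K : nat) : 0 <= h ->
  measurable_fun setT f -> (forall x, 0 <= f x)%E ->
  (\int[mu]_(x in `]0%R, (K%:R * h)%R]) f x =
   \sum_(k < K) \int[mu]_(x in `](k%:R * h)%R, (k.+1%:R * h)%R]) f x)%E.
Proof.
move=> h0 mf f0; elim: K => [|K IH].
  by rewrite big_ord0 mul0r set_itv_ge ?bnd_simp ?ltxx// integral_set0.
rewrite big_ord_recr /= -IH.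
have -> : `]0%R, K.+1%:R * h]%classic = `]0%R, K%:R * h] `|` `]K%:R * h, K.+1%:R * h].
  rewrite -itv_bndbnd_setU// bnd_simp ?mulr_ge0// ler_wpM2r// ler_nat//.
rewrite ge0_integral_setU//=.
- exact: measurable_funTS.
- rewrite disj_set2E; apply/eqP/seteqP; split => // x [] /=.
  by rewrite !in_itv/= => /andP[_ xK] /andP[]; rewrite ltNge xK.
Qed.

End integral_partition.

Section upper_sums.
Context {R : realType}.
Notation mu := (@lebesgue_measure R).
Variables (l b : R) (alpha : R * R -> R).

(** On each cell [alpha] is frozen at the left end and raised by its oscillation [eps], and the
    derivative is replaced by the slope of the chord, which can only increase the integral of the
    concave [gamma]. *)
Definition usum (K : nat) (eps : R) (y : R -> R) : R :=
  let h := l / K%:R in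
  \sum_(k < K) (alpha (k%:R * h, y (k%:R * h)) + eps) *
    (h * gamma ((y (k.+1%:R * h) - y (k%:R * h)) / h)).

Hypothesis l0 : 0 < l.
Hypothesis cont : {within [set p | inQ l b p.1 p.2], continuous alpha}.
Hypothesis alpha0 : forall p : R * R, inQ l b p.1 p.2 -> 0 <= alpha p.

Lemma Xset_inQ (y : R -> R) (x : R) : Xset l b y -> x \in `[0, l] -> inQ l b x (y x).
Proof.
move=> [y0 [yl yL]] xl; move: (xl); rewrite in_itv/= => /andP[x0 xl'].
split; first by rewrite x0.
have l0' : 0 \in `[0, l] by rewrite in_itv/= lexx ltW.
have ll' : l \in `[0, l] by rewrite in_itv/= lexx ltW.
split.
  by have := yL x 0 xl l0'; rewrite y0 !subr0 (ger0_norm x0).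
by have := yL l x ll' xl; rewrite yl [leRHS]ger0_norm// subr_ge0.
Qed.

(** Replaces the possibly nonmeasurable integrand by a measurable one, built from a continuous [phi]
    and a bounded density [g]. All later estimates of the functional use the right-hand side, so the
    junk values of [derive1] do not come back. *)
Lemma Gfun_density (y : R -> R) : Xset l b y -> exists phi g : R -> R,
  [/\ continuous phi /\ (forall x, 0 <= phi x),
      {in `[0, l], forall x, phi x = alpha (x, y x)},
      measurable_fun setT g /\ (forall x, `|g x| <= 1),
      {ae mu, forall x, x \in `]0, l[ -> derivable y x 1 /\ derive1 y x = g x} /\
      (forall c e : R, 0 <= c -> c <= e -> e <= l ->
        (\int[mu]_(x in `]c, e]) (g x)%:E)%E = (y e - y c)%:E) &
      Gfun l alpha y = (\int[mu]_(x in `]0%R, l]) (phi x * gamma (g x))%:E)%E].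
Proof.
move=> Xy; have [y0 [yl yL]] := Xy.
have [g [mg g1 gae gint]] := lipschitz1_density l0 yL.
pose cl := clamp 0 l; have clin x := clamp_in x (ltW l0); have clid (x : R) : x \in `[0, l] -> cl x = x := @clamp_id _ 0 l x.
have cllip := clamp_lip (ltW l0).
pose phi x := alpha (cl x, y (cl x)).
have phic : continuous phi.
  move=> x; apply/cvgrPdist_le => e e0.
  have [r r0 H] := alpha_unif cont e0.
  near=> z.
  have zr : `|x - z| <= r by near: z; exists r => //= t /ltW.
  apply: H => /=.
  - exact: Xset_inQ.
  - exact: Xset_inQ.
  - exact: le_trans (cllip _ _) zr.
  - exact: le_trans (le_trans (yL _ _ (clin _) (clin _)) (cllip _ _)) zr.
have phi0 x : 0 <= phi x := alpha0 (p := (cl x, y (cl x))) (Xset_inQ Xy (clin x)).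
have mphi : measurable_fun setT (fun x => (phi x * gamma (g x))%:E).
  apply/measurable_EFinP; apply: measurable_funM; first exact: continuous_measurable_fun.
  apply: measurableT_comp => //; exact: (continuous_measurable_fun gamma_continuous).
exists phi, g; split => //; first by move=> x xl; rewrite /phi clid.
rewrite integral_itv_obnd_cbnd; last exact: measurable_funTS.
rewrite /Gfun; apply: ge0_ae_eq_integral_measurable_r => //.
- move=> x /= xl; rewrite lee_fin mulr_ge0 ?gamma_ge0//; apply: alpha0; exact: Xset_inQ.
- by move=> x _; rewrite lee_fin mulr_ge0 ?gamma_ge0.
- exact: measurable_funTS.
have h0 (c : R) : {ae mu, forall x, x <> c}.
  exists [set c]; split; [exact: measurable_set1|exact: lebesgue_measure_set1|].
  by move=> x /= /contrapT.
move: (h0 0) (h0 l) gae.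
apply: filterS3; first exact: (ae_filter_ringOfSetsType mu).
move=> x /= x0 xl H; rewrite in_itv/= => /andP[x0' xl'].
have xi : x \in `]0, l[.
  by rewrite in_itv/= !lt_neqAle x0' xl' !andbT; apply/andP; split; apply/eqP; [exact/nesym|].
by rewrite (H xi).2 /phi clid// in_itv/= x0'.
Unshelve. all: by end_near. Qed.

Lemma cell_in (K k : nat) : (0 < K)%N -> (k <= K)%N -> k%:R * (l / K%:R) \in `[0, l].
Proof.
move=> K0 kK; have K0' : 0 < K%:R :> R by rewrite ltr0n.
rewrite in_itv/= mulr_ge0 ?divr_ge0 ?(ltW l0)//= mulrCA ler_piMr ?(ltW l0)//.
by rewrite ler_pdivrMr// mul1r ler_nat.
Qed.

Lemma Xset_slope (y : R -> R) (K k : nat) : Xset l b y -> (k < K)%N ->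
  `|(y (k.+1%:R * (l / K%:R)) - y (k%:R * (l / K%:R))) / (l / K%:R)| <= 1.
Proof.
move=> [_ [_ yL]] kK; set h := l / K%:R; have K0 : (0 < K)%N by exact: leq_ltn_trans kK.
have h0 : 0 < h by rewrite divr_gt0// ltr0n.
rewrite normrM normfV (gtr0_norm h0) ler_pdivrMr// mul1r.
apply: le_trans (yL _ _ (cell_in K0 kK) (cell_in K0 (ltnW kK))) _.
by rewrite -mulrBl -natrB// subSnn mul1r gtr0_norm.
Qed.

(** Jensen's inequality on each cell, after [alpha] has been bounded by its value at the left end
    plus [eps]; the Lipschitz bound keeps the curve within one mesh width vertically as well. *)
Lemma Gfun_le_usum (K : nat) (eps : R) (y : R -> R) : (0 < K)%N -> 0 <= eps ->
  (forall p q : R * R, inQ l b p.1 p.2 -> inQ l b q.1 q.2 ->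
     `|p.1 - q.1| <= l / K%:R -> `|p.2 - q.2| <= l / K%:R -> `|alpha p - alpha q| <= eps) ->
  Xset l b y -> (Gfun l alpha y <= (usum K eps y)%:E)%E.
Proof.
move=> K0 eps0 Hu Xy.
have [phi [g [[phic phi0] phiE [mg g1] [gae gint] ->]]] := Gfun_density Xy.
have K0' : 0 < K%:R :> R by rewrite ltr0n.
set h := l / K%:R; have h0 : 0 < h by rewrite divr_gt0.
have mgam : measurable_fun setT (fun x => (gamma (g x))%:E).
  apply/measurable_EFinP; apply: measurableT_comp => //; exact: (continuous_measurable_fun gamma_continuous).
have mf : measurable_fun setT (fun x => (phi x * gamma (g x))%:E).
  apply/measurable_EFinP; apply: measurable_funM; first exact: continuous_measurable_fun.
  exact/measurable_EFinP.
have -> : `]0, l] = `]0, K%:R * h] by rewrite /h mulrC divfK// gt_eqF.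
rewrite ge0_integral_cells ?(ltW h0)//; last first.
  by move=> x; rewrite lee_fin mulr_ge0// gamma_ge0.
rewrite /usum -sumEFin; apply: lee_sum => k _.
set u := k%:R * h; set v := k.+1%:R * h.
have uv : v - u = h by rewrite /u /v -mulrBl -natrB// subSnn mul1r.
have uin : u \in `[0, l] by apply: cell_in => //; exact: ltnW.
have vin : v \in `[0, l] by exact: cell_in.
have [u0 ul] : 0 <= u /\ u <= l by move: uin; rewrite in_itv => /andP.
have [v0 vl] : 0 <= v /\ v <= l by move: vin; rewrite in_itv => /andP.
have lt_uv : u < v by lra.
have au0 : 0 <= alpha (u, y u) by apply: alpha0; exact: Xset_inQ.
have gint1 : mu.-integrable `]u, v] (EFin \o g).
  apply: measurable_bounded_integrable => //.
  - by rewrite /= lebesgue_measure_itv/= lte_fin lt_uv -EFinB ltry.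
  - exact: measurable_funTS.
  - by exists 1; split; rewrite ?num_real// => M M1 x _; exact: le_trans (g1 x) (ltW M1).
apply: (@le_trans _ _ ((alpha (u, y u) + eps)%:E * \int[mu]_(x in `]u, v]) (gamma (g x))%:E)%E).
  rewrite -ge0_integralZl//=; last 3 first.
  - exact: measurable_funTS.
  - by move=> x _; rewrite lee_fin gamma_ge0.
  - by rewrite lee_fin addr_ge0.
  apply: ge0_le_integral => //.
  - by move=> x _; rewrite lee_fin mulr_ge0// gamma_ge0.
  - exact: measurable_funTS.
  - by apply/measurable_EFinP; apply: measurable_funM => //; exact/measurable_EFinP/measurable_funTS.
  move=> x /=; rewrite in_itv/= => /andP[ux xv]; rewrite lee_fin ler_wpM2r ?gamma_ge0//.
  have xin : x \in `[0, l] by rewrite in_itv/=; apply/andP; split; lra.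
  rewrite phiE// -lerBlDl; apply: le_trans (ler_norm _) _; apply: Hu => /=.
  - exact: Xset_inQ.
  - exact: Xset_inQ.
  - by rewrite -/h ger0_norm; lra.
  - apply: le_trans (Xy.2.2 _ _ xin uin) _; rewrite -/h ger0_norm; lra.
rewrite EFinM lee_wpmul2l ?lee_fin ?addr_ge0//.
apply/lee_addgt0Pr => e e0.
have e'0 : 0 < e / h by rewrite divr_gt0.
have w1 : `|(y v - y u) / h| <= 1 by exact: Xset_slope.
(* Jensen by hand: an affine majorant almost touching [gamma] at the slope of the chord has an
   integral that depends only on the endpoints of the chord. *)
have [A [B [AB ABe]]] := gamma_tangent w1 e'0.
apply: (@le_trans _ _ (\int[mu]_(x in `]u, v]) (A%:E + B%:E * (g x)%:E))%E).
  apply: ge0_le_integral => //.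
  - by move=> x _; rewrite lee_fin gamma_ge0.
  - exact: measurable_funTS.
  - by apply/measurable_EFinP; apply: measurable_funD => //; apply: measurable_funM => //; exact: measurable_funTS.
  - by move=> x _; rewrite -EFinM -EFinD lee_fin; exact: AB.
rewrite integralD//=; last 2 first.
- by apply: integrable_cst_itv; rewrite lebesgue_measure_itv/= lte_fin lt_uv -EFinB ltry.
- exact: integrableZl.
rewrite integralZl// integral_cst//= lebesgue_measure_itv/= lte_fin lt_uv -EFinB uv.
rewrite gint ?(ltW lt_uv)//.
rewrite (_ : (A%:E * h%:E + B%:E * (y v - y u)%:E)%E = (A * h + B * (y v - y u))%:E)// -EFinD lee_fin.
have -> : A * h + B * (y v - y u) = h * (A + B * ((y v - y u) / h)).
  by field; rewrite gt_eqF.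
have -> : h * gamma ((y v - y u) / h) + e = h * (gamma ((y v - y u) / h) + e / h).
  by field; rewrite gt_eqF.
by rewrite ler_pM2l.
Qed.

(** The point [x] is in general not an endpoint of its mesh cell. As it lies between [u] and [v],
    the first-order errors at the two ends add up to at most [e * (v - u)]. *)
Lemma straddle (y : R -> R) (x d e : R) : 0 < e -> derivable y x 1 -> derive1 y x = d ->
  exists2 r : R, 0 < r & forall u v : R, u < x -> x <= v -> v - u < r ->
    `|(y v - y u) / (v - u) - d| <= e.
Proof.
move=> e0 dy dE.
have : h^-1 *: (y (h + x) - y x) @[h --> 0^'] --> d.
  rewrite -dE; move: dy; rewrite /derivable.
  by under eq_fun do rewrite /= /shift [_%:A]mulr1.
move=> /cvgrPdist_le /(_ e e0); rewrite near_withinE => -[r /= r0 H].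
have loc z : `|z - x| < r -> `|y z - y x - d * (z - x)| <= e * `|z - x|.
  have [->|zx] := eqVneq z x; first by rewrite !subrr mulr0 subrr normr0 mulr0.
  move=> zr; have zx0 : z - x != 0 by rewrite subr_eq0.
  have := H (z - x); rewrite /ball_/= sub0r normrN => /(_ zr zx0); rewrite subrK => Hz.
  have -> : y z - y x - d * (z - x) = - ((d - (z - x)^-1 *: (y z - y x)) * (z - x)).
    by rewrite /GRing.scale/=; field.
  by rewrite normrN normrM ler_wpM2r.
exists r => // u v ux xv vur.
have vu0 : 0 < v - u by lra.
have hu : `|y u - y x - d * (u - x)| <= e * (x - u).
  by apply: le_trans (loc u _) _; rewrite ltr0_norm ?subr_lt0//; lra.
have hv : `|y v - y x - d * (v - x)| <= e * (v - x).
  by apply: le_trans (loc v _) _; rewrite ger0_norm ?subr_ge0//; lra.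
have -> : (y v - y u) / (v - u) - d = (y v - y u - d * (v - u)) / (v - u).
  by field; rewrite gt_eqF.
rewrite normrM normfV (gtr0_norm vu0) ler_pdivrMr//.
move: hu hv; rewrite !ler_norml => /andP[? ?] /andP[? ?]; apply/andP; split; lra.
Qed.

(** The upper sum is the integral of a step function [st], which converges almost everywhere because
    the chord slopes tend to the derivative at each point of differentiability; dominated
    convergence concludes. *)
Lemma usum_cvg (K : nat -> nat) (eps : nat -> R) (y : R -> R) :
  (forall n, (0 < K n)%N) -> (forall n, 0 <= eps n <= 1) ->
  (l / (K n)%:R) @[n --> \oo] --> (0 : R) -> eps n @[n --> \oo] --> (0 : R) ->
  Xset l b y -> (usum (K n) (eps n) y)%:E @[n --> \oo] --> Gfun l alpha y.
Proof.
move=> K0 eps01 hcvg ecvg Xy.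
have [phi [g [[phic phi0] phiE [mg g1] [gae gint] ->]]] := Gfun_density Xy.
have K0' n : 0 < (K n)%:R :> R by rewrite ltr0n.
pose h n := l / (K n)%:R; have h0 n : 0 < h n by rewrite divr_gt0.
have lE n : l = (K n)%:R * h n by rewrite /h mulrC divfK// gt_eqF.
pose c n k := (alpha (k%:R * h n, y (k%:R * h n)) + eps n) *
    gamma ((y (k.+1%:R * h n) - y (k%:R * h n)) / h n).
pose cell n k := `]k%:R * h n, k.+1%:R * h n]%classic.
pose st n x := \sum_(k < K n) c n k * \1_(cell n k) x.
have stE n k x : (k < K n)%N -> cell n k x -> st n x = c n k.
  move=> kK kx; rewrite /st (bigD1 (Ordinal kK))//= indicE mem_set// mulr1 big1 ?addr0// => j jk.
  rewrite indicE memNset ?mulr0// => jx; move/eqP: jk; apply; apply: val_inj => /=.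
  exact: (@cell_unique R (h n) x).
have c0 n k : (k < K n)%N -> 0 <= c n k.
  move=> kK; rewrite mulr_ge0 ?gamma_ge0// addr_ge0//; last by case/andP: (eps01 n).
  by apply: alpha0; apply: Xset_inQ => //; apply: cell_in => //; exact: ltnW.
have st0 n x : 0 <= st n x by apply: sumr_ge0 => k _; rewrite mulr_ge0// c0.
have mst n : measurable_fun setT (fun x => (st n x)%:E).
  apply/measurable_EFinP; apply: measurable_sum => k; apply: measurable_funM => //.
  by apply: measurable_indic; exact: measurable_itv.
have -> : (fun n => (usum (K n) (eps n) y)%:E) =
    (fun n => \int[mu]_(x in `]0%R, l]) (st n x)%:E)%E.
  apply/funext => n; rewrite [in RHS](lE n) ge0_integral_cells ?(ltW (h0 n))//; last first.
    by move=> x; rewrite lee_fin.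
  rewrite /usum -sumEFin; apply: eq_bigr => k _.
  transitivity (\int[mu]_(x in cell n k) (c n k)%:E)%E; last first.
    by apply: eq_integral => x /[!inE] xk; rewrite (stE n k).
  rewrite /cell integral_cst//= lebesgue_measure_itv/= lte_fin ltr_pM2r// ltr_nat leqnn.
  by rewrite -EFinB -mulrBl -natrB// subSnn mul1r -EFinM /c; congr (_%:E); rewrite /h; ring.
have [M M0 HM] := alpha_bound cont.
have mf : measurable_fun setT (fun x => (phi x * gamma (g x))%:E).
  apply/measurable_EFinP; apply: measurable_funM; first exact: continuous_measurable_fun.
  apply: measurableT_comp => //; exact: (continuous_measurable_fun gamma_continuous).
(* The dominating constant combines [alpha <= M], [eps n <= 1] and [gamma <= 2]. *)
have := @dominated_convergence _ _ _ mu `]0, l]%classic (measurable_itv _)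
  (fun n x => (st n x)%:E) (fun x => (phi x * gamma (g x))%:E) (cst ((M + 1) * 2)%:E).
case.
- by move=> n; exact: measurable_funTS (mst n).
- exact: measurable_funTS mf.
- have hl : {ae mu, forall x, x <> l}.
    exists [set l]; split; [exact: measurable_set1|exact: lebesgue_measure_set1|].
    by move=> x /= /contrapT.
  move: hl gae; apply: filterS2; first exact: (ae_filter_ringOfSetsType mu).
  move=> x /= xl Hx; rewrite in_itv/= => /andP[x0 xl'].
  have xi : x \in `]0, l[ by rewrite in_itv/= x0/= lt_neqAle xl' andbT; apply/eqP.
  have [dy Dy] := Hx xi.
  have kex n : exists k, (k < K n)%N /\ k%:R * h n < x <= k.+1%:R * h n.
    by have := @cell_exists R (h n) x (K n) (h0 n) x0; rewrite -lE => /(_ xl')[k kK ?]; exists k.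
  have [k kP] := choice kex.
  have -> : (fun n => (st n x)%:E) = (fun n => (c n (k n))%:E).
    by apply/funext => n; rewrite (stE n (k n)) //; [exact: (kP n).1|rewrite /cell/= in_itv; exact: (kP n).2].
  apply: cvg_EFin; first by exact: nearW.
  have hu n : `|x - (k n)%:R * h n| <= h n.
    have [_ /andP[k1 k2]] := kP n.
    by move: k2; rewrite -addn1 natrD mulrDl mul1r => k2; rewrite ger0_norm; lra.
  have small (r : R) : 0 < r -> \forall n \near \oo, h n < r.
    move=> r0; have := hcvg => /cvgrPdist_lt /(_ r r0); apply: filterS => n.
    by rewrite sub0r normrN gtr0_norm; first by []; exact: h0.
  have uc : (k n)%:R * h n @[n --> \oo] --> x.
    apply/cvgrPdist_le => e e0; have := small e e0; apply: filterS => n he.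
    exact: le_trans (hu n) (ltW he).
  have phu : phi ((k n)%:R * h n) @[n --> \oo] --> phi x by exact: (cvg_comp _ _ uc (phic x)).
  have sl : (y ((k n).+1%:R * h n) - y ((k n)%:R * h n)) / h n @[n --> \oo] --> g x.
    apply/cvgrPdist_le => e e0; have [r r0 Hr] := straddle e0 dy Dy.
    have := small r r0; apply: filterS => n hr.
    have [_ /andP[k1 k2]] := kP n.
    have vu : (k n).+1%:R * h n - (k n)%:R * h n = h n by rewrite -mulrBl -natrB// subSnn mul1r.
    by have := Hr _ _ k1 k2; rewrite vu distrC; apply.
  have -> : fine \o (fun n => (c n (k n))%:E) = (fun n => (phi ((k n)%:R * h n) + eps n) *
     gamma ((y ((k n).+1%:R * h n) - y ((k n)%:R * h n)) / h n)).
    apply/funext => n; rewrite /= /c phiE//; apply: cell_in => //; exact: ltnW (kP n).1.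
  apply: cvgM; first by rewrite -[X in _ --> X]addr0; exact: cvgD.
  exact: (cvg_comp _ _ sl (@gamma_continuous R (g x))).
- by apply: integrable_cst_itv; rewrite lebesgue_measure_itv/= lte_fin l0 -EFinB ltry.
- apply: aeW => x n /=; rewrite in_itv/= => /andP[x0 xl].
  have := @cell_exists R (h n) x (K n) (h0 n) x0; rewrite -lE => /(_ xl)[k kK kx].
  rewrite (stE n k)//.
  rewrite lee_fin ger0_norm ?c0// /c; apply: ler_pM; rewrite ?gamma_ge0 ?gamma_le2//.
    apply: addr_ge0; last by case/andP: (eps01 n).
    by apply: alpha0; apply: Xset_inQ => //; apply: cell_in => //; exact: ltnW.
  apply: lerD; last by case/andP: (eps01 n).
  by apply: HM; apply: Xset_inQ => //; apply: cell_in => //; exact: ltnW.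
by move=> _ _.
Qed.

End upper_sums.

Lemma ultra_fmap (T S : Type) (F : set_system T) (f : T -> S) :
  UltraFilter F -> UltraFilter (f @ F).
Proof.
move=> UF; split; first exact: fmap_proper_filter.
move=> G PG FG; apply/seteqP; split => // A GA.
have [//|FA] := in_ultra_setVsetC (f @^-1` A) UF.
have GC : G (~` A) by exact: FG.
have : G (A `&` ~` A) by exact: filterI.
by rewrite setICr => /filter_not_empty.
Qed.

(** * Existence and stability of the maximizer *)

Section variational_problem.
Context {R : realType}.
Variables (l b : R) (alpha : R * R -> R).
Hypothesis l0 : 0 < l.
Hypothesis bl : `|b| < l.
Hypothesis cont : {within [set p | inQ l b p.1 p.2], continuous alpha}.
Hypothesis alpha0 : forall p : R * R, inQ l b p.1 p.2 -> 0 <= alpha p.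

Definition fine_mesh (K : nat) (eps : R) := forall p q : R * R,
  inQ l b p.1 p.2 -> inQ l b q.1 q.2 ->
  `|p.1 - q.1| <= l / K%:R -> `|p.2 - q.2| <= l / K%:R -> `|alpha p - alpha q| <= eps.

(** The requirement [n < K n] makes the mesh width tend to 0 even when [alpha] is constant. *)
Lemma fine_mesh_exists : exists K : nat -> nat, forall n,
  (n < K n)%N /\ fine_mesh (K n) n.+1%:R^-1.
Proof.
suff ex n : exists k, (n < k)%N /\ fine_mesh k n.+1%:R^-1 by have [f fP] := choice ex; exists f.
have [r r0 H] := alpha_unif cont (e := n.+1%:R^-1) ltac:(by rewrite invr_gt0).
pose K := (n + Num.bound (l / r)).+1.
exists K; split; first by rewrite /K ltnS leq_addr.
have lK : l / K%:R <= r.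
  rewrite ler_pdivrMr ?ltr0n// -ler_pdivrMl// mulrC; apply: ltW.
  have := archi_boundP (divr_ge0 (ltW l0) (ltW r0)) => /lt_le_trans; apply.
  by rewrite ler_nat /K leqW// leq_addl.
by move=> p q Qp Qq h1 h2; apply: H => //; exact: le_trans lK.
Qed.

(* The limit curve is taken along an ultrafilter, which makes every bounded real sequence converge. *)
Lemma Xset_ultra_cvg (y_ : nat -> R -> R) : (forall m, Xset l b (y_ m)) ->
  exists (U : set_system nat) (y : R -> R), [/\ UltraFilter U, \oo `<=` U, Xset l b y &
    forall x, x \in `[0, l] -> y_ m x @[m --> U] --> y x].
Proof.
move=> Xy.
have [U [UF UG]] := ultraFilterLemma (F := \oo) _.
have lim x : exists z : R, x \in `[0, l] -> y_ m x @[m --> U] --> z.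
  have [xl|_] := boolP (x \in `[0, l]); last by exists 0.
  have cp := @segment_compact R (- l) l.
  rewrite compact_ultra in cp.
  have Ux : U ((fun m => y_ m x) @^-1` `[- l, l]%classic).
    apply: filterE => m /=; rewrite in_itv/=.
    have [/andP[x0 xl'] [h _]] := Xset_inQ l0 (Xy m) xl.
    by move: h; rewrite ler_norml => /andP[? ?]; apply/andP; split; lra.
  by have [z [_ Hz]] := cp (y_ m x @[m --> U]) (ultra_fmap _ UF) Ux; exists z.
have [y yP] := choice lim.
exists U, y; split => //.
have l0' : 0 \in `[0, l] by rewrite in_itv/= lexx ltW.
have ll' : l \in `[0, l] by rewrite in_itv/= lexx ltW.
split; [|split].
- have := yP 0 l0'; under eq_fun do rewrite (Xy _).1.
  move=> /cvg_lim <-//; exact: (lim_cst).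
- have := yP l ll'; under eq_fun do rewrite (Xy _).2.1.
  move=> /cvg_lim <-//; exact: (lim_cst).
- move=> x1 x2 h1 h2.
  apply: (@closed_cvg _ _ _ _ _ [set u : R | u <= `|x1 - x2|] _ _ (`|y x1 - y x2|) (cvg_norm (cvgB (yP x1 h1) (yP x2 h2)))).
  + exact: closed_le.
  + by apply: nearW => m; exact: (Xy m).2.2.
Qed.

(** An upper sum reads the curve at finitely many points, hence is continuous for pointwise
    convergence; the functional itself is not. *)
Lemma usum_ultra_cvg (U : set_system nat) (y_ : nat -> R -> R) (y : R -> R) (K : nat) (eps : R) :
  ProperFilter U -> (0 < K)%N -> (forall m, Xset l b (y_ m)) -> Xset l b y ->
  (forall x, x \in `[0, l] -> y_ m x @[m --> U] --> y x) ->
  usum l alpha K eps (y_ m) @[m --> U] --> usum l alpha K eps y.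
Proof.
move=> FU K0 Xy_ Xy ycvg; apply: cvg_big => [|k _]; first exact: add_continuous.
have kin := cell_in l0 K0 (ltnW (ltn_ord k)).
have k1in := cell_in l0 K0 (ltn_ord k).
apply: cvgM.
  apply: cvgD; last exact: cvg_cst.
  apply/cvgrPdist_le => e e0; have [r r0 H] := alpha_unif cont e0.
  have /cvgrPdist_le /(_ r r0) := ycvg _ kin; apply: filterS => m hm.
  apply: H => //=.
  - exact: Xset_inQ.
  - exact: Xset_inQ.
  - by rewrite subrr normr0 ltW.
apply: cvgM; first exact: cvg_cst.
have sl : (y_ m (k.+1%:R * (l / K%:R)) - y_ m (k%:R * (l / K%:R))) / (l / K%:R) @[m --> U] -->
    (y (k.+1%:R * (l / K%:R)) - y (k%:R * (l / K%:R))) / (l / K%:R).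
  by apply: cvgM; [apply: cvgB; exact: ycvg|exact: cvg_cst].
exact: (cvg_comp _ _ sl (@gamma_continuous R _)).
Qed.

Lemma Xset_nonempty : Xset l b (fun x => x * (b / l)).
Proof.
split; first by rewrite mul0r.
split; first by rewrite mulrC divfK// gt_eqF.
move=> x1 x2 _ _; rewrite -mulrBl normrM ler_piMr//.
by rewrite normrM normfV (gtr0_norm l0) ler_pdivrMr// mul1r ltW.
Qed.

Section mesh_sequence.
Variable K : nat -> nat.
Hypothesis KP : forall n, (n < K n)%N /\ fine_mesh (K n) n.+1%:R^-1.
Let S n (y : R -> R) := usum l alpha (K n) n.+1%:R^-1 y.

Lemma Gfun_le_usum_mesh n y : Xset l b y -> (Gfun l alpha y <= (S n y)%:E)%E.
Proof.
move=> Xy; have [Kn HK] := KP n.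
by apply: (Gfun_le_usum l0 cont alpha0) => //; exact: leq_ltn_trans Kn.
Qed.

Lemma usum_mesh_cvg y : Xset l b y -> (S n y)%:E @[n --> \oo] --> Gfun l alpha y.
Proof.
move=> Xy; apply: (usum_cvg l0 cont alpha0) => //.
- by move=> n; exact: leq_ltn_trans (KP n).1.
- by move=> n; rewrite invr_ge0 ler0n/= invf_le1 ?ltr0n// ler1n.
- apply/cvgrPdist_le => e e0; near=> n.
  have K0 : 0 < (K n)%:R :> R by rewrite ltr0n; exact: leq_ltn_trans (KP n).1.
  rewrite sub0r normrN gtr0_norm ?divr_gt0// ler_pdivrMr// mulrC -ler_pdivrMr//.
  apply: (@le_trans _ _ n%:R); last by rewrite ler_nat ltnW// (KP n).1.
  by near: n; exact: nbhs_infty_ger.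
- exact: cvg_harmonic.
Unshelve. all: by end_near. Qed.

Lemma Gfun_ge0 y : Xset l b y -> (0 <= Gfun l alpha y)%E.
Proof.
move=> Xy; apply: integral_ge0 => x xl; rewrite lee_fin mulr_ge0 ?gamma_ge0//.
by apply: alpha0; exact: Xset_inQ.
Qed.

Lemma Gfun_fin y : Xset l b y -> Gfun l alpha y \is a fin_num.
Proof.
move=> Xy; rewrite ge0_fin_numE ?Gfun_ge0//.
exact: le_lt_trans (Gfun_le_usum_mesh 0 Xy) (ltry _).
Qed.

(** Upper semicontinuity in the form used below: first [m] runs along the ultrafilter with [n]
    fixed, which continuity of [S n] permits, and then [n] tends to infinity. It serves both for
    existence and for stability. *)
Lemma Gfun_compact (y_ : nat -> R -> R) (M : R) : (forall m, Xset l b (y_ m)) ->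
  (forall n m, (n <= m)%N -> M - m.+1%:R^-1 <= S n (y_ m)) ->
  exists (U : set_system nat) (y : R -> R), [/\ UltraFilter U, \oo `<=` U, Xset l b y,
    (forall x, x \in `[0, l] -> y_ m x @[m --> U] --> y x) & (M%:E <= Gfun l alpha y)%E].
Proof.
move=> Xy_ HM; have [U [y [UU Uoo Xy ycvg]]] := Xset_ultra_cvg Xy_.
exists U, y; split => //.
have MS n : M <= S n y.
  have K0 : (0 < K n)%N by exact: leq_ltn_trans (KP n).1.
  suff MSe (e : R) : 0 < e -> M <= S n y + e by apply/ler_addgt0Pr.
  move=> e0.
  have e20 : 0 < e / 2 by rewrite divr_gt0.
  have Sc : S n (y_ m) @[m --> U] --> S n y by exact: usum_ultra_cvg.
  move/cvgrPdist_lt : Sc => /(_ _ e20) H1.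
  have H2 : U [set m | (n <= m)%N /\ m.+1%:R^-1 < e / 2].
    apply: Uoo; apply: filterI; first exact: nbhs_infty_ge.
    have /cvgrPdist_lt /(_ _ e20) := @cvg_harmonic R.
    by apply: filterS => m; rewrite sub0r normrN ger0_norm ?invr_ge0.
  have [m [/= h1 [h2 h3]]] := filter_ex (filterI H1 H2).
  have := HM n m h2; rewrite lerBlDr => /le_trans; apply.
  have /ltW h4 : S n (y_ m) < S n y + e / 2.
    by rewrite -ltrBlDl; apply: le_lt_trans h1; rewrite distrC ler_norm.
  by apply: le_trans (lerD h4 (ltW h3)) _; rewrite -addrA -splitr.
have := usum_mesh_cvg Xy; move=> /cvg_lim <-//.
apply: lime_ge; first by apply/cvg_ex; eexists; exact: usum_mesh_cvg.
by apply: nearW => n; rewrite lee_fin.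
Qed.

Lemma maximizer_exists : exists y, Xset l b y /\
  Gfun l alpha y = ereal_sup [set Gfun l alpha y | y in Xset l b].
Proof.
set G := [set _ | _ in _].
have [M M0 HM] := alpha_bound cont.
have K0 : (0 < K 0)%N by exact: leq_ltn_trans (KP 0).1.
have G0 : exists G0 : R, forall y, Xset l b y -> (Gfun l alpha y <= G0%:E)%E.
  exists (\sum_(k < K 0) (M + 1^-1) * (l / (K 0)%:R * 2)) => y Xy.
  apply: le_trans (Gfun_le_usum_mesh 0 Xy) _; rewrite lee_fin; apply: ler_sum => k _.
  have kin := cell_in l0 K0 (ltnW (ltn_ord k)).
  have hK : 0 <= l / (K 0)%:R by rewrite divr_ge0// ltW.
  apply: ler_pM.
  - by rewrite addr_ge0 ?invr_ge0//; apply: alpha0; exact: Xset_inQ.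
  - by rewrite mulr_ge0// gamma_ge0.
  - by rewrite lerD2r; apply: HM; exact: Xset_inQ.
  - by rewrite ler_wpM2l// gamma_le2.
have [g0 Hg0] := G0.
have sup0 : (ereal_sup G <= g0%:E)%E by apply: ge_ereal_sup => _ [y Xy <-]; exact: Hg0.
have Gfin : ereal_sup G \is a fin_num.
  rewrite fin_numElt (le_lt_trans sup0) ?ltry// andbT.
  apply: (@lt_le_trans _ _ (Gfun l alpha (fun x => x * (b / l)))).
    by apply: lt_le_trans (Gfun_ge0 Xset_nonempty); rewrite ltNye.
  by apply: ereal_sup_ubound; exists (fun x => x * (b / l)) => //; exact: Xset_nonempty.
have ex m : exists y, Xset l b y /\ ((fine (ereal_sup G) - m.+1%:R^-1)%:E <= Gfun l alpha y)%E.
  have m0 : 0 < m.+1%:R^-1 :> R by rewrite invr_gt0.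
  have [_ [y Xy <-] hy] := ub_ereal_sup_adherent m0 Gfin.
  by exists y; split => //; rewrite EFinB fineK// ltW.
have [y_ yP] := choice ex.
have HS n m : (n <= m)%N -> fine (ereal_sup G) - m.+1%:R^-1 <= S n (y_ m).
  move=> _; rewrite -lee_fin; exact: le_trans (yP m).2 (Gfun_le_usum_mesh n (yP m).1).
have [U [y [_ _ Xy _ Gy]]] := Gfun_compact (fun m => (yP m).1) HS.
exists y; split => //; apply/eqP; rewrite eq_le; apply/andP; split.
  by apply: ereal_sup_ubound; exists y.
by rewrite fineK in Gy.
Qed.

(** By contradiction with [eta = m.+1%:R^-1] and [n0 = m]: the counterexamples accumulate at a curve
    with maximal value, hence at [ys], while staying [delta] away from it. The point is that
    finitely many sums detect every distant curve, with one common gap. *)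
Lemma maximizer_stable (ys : R -> R) (delta : R) : 0 < delta -> Xset l b ys ->
  (forall y, Xset l b y -> (Gfun l alpha ys <= Gfun l alpha y)%E ->
     forall x, x \in `[0, l] -> y x = ys x) ->
  exists (eta : R) (n0 : nat), 0 < eta /\ forall y, Xset l b y ->
    (exists2 x, x \in `[0, l] & delta <= `|y x - ys x|) ->
    exists2 n, (n <= n0)%N & S n y <= fine (Gfun l alpha ys) - eta.
Proof.
move=> d0 Xys uniq; apply: contrapT => /forallNP H.
have ex m : exists y, [/\ Xset l b y, (exists2 x, x \in `[0, l] & delta <= `|y x - ys x|) &
   forall n, (n <= m)%N -> fine (Gfun l alpha ys) - m.+1%:R^-1 <= S n y].
  have /forallNP/(_ m) := H m.+1%:R^-1.
  move/not_andP => []; first by rewrite invr_gt0.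
  move=> /existsNP[y /not_implyP[Xy /not_implyP[hx /forall2NP hn]]]; exists y; split => // n nm.
  by have [//|/negP] := hn n; rewrite -ltNge => /ltW.
have [y_ yP] := choice ex.
have [U [y [UU Uoo Xy ycvg MG]]] := Gfun_compact (fun m => let: And3 a _ _ := yP m in a)
  (fun n m => let: And3 _ _ c := yP m in c n).
rewrite fineK ?Gfun_fin// in MG.
have ye := uniq y Xy MG.
have [x_ xP] : exists x_ : nat -> R, forall m, x_ m \in `[0, l] /\ delta <= `|y_ m (x_ m) - ys (x_ m)|.
  suff exx m : exists x : R, x \in `[0, l] /\ delta <= `|y_ m x - ys x| by have [f fP] := choice exx; exists f.
  by have [_ [x ? ?] _] := yP m; exists x.
(* The places [x_ m] of large deviation are made to converge too, along the same ultrafilter. The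
   Lipschitz bounds move the deviation to the limit [z], where three errors below [delta / 4]
   contradict it. *)
have cp := @segment_compact R 0 l.
rewrite compact_ultra in cp.
have Ux : U (x_ @^-1` `[0, l]%classic) by apply: filterE => m /=; exact: (xP m).1.
have [z [/= zl Hz]] := cp (x_ m @[m --> U]) (ultra_fmap _ UU) Ux.
have d4 : 0 < delta / 4 by rewrite divr_gt0.
have /cvgrPdist_lt /(_ _ d4) H1 := Hz.
have /cvgrPdist_lt /(_ _ d4) H2 := ycvg z zl.
have [m [/= h1 h2]] := filter_ex (filterI H1 H2).
have [xm hm] := xP m.
have [Xm _ _] := yP m.
have a1 := Xm.2.2 _ _ xm zl; have a2 := Xys.2.2 _ _ xm zl.
rewrite (ye z zl) in h2.
have t1 := ler_distD (y_ m z) (y_ m (x_ m)) (ys (x_ m)).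
have t2 := ler_distD (ys z) (y_ m z) (ys (x_ m)).
rewrite (distrC z) in h1; rewrite distrC in h2; rewrite (distrC (ys (x_ m))) in a2.
lra.
Qed.

End mesh_sequence.

End variational_problem.

(** * Exponential variables and independence *)

Section density.
Context d (T : measurableType d) (R : realType).
Variables (mu nu : {measure set T -> \bar R}) (g : T -> R).
Hypotheses (g0 : forall x, 0 <= g x) (mg : measurable_fun setT g).
Hypothesis nuE : forall A, measurable A -> (nu A = \int[mu]_(x in A) (g x)%:E)%E.
Import HBNNSimple.

Lemma ge0_integral_density (f : T -> R) : measurable_fun setT f ->
  (forall x, 0 <= f x) -> (\int[nu]_x (f x)%:E = \int[mu]_x (f x * g x)%:E)%E.
Proof.
move=> /measurable_EFinP mf f0.
pose f_ := nnsfun_approx measurableT mf.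
have mgE : measurable_fun setT (fun x => (g x)%:E) by exact/measurable_EFinP.
transitivity (limn (fun n => \int[nu]_x (f_ n x)%:E))%E.
  rewrite -monotone_convergence//.
  - apply: eq_integral => y _; apply/esym/cvg_lim => //.
    by apply: cvg_nnsfun_approx => // x _; rewrite lee_fin.
  - by move=> n; exact/measurable_EFinP/measurable_funP.
  - by move=> n y _; rewrite lee_fin.
  - by move=> y _ m n mn; rewrite lee_fin; exact/lefP/nd_nnsfun_approx.
transitivity (limn (fun n => \int[mu]_x ((f_ n x)%:E * (g x)%:E)))%E; last first.
  rewrite -monotone_convergence//.
  - apply: eq_integral => y _; apply/cvg_lim => //.
    rewrite EFinM; apply: cvgeM; last exact: cvg_cst.
    + exact: mule_def_fin.
    + by apply: cvg_nnsfun_approx => // x _; rewrite lee_fin.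
  - move=> n; apply: emeasurable_funM => //.
    exact/measurable_EFinP/measurable_funP.
  - by move=> n y _; rewrite mule_ge0 ?lee_fin.
  - move=> y _ m n mn; rewrite lee_wpmul2r ?lee_fin//.
    exact/lefP/nd_nnsfun_approx.
congr (limn _); apply/funext => n.
under eq_integral do rewrite fimfunE -fsumEFin//.
rewrite ge0_integral_fsum//; last 2 first.
- by move=> y; exact/measurable_EFinP/measurable_funM.
- by move=> y x _; rewrite nnfun_muleindic_ge0.
under [in RHS]eq_integral.
  move=> x _; rewrite fimfunE -fsumEFin// ge0_mule_fsuml; last first.
    by move=> i; rewrite nnfun_muleindic_ge0.
  over.
rewrite ge0_integral_fsum//; last 2 first.
- move=> y; apply: emeasurable_funM => //.
  exact/measurable_EFinP/measurable_funM.
- by move=> y x _; rewrite mule_ge0 ?nnfun_muleindic_ge0 ?lee_fin.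
apply: eq_fsbigr => r rf; rewrite integralZl_indic_nnsfun// integral_indic//= setIT.
rewrite nuE// integral_mkcond.
under [in RHS]eq_integral do rewrite EFinM -muleA.
have r0 : 0 <= r by move: rf; rewrite inE => -[x _ <-].
rewrite ge0_integralZl//; last 2 first.
- by apply: emeasurable_funM => //; exact/measurable_EFinP.
- by move=> x _; rewrite mule_ge0// lee_fin.
congr (_ * _)%E; apply: eq_integral => x _; rewrite patchE indicE.
by case: ifPn => _; rewrite ?mul1e ?mul0e.
Qed.

End density.

Section exponential_law.
Context {R : realType}.
Implicit Types (a t : R).

Lemma exponential_prob_ge a t : 0 < a -> 0 <= t ->
  exponential_prob a `[t, +oo[%classic = (expR (- a * t))%:E.
Proof.
move=> a0 t0; rewrite /exponential_prob.
have c : continuous (fun z : R^o => expR (- a * z)).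
  move=> z; apply: continuous_comp; last exact: continuous_expR.
  by apply: continuousM => //; apply: (@continuousN _ R^o); exact: cst_continuous.
rewrite (@ge0_continuous_FTC2y _ _ (fun x => - (expR (- a * x))) _ 0)//.
- by rewrite EFinN oppeK add0e.
- by move=> x _; apply: exponential_pdf_ge0; exact: ltW.
- apply: (@continuous_subspaceW R^o _ _ [set` `[0, +oo[%R]).
  + by apply: subset_itvr; rewrite bnd_simp.
  + exact: within_continuous_exponential_pdf.
- rewrite -oppr0; apply: cvgN.
  rewrite (_ : (fun x => expR (- a * x)) =
               (fun z => expR (- z)) \o (fun z => a * z)); last first.
    by apply: eq_fun => x; rewrite mulNr.
  apply: (@cvg_comp _ _ _ _ _ _ (pinfty_nbhs R)); last exact: cvgr_expR.
  exact: gt0_cvgMry.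
- by apply: cvgN; apply/cvg_at_right_filter; exact: c.
- move=> z; rewrite in_itv/= andbT => tz; apply: derive1_exponential_pdf.
  by rewrite in_itv/= andbT (le_lt_trans t0).
Qed.

Lemma exponential_prob_gt a t : 0 < a -> 0 <= t ->
  exponential_prob a `]t, +oo[%classic = (expR (- a * t))%:E.
Proof.
move=> a0 t0; rewrite -exponential_prob_ge// /exponential_prob.
rewrite integral_itv_obnd_cbnd//.
apply: measurable_funTS; apply/measurable_EFinP.
exact: measurable_exponential_pdf.
Qed.

Lemma exponential_prob_gt_neg a t : 0 < a -> t <= 0 ->
  exponential_prob a `]t, +oo[%classic = 1%E.
Proof.
move=> a0 t0; apply/eqP; rewrite eq_le; apply/andP; split.
  rewrite -(integral_exponential_pdf a0) /exponential_prob.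
  apply: ge0_subset_integral => //.
    by apply/measurable_EFinP; exact: measurable_exponential_pdf.
  by move=> x _; rewrite lee_fin exponential_pdf_ge0// ltW.
rewrite -[leLHS](_ : exponential_prob a `]0, +oo[%classic = 1%E); last first.
  by rewrite exponential_prob_gt// mulr0 expR0.
apply: ge0_subset_integral => //.
- apply/measurable_EFinP/measurable_funTS; exact: measurable_exponential_pdf.
- by move=> x _; rewrite lee_fin exponential_pdf_ge0// ltW.
- by apply: subset_itvr; rewrite bnd_simp.
Qed.

(** Open rays form a generating pi-system, and the tail at 0 gives [0 < X] almost surely, which
    settles the rays with negative endpoint. *)
Lemma exponential_law d (T : measurableType d) (P : probability T R) (X : T -> R) a :
  0 < a -> measurable_fun setT X ->
  (forall t : R, 0 <= t -> P [set w | t < X w] = (expR (- a * t))%:E) ->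
  forall A, measurable A -> P (X @^-1` A) = exponential_prob a A.
Proof.
move=> a0 mX Xt A mA.
have Xr t : P (X @^-1` `]t, +oo[%classic) = exponential_prob a `]t, +oo[%classic.
  have -> : X @^-1` `]t, +oo[%classic = [set w | t < X w].
    by apply/seteqP; split => w /=; rewrite in_itv/= andbT.
  have [t0|t0] := leP 0 t; first by rewrite Xt// exponential_prob_gt.
  rewrite exponential_prob_gt_neg ?ltW//; apply/eqP; rewrite eq_le.
  have mXt u : measurable [set w | u < X w].
    rewrite (_ : [set w | _] = setT `&` X @^-1` `]u, +oo[%classic); first exact: mX.
    by apply/seteqP; split => w /=; rewrite in_itv/= andbT// => -[].
  rewrite probability_le1//=.
  rewrite -[leLHS](_ : P [set w | 0 < X w] = 1%E); last by rewrite Xt// mulr0 expR0.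
  by apply: le_measure; rewrite ?inE// => w /=; exact: lt_trans.
pose X' : T -> measurableTypeR R := X.
have mX' : measurable_fun setT X' by exact: mX.
have := @measure_unique _ R (measurableTypeR R) (@RGenOInfty.G R)
  (fun n => `](- n%:R), +oo[%classic) (RGenOInfty.measurableE R) _ _ _
  (distribution P (mfun_Sub (mem_set mX'))) (exponential_prob a).
apply => //.
- move=> _ _ [x ->] [y ->]; exists (Num.max x y).
  by apply/seteqP; split => z /=; rewrite !in_itv/= !andbT gt_max => /andP.
- by move=> n; eexists; reflexivity.
- apply/seteqP; split => // x _; exists (Num.truncn `|x|).+1 => //=.
  rewrite in_itv/= andbT ltrNl (le_lt_trans (ler_norm _))// normrN.
  exact: truncnS_gt.
- by move=> _ [t ->]; exact: Xr.
- by move=> k; rewrite (le_lt_trans (probability_le1 _ _)) ?ltry.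
Qed.

Lemma exponential_expect d (T : measurableType d) (P : probability T R)
    (X : T -> R) a (f : R -> R) :
  0 < a -> measurable_fun setT X ->
  (forall t : R, 0 <= t -> P [set w | t < X w] = (expR (- a * t))%:E) ->
  measurable_fun setT f -> (forall x, 0 <= f x) ->
  (\int[P]_w (f (X w))%:E =
   \int[@lebesgue_measure R]_x (f x * exponential_pdf a x)%:E)%E.
Proof.
move=> a0 mX Xt mf f0.
pose X' : T -> measurableTypeR R := X.
have mX' : measurable_fun setT X' by exact: mX.
rewrite -(@ge0_integral_density _ (measurableTypeR R) R (@lebesgue_measure R)
  (distribution P (mfun_Sub (mem_set mX')))) //.
- rewrite (@ge0_integral_distribution _ _ _ (measurableTypeR R) _ P
    (mfun_Sub (mem_set mX')) (fun x => (f x)%:E))//.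
  exact/measurable_EFinP.
- by move=> x; apply: exponential_pdf_ge0; exact: ltW.
- exact: measurable_exponential_pdf.
- by move=> A mA; exact: exponential_law.
Qed.

(** Exponential tilting: [expR (th * x)] times the density of rate [a] is [a / (a - th)] times the
    density of rate [a - th]. It yields the moment generating function for [A = setT], and the race
    of two exponentials when [A] is a ray. *)
Lemma exponential_expect_expR d (T : measurableType d) (P : probability T R)
    (X : T -> R) a th (A : set R) :
  0 < a -> th < a -> measurable_fun setT X ->
  (forall t : R, 0 <= t -> P [set w | t < X w] = (expR (- a * t))%:E) ->
  measurable A ->
  (\int[P]_w (expR (th * X w) * \1_A (X w))%:E =
   (a / (a - th))%:E * exponential_prob (a - th) A)%E.
Proof.
move=> a0 tha mX Xt mA; have ath : 0 < a - th by rewrite subr_gt0.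
have mexp : measurable_fun setT (fun x : R => expR (th * x)).
  by apply: measurableT_comp => //; exact: mulrl_measurable.
rewrite (@exponential_expect _ _ P X a (fun x => expR (th * x) * \1_A x))//.
- rewrite /exponential_prob -ge0_integralZl; last 4 first.
  + exact: mA.
  + apply/measurable_EFinP/measurable_funTS; exact: measurable_exponential_pdf.
  + by move=> x _; rewrite lee_fin exponential_pdf_ge0// ltW.
  + by rewrite lee_fin divr_ge0// ltW.
  rewrite [in RHS]integral_mkcond; apply: eq_integral => x _.
  rewrite patchE indicE; case: ifPn => xA; last by rewrite mulr0 mul0r.
  rewrite mulr1 -EFinM; congr EFin.
  have [x0|x0] := ltP x 0; first by rewrite !lt0_exponential_pdf// !mulr0.
  rewrite !exponential_pdfE// [RHS]mulrA divfK ?gt_eqF// mulrCA -expRD.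
  by congr (_ * expR _); ring.
- by apply: measurable_funM => //; exact: measurable_indic.
Qed.

End exponential_law.

(** * Independence of pairs and of finite families *)

Section independence.
Context d (T : measurableType d) (R : realType) (P : probability T R).
Local Open Scope ereal_scope.

(** Both sides are finite measures as functions of [D], so agreement on a generating pi-system that
    covers the space suffices. *)
Lemma indep_ext d' (U : measurableType d') (Z : T -> U) (G : set (set U))
    (g : (set U)^nat) (A : set T) : measurable_fun setT Z -> measurable = <<s G >> ->
  setI_closed G -> (forall n, G (g n)) -> \bigcup_n g n = setT -> measurable A ->
  (forall D, G D -> P (A `&` Z @^-1` D) = P A * P (Z @^-1` D)) ->
  forall D, measurable D -> P (A `&` Z @^-1` D) = P A * P (Z @^-1` D).
Proof.
move=> mZ mG GI Gg gT mA h D mD.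
have PA0 : (0 <= fine (P A))%R by rewrite fine_ge0.
pose Z' := mfun_Sub (mem_set mZ) : {mfun T >-> U}.
have := @measure_unique _ R U G g mG GI Gg gT
  (pushforward (mrestr P mA) Z') (mscale (NngNum PA0) (distribution P Z')).
have mscE B : mscale (NngNum PA0) (distribution P Z') B = P A * P (Z @^-1` B).
  by rewrite /mscale/= fineK// fin_num_measure.
have mrE B : pushforward (mrestr P mA) Z' B = P (A `&` Z @^-1` B).
  by rewrite /pushforward /mrestr/= setIC.
move=> H; rewrite -mrE -mscE; apply: H => //=.
- by move=> B GB; rewrite mrE mscE; exact: h.
- move=> k; rewrite mrE (le_lt_trans (probability_le1 _ _)) ?ltry//.
  apply: measurableI => //; rewrite -[X in measurable X]setTI.
  by have := mZ measurableT (g k); apply; rewrite mG; exact: sub_sigma_algebra.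
Qed.

Lemma indep_pair d1 d2 (U : measurableType d1) (V : measurableType d2)
    (X : T -> U) (Y : T -> V) (A : set T) :
  measurable_fun setT X -> measurable_fun setT Y -> measurable A ->
  (forall B1 B2, measurable B1 -> measurable B2 ->
     P (A `&` (X @^-1` B1 `&` Y @^-1` B2)) = P A * P (X @^-1` B1 `&` Y @^-1` B2)) ->
  forall D, measurable D -> P (A `&` (fun w => (X w, Y w)) @^-1` D) =
     P A * P ((fun w => (X w, Y w)) @^-1` D).
Proof.
move=> mX mY mA h; apply: (indep_ext (g := fun=> setT) _ (measurable_prod_measurableType _ _)) => //.
- exact/measurable_fun_pair.
- move=> _ _ [A1 mA1 [B1 mB1 <-]] [A2 mA2 [B2 mB2 <-]]; rewrite -setXI.
  by exists (A1 `&` A2); [exact: measurableI|exists (B1 `&` B2) => //; exact: measurableI].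
- by move=> _; exists setT => //; exists setT => //; rewrite setXTT.
- exact: bigcup_const.
- by move=> _ [B1 mB1 [B2 mB2 <-]]; exact: h.
Qed.

Definition indep2 d1 d2 (U : measurableType d1) (V : measurableType d2)
    (X : T -> U) (Y : T -> V) := forall B1 B2, measurable B1 -> measurable B2 ->
  P (X @^-1` B1 `&` Y @^-1` B2) = P (X @^-1` B1) * P (Y @^-1` B2).

Lemma indep2_law d1 d2 (U : measurableType d1) (V : measurableType d2)
    (X : {mfun T >-> U}) (Y : {mfun T >-> V}) : indep2 X Y ->
  forall D, measurable D -> P ((fun w => (X w, Y w)) @^-1` D) =
     (distribution P X \x distribution P Y) D.
Proof.
move=> XY D mD.
have mXY : measurable_fun setT (fun w => (X w, Y w)).
  exact/measurable_fun_pair.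
have := @product_measure_unique _ _ U V R (distribution P X) (distribution P Y)
  (distribution P (mfun_Sub (mem_set mXY))).
by move=> -> //= B1 B2 mB1 mB2; exact: XY.
Qed.

Lemma indep2_expect d1 d2 (U : measurableType d1) (V : measurableType d2)
    (X : T -> U) (Y : T -> V) (f : U -> R) (g : V -> R) :
  measurable_fun setT X -> measurable_fun setT Y -> indep2 X Y ->
  measurable_fun setT f -> measurable_fun setT g ->
  (forall x, 0 <= f x)%R -> (forall x, 0 <= g x)%R ->
  \int[P]_w (f (X w) * g (Y w))%:E = \int[P]_w (f (X w))%:E * \int[P]_w (g (Y w))%:E.
Proof.
move=> mX mY XY mf mg f0 g0.
pose X' := mfun_Sub (mem_set mX) : {mfun T >-> U}.
pose Y' := mfun_Sub (mem_set mY) : {mfun T >-> V}.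
have mXY : measurable_fun setT (fun w => (X w, Y w)).
  exact/measurable_fun_pair.
pose Z' := mfun_Sub (mem_set mXY) : {mfun T >-> (U * V)%type}.
have mfg : measurable_fun setT (fun z : U * V => (f z.1 * g z.2)%:E).
  by apply/measurable_EFinP; apply: measurable_funM; apply: measurableT_comp.
rewrite -(@ge0_integral_distribution _ _ _ _ _ P Z' (fun z => (f z.1 * g z.2)%:E))//; last first.
  by move=> y; rewrite lee_fin mulr_ge0.
rewrite (eq_measure_integral (distribution P X' \x distribution P Y')); last first.
  by move=> D mD _; exact: (@indep2_law _ _ U V X' Y').
rewrite fubini_tonelli1//; last by move=> y; rewrite lee_fin mulr_ge0.
rewrite /fubini_F/=.
under eq_integral => x _.
  under eq_integral do rewrite EFinM.
  rewrite ge0_integralZl//; last 3 first.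
  - exact/measurable_EFinP.
  - by move=> y _; rewrite lee_fin.
  - by rewrite lee_fin.
  over.
rewrite ge0_integralZr//; last 3 first.
- exact/measurable_EFinP.
- by move=> y _; rewrite lee_fin.
- by apply: integral_ge0 => y _; rewrite lee_fin.
by rewrite !ge0_integral_distribution//; exact/measurable_EFinP.
Qed.

End independence.

Section mutual_independence.
Context d (T : measurableType d) (R : realType) (P : probability T R).
Context {I : eqType}.
Implicit Types (S : {pred I}) (Z : I -> T -> R) (B : I -> set R) (s r : seq I).
Local Open Scope ereal_scope.

Definition box Z s B : set T := \bigcap_(p in [set` s]) (Z p @^-1` B p).

Definition mutind S Z := forall s B, uniq s -> {subset s <= S} ->
  (forall p, measurable (B p)) ->
  P (box Z s B) = \prod_(p <- s) P (Z p @^-1` B p).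

Lemma box_nil Z B : box Z [::] B = setT.
Proof. by apply/seteqP; split => // w _ p. Qed.

Lemma box_cons Z p s B : box Z (p :: s) B = Z p @^-1` B p `&` box Z s B.
Proof.
apply/seteqP; split => w.
  move=> h; split; first by apply: h => /=; rewrite inE eqxx.
  by move=> q qs; apply: h => /=; rewrite inE; apply/orP; right.
by move=> [h1 h2] q /=; rewrite inE => /orP[/eqP->//|]; exact: h2.
Qed.

Lemma eq_box Z Z' s B B' : {in s, forall p, Z p @^-1` B p = Z' p @^-1` B' p} ->
  box Z s B = box Z' s B'.
Proof. by move=> h; apply: eq_bigcapr => p /= ps; exact: h. Qed.

Lemma measurable_box Z s B : {in s, forall p, measurable_fun setT (Z p)} ->
  (forall p, measurable (B p)) -> measurable (box Z s B).
Proof.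
elim: s => [|p s IH] mZ mB; first by rewrite box_nil.
rewrite box_cons; apply: measurableI.
  rewrite -[X in measurable X]setTI; apply: mZ => //; exact: mem_head.
by apply: IH => // q qs; apply: mZ; rewrite inE qs orbT.
Qed.

Definition upd2 (a b : I) (U V : T -> R) Z : I -> T -> R :=
  fun i => if i == a then U else if i == b then V else Z i.

(** Made for one cell of the Burke evolution: the variables at [a] and [b] are replaced by functions
    of the triple, and the index [c] is dropped because its randomness has been spent on them. *)
Lemma mutind_upd2 S Z a b c (phi psi : R * (R * R) -> R) :
  mutind S Z -> {in S, forall p, measurable_fun setT (Z p)} ->
  uniq [:: a; b; c] -> a \in S -> b \in S -> c \in S ->
  measurable_fun setT phi -> measurable_fun setT psi ->
  let U w := phi (Z a w, (Z b w, Z c w)) in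
  let V w := psi (Z a w, (Z b w, Z c w)) in
  indep2 P U V ->
  mutind [pred i in S | i != c] (upd2 a b U V Z).
Proof.
move=> ind mZ uabc aS bS cS mphi mpsi U V UV.
have mZa := mZ _ aS; have mZb := mZ _ bS; have mZc := mZ _ cS.
have mtri : measurable_fun setT (fun w => (Z a w, (Z b w, Z c w))).
  by apply/measurable_fun_pair => //; apply/measurable_fun_pair.
have mU : measurable_fun setT U by apply: (measurableT_comp mphi).
have mV : measurable_fun setT V by apply: (measurableT_comp mpsi).
have pm (X : T -> R) (B : set R) : measurable_fun setT X -> measurable B ->
    measurable (X @^-1` B).
  by move=> mX mB; rewrite -[X in measurable X]setTI; exact: mX.
(* the boxes over the remaining indices are independent of the triple *)
have key r B : uniq r -> {subset r <= [pred i in S | [&& i != a, i != b & i != c]]} ->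
    (forall p, measurable (B p)) ->
    forall D1 D2, measurable D1 -> measurable D2 ->
    P (U @^-1` D1 `&` (V @^-1` D2 `&` box Z r B)) =
    P (U @^-1` D1) * (P (V @^-1` D2) * P (box Z r B)).
  move=> ur rS mB D1 D2 mB1 mB2.
  have mbox : measurable (box Z r B).
    by apply: measurable_box => // p /rS; rewrite inE => /andP[/mZ].
  pose D := [set z | D1 (phi z) /\ D2 (psi z)].
  have mD : measurable D.
    rewrite (_ : D = phi @^-1` D1 `&` psi @^-1` D2); last by [].
    by apply: measurableI; rewrite -[X in measurable X]setTI; [exact: mphi|exact: mpsi].
  have -> : U @^-1` D1 `&` (V @^-1` D2 `&` box Z r B) =
      box Z r B `&` (fun w => (Z a w, (Z b w, Z c w))) @^-1` D.
    by apply/seteqP; split => w /= => [[? []]|[? []]].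
  have prod3 s B' Ba Bb Bc : uniq s ->
      {subset s <= [pred i in S | [&& i != a, i != b & i != c]]} ->
      (forall p, measurable (B' p)) -> measurable Ba -> measurable Bb -> measurable Bc ->
      P (box Z s B' `&` (Z a @^-1` Ba `&` (Z b @^-1` Bb `&` Z c @^-1` Bc))) =
      P (Z a @^-1` Ba) * (P (Z b @^-1` Bb) * (P (Z c @^-1` Bc) * P (box Z s B'))).
    move=> us sS mB' mBa mBb mBc.
    pose B'' i := if i == a then Ba else if i == b then Bb else if i == c then Bc else B' i.
    have nas x : x \in s -> [&& x \in S, x != a, x != b & x != c].
      by move=> /sS; rewrite inE.
    have -> : box Z s B' `&` (Z a @^-1` Ba `&` (Z b @^-1` Bb `&` Z c @^-1` Bc)) =
        box Z [:: a, b, c & s] B''.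
      rewrite !box_cons /B'' eqxx.
      move: uabc => /=; rewrite !inE negb_or => /andP[/andP[ab ac] /andP[bc _]].
      rewrite (eq_sym b) (negPf ab) eqxx (eq_sym c) (negPf ac) (eq_sym c) (negPf bc) eqxx.
      rewrite setIC -!setIA; congr (_ `&` (_ `&` (_ `&` _))).
      apply: eq_box => p /nas /and4P[_ pa pb pc].
      by rewrite (negPf pa) (negPf pb) (negPf pc).
    rewrite ind; last 3 first.
    - move: uabc; rewrite /= !inE !negb_or => /andP[/andP[ab ac] /andP[bc _]].
      rewrite ab ac bc us andbT /=.
      by apply/and3P; split; apply/negP => /nas; rewrite eqxx /= ?andbF.
    - move=> p; rewrite !inE => /or4P[/eqP->|/eqP->|/eqP->|/nas/andP[]]//.
    - by move=> p; rewrite /B''; do 3 case: ifP => // _.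
    rewrite !big_cons /B'' eqxx.
    move: uabc => /=; rewrite !inE negb_or => /andP[/andP[ab ac] /andP[bc _]].
    rewrite (eq_sym b) (negPf ab) eqxx (eq_sym c) (negPf ac) (eq_sym c) (negPf bc) eqxx.
    congr (_ * (_ * (_ * _))).
    rewrite ind//; last by move=> p /nas/andP[].
    by apply: eq_big_seq => p /nas /and4P[_ /negPf-> /negPf-> /negPf->].
  have prod3' Ba Bb Bc : measurable Ba -> measurable Bb -> measurable Bc ->
      P (Z a @^-1` Ba `&` (Z b @^-1` Bb `&` Z c @^-1` Bc)) =
      P (Z a @^-1` Ba) * (P (Z b @^-1` Bb) * P (Z c @^-1` Bc)).
    move=> mBa mBb mBc; have := @prod3 [::] (fun=> setT) _ _ _ erefl _ (fun=> measurableT) mBa mBb mBc.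
    by rewrite box_nil setTI probability_setT mule1; apply.
  have prod1 s B' Ba : uniq s ->
      {subset s <= [pred i in S | [&& i != a, i != b & i != c]]} ->
      (forall p, measurable (B' p)) -> measurable Ba ->
      P (box Z s B' `&` Z a @^-1` Ba) = P (Z a @^-1` Ba) * P (box Z s B').
    move=> us sS mB' mBa; have := prod3 s B' Ba setT setT us sS mB' mBa measurableT measurableT.
    by rewrite !preimage_setT !setIT !probability_setT !mul1e.
  have mboxs s B' : {subset s <= [pred i in S | [&& i != a, i != b & i != c]]} ->
      (forall p, measurable (B' p)) -> measurable (box Z s B').
    by move=> sS mB'; apply: measurable_box => // p /sS; rewrite inE => /andP[/mZ].
  (* The triple is treated as nested pairs: independence of boxes is extended first to measurable
     sets of [(Z b, Z c)], then to those of the whole triple. *)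
  have indA s B' D3 : uniq s ->
      {subset s <= [pred i in S | [&& i != a, i != b & i != c]]} ->
      (forall p, measurable (B' p)) -> measurable D3 -> forall D', measurable D' ->
     P ((box Z s B' `&` Z a @^-1` D3) `&` (fun w => (Z b w, Z c w)) @^-1` D') =
     P (box Z s B' `&` Z a @^-1` D3) * P ((fun w => (Z b w, Z c w)) @^-1` D').
    move=> us sS mB' mB3; apply: indep_pair => //.
      by apply: measurableI; [exact: mboxs|exact: pm].
    move=> D4 D5 mB4 mB5; rewrite -setIA prod3// prod1//.
    have := prod3' setT D4 D5 measurableT mB4 mB5.
    rewrite preimage_setT setTI probability_setT mul1e => ->.
    by rewrite -!muleA; congr (_ * _); rewrite [RHS]muleC -muleA.
  have indA0 D3 D' : measurable D3 -> measurable D' ->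
     P (Z a @^-1` D3 `&` (fun w => (Z b w, Z c w)) @^-1` D') =
     P (Z a @^-1` D3) * P ((fun w => (Z b w, Z c w)) @^-1` D').
    move=> mB3 mD'; have := @indA [::] (fun=> setT) D3 erefl _ (fun=> measurableT) mB3 D' mD'.
    by rewrite box_nil !setTI; apply.
  rewrite (indep_pair mZa _ mbox) //; last 2 first.
  - exact/measurable_fun_pair.
  - move=> D4 D' mB4 mD'; rewrite setIA indA// indA0// prod1//.
    by rewrite muleCA muleA.
  rewrite [_ @^-1` D](_ : _ = U @^-1` D1 `&` V @^-1` D2); last by [].
  by rewrite UV// muleC muleA.
move=> s B us sS mB.
pose r := [seq i <- s | (i != a) && (i != b)].
have ur : uniq r by exact: filter_uniq.
have rS : {subset r <= [pred i in S | [&& i != a, i != b & i != c]]}.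
  by move=> i; rewrite mem_filter !inE => /andP[/andP[-> ->] /sS]; rewrite !inE => /andP[-> ->].
have [ab _] : a != b /\ true by move: uabc; rewrite /= !inE negb_or => /andP[/andP[->]].
(* The list [s] may or may not contain [a] and [b]; a missing index counts as the trivial constraint
   [setT]. *)
pose Ba := if a \in s then B a else setT.
pose Bb := if b \in s then B b else setT.
have mBa : measurable Ba by rewrite /Ba; case: ifP.
have mBb : measurable Bb by rewrite /Bb; case: ifP.
have -> : box (upd2 a b U V Z) s B = U @^-1` Ba `&` (V @^-1` Bb `&` box Z r B).
  apply/seteqP; split => w.
    move=> h; split; [|split].
    - rewrite /Ba; case: ifPn => // as_; have /= := h a as_.
      by rewrite /upd2 eqxx.
    - rewrite /Bb; case: ifPn => // bs; have /= := h b bs.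
      by rewrite /upd2 eq_sym (negPf ab) eqxx.
    - move=> i /=; rewrite mem_filter => /andP[/andP[ia ib] is_]; have /= := h i is_.
      by rewrite /upd2 (negPf ia) (negPf ib).
  move=> [h1 [h2 h3]] i /= is_; rewrite /upd2.
  case: ifPn => [/eqP ia|ia]; first by move: h1; rewrite /Ba -ia is_.
  case: ifPn => [/eqP ib|ib]; first by move: h2; rewrite /Bb -ib is_.
  by apply: h3; rewrite /= mem_filter ia ib.
rewrite key//.
have -> : P (box Z r B) = \prod_(p <- r) P (upd2 a b U V Z p @^-1` B p).
  rewrite ind//; last by move=> i /rS; rewrite inE => /andP[].
  apply: eq_big_seq => i; rewrite mem_filter => /andP[/andP[ia ib] _].
  by rewrite /upd2 (negPf ia) (negPf ib).
set F := fun p => P (upd2 a b U V Z p @^-1` B p).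
have big1s x : \prod_(i <- s | i == x) F i = if x \in s then F x else 1.
  case: ifPn => xs; first by rewrite -big_filter filter_pred1_uniq// big_seq1.
  by rewrite big_seq_cond big1// => i /andP[is_ /eqP ix]; rewrite ix (negPf xs) in is_.
rewrite [RHS](bigID (pred1 a))/= (bigID (pred1 b) (fun i => i != a))/=.
rewrite [X in _ = X * _](_ : _ = if a \in s then F a else 1); last exact: (big1s a).
rewrite [X in _ = _ * (X * _)](_ : _ = if b \in s then F b else 1); last first.
  rewrite -(big1s b); apply: eq_bigl => i.
  by have [->|] := eqVneq i b; rewrite ?andbT ?andbF// eq_sym.
rewrite big_filter; congr (_ * (_ * _)).
- by rewrite /Ba /F /upd2 eqxx; case: ifP => // _; rewrite preimage_setT probability_setT.
- rewrite /Bb /F /upd2 eq_sym (negPf ab) eqxx; case: ifP => // _.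
  by rewrite preimage_setT probability_setT.
Qed.

End mutual_independence.

(** * Burke's property for a single cell *)

Section burke.
Context d (T : measurableType d) (R : realType) (P : probability T R).
Local Open Scope ereal_scope.

Let pm (X : T -> R) (B : set R) : measurable_fun setT X -> measurable B ->
  measurable (X @^-1` B).
Proof. by move=> mX mB; rewrite -[X in measurable X]setTI; exact: mX. Qed.

(** Given [Y], the tail of [X] beyond [Y + v] is [expR (- a * (Y + v))], and tilting evaluates the
    expectation over [Y > u]. The boolean [c] covers the strict and the closed inequality, since the
    complement taken in [MDtE] exchanges them. *)
Lemma exponential_race (X Y : T -> R) (a b u v : R) c :
  (0 < a)%R -> (0 < b)%R -> (0 <= u)%R -> (0 <= v)%R ->
  measurable_fun setT X -> measurable_fun setT Y -> indep2 P X Y ->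
  (forall t : R, (0 <= t)%R -> P [set w | (t < X w)%R] = (expR (- a * t))%:E) ->
  (forall t : R, (0 <= t)%R -> P [set w | (t < Y w)%R] = (expR (- b * t))%:E) ->
  P [set w | (u < Y w)%R /\ (Y w + v < X w ?<= if c)%R] =
  (expR (- a * v) * (b / (b + a) * expR (- (b + a) * u)))%:E.
Proof.
move=> a0 b0 u0 v0 mX mY XY Xt Yt.
have YX : indep2 P Y X by move=> B1 B2 mB1 mB2; rewrite setIC XY// muleC.
pose E := [set z : R * R | (u < z.1)%R /\ (z.1 + v < z.2 ?<= if c)%R].
have mE : measurable E.
  rewrite (_ : E = fst @^-1` `]u, +oo[%classic `&`
      (fun z : R * R => (z.2 - z.1)%R) @^-1` [set` Interval (BSide c v) +oo%O]).
    apply: measurableI; rewrite -[X in measurable X]setTI.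
      by apply: measurable_fst => //; exact: measurable_itv.
    by apply: measurable_funB => //; exact: measurable_itv.
  apply/seteqP; split => z; rewrite /E/= !in_itv/= !andbT.
    by rewrite lteifBrDr addrC.
  by rewrite lteifBrDr addrC.
pose X' := mfun_Sub (mem_set mX) : {mfun T >-> R}.
pose Y' := mfun_Sub (mem_set mY) : {mfun T >-> R}.
rewrite [LHS](_ : _ = P ((fun w => (Y' w, X' w)) @^-1` E)); last by [].
rewrite indep2_law// /product_measure1/=.
rewrite ge0_integral_distribution//; last first.
  exact: (@measurable_fun_xsection _ _ _ _ _ (distribution P X') _ mE).
transitivity (\int[P]_w ((expR (- a * v))%:E *
   (expR (- a * Y w) * \1_`]u, +oo[%classic (Y w))%:E)); last first.
  rewrite ge0_integralZl//.
  - rewrite (exponential_expect_expR b0 _ mY Yt)//; last by lra.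
    rewrite opprK exponential_prob_gt//; last by rewrite addr_gt0.
  - apply/measurable_EFinP; apply: measurable_funM.
      by apply: measurableT_comp => //; apply: measurableT_comp => //.
    by apply: measurableT_comp => //; exact: measurable_indic.
apply: eq_integral => w _ /=; rewrite indicE.
have [uY|uY] := ltP u (Y w).
  rewrite mem_set ?mulr1; last by rewrite /= in_itv/= uY.
  rewrite -EFinM -expRD /distribution /pushforward/=.
  rewrite [X in P X](_ : _ = X @^-1` [set` Interval (BSide c (Y w + v)%R) +oo%O]).
    rewrite (exponential_law a0)//.
    have Yv : (0 <= Y w + v)%R by rewrite addr_ge0// (le_trans u0)// ltW.
    case: c {E mE}; rewrite ?(exponential_prob_ge a0 Yv) ?(exponential_prob_gt a0 Yv).
      by congr (expR _)%:E; ring.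
    by congr (expR _)%:E; ring.
  apply/seteqP; split => w' /=; rewrite /xsection/= in_itv/= andbT.
    by rewrite in_setE => -[].
  by move=> h; rewrite in_setE.
rewrite memNset ?mulr0 ?mule0; last by rewrite /= in_itv/= ltNge uY.
rewrite [X in distribution P X' X](_ : _ = set0) ?measure0//.
apply/seteqP; split => // x; rewrite /xsection/= in_setE => -[/=].
by rewrite ltNge uY.
Qed.

Let max0 (x : R) := Num.max x 0%R.

Section burke_step.
Variables (X Y W : T -> R) (a b : R).
Hypotheses (a0 : (0 < a)%R) (b0 : (0 < b)%R).
Hypotheses (mX : measurable_fun setT X) (mY : measurable_fun setT Y) (mW : measurable_fun setT W).
Hypotheses (X0 : forall w, (0 <= X w)%R) (Y0 : forall w, (0 <= Y w)%R).
Hypothesis Xt : forall t : R, (0 <= t)%R -> P [set w | (t < X w)%R] = (expR (- a * t))%:E.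
Hypothesis Yt : forall t : R, (0 <= t)%R -> P [set w | (t < Y w)%R] = (expR (- b * t))%:E.
Hypothesis Wt : forall t : R, (0 <= t)%R -> P [set w | (t < W w)%R] = (expR (- (a + b) * t))%:E.
Hypothesis XY : indep2 P X Y.
Hypothesis WXY : indep2 P W (fun w => (X w, Y w)).

Let M w := Num.min (X w) (Y w).
Let D w := (X w - Y w)%R.
Let mM : measurable_fun setT M. Proof. exact: measurable_minr. Qed.
Let mD : measurable_fun setT D. Proof. exact: measurable_funB. Qed.

(** The tail of the difference [X - Y] of independent exponentials of rates [a] and [b]. *)
Let h (v : R) : R := if (0 <= v)%R then (b / (b + a) * expR (- a * v))%R
  else (1 - a / (a + b) * expR (b * v))%R.

Let rayE (Z : T -> R) u : Z @^-1` `]u, +oo[%classic = [set w | (u < Z w)%R].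
Proof. by apply/seteqP; split => w /=; rewrite in_itv/= andbT. Qed.

Let mray (Z : T -> R) u : measurable_fun setT Z -> measurable [set w | (u < Z w)%R].
Proof. by move=> mZ; rewrite -rayE; apply: pm => //; exact: measurable_itv. Qed.

Let MtE (u : R) : (0 <= u)%R -> P [set w | (u < M w)%R] = (expR (- (a + b) * u))%:E.
Proof.
move=> u0.
rewrite (_ : [set w | _] = X @^-1` `]u, +oo[%classic `&` Y @^-1` `]u, +oo[%classic).
  rewrite XY; [|exact: measurable_itv..].
  by rewrite !rayE Xt// Yt// -EFinM -expRD; congr (expR _)%:E; ring.
by rewrite !rayE; apply/seteqP; split => w /=; rewrite /M lt_min => /andP.
Qed.

Let MDtE (u v : R) : (0 <= u)%R -> P ([set w | (u < M w)%R] `&` [set w | (v < D w)%R]) =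
  (expR (- (a + b) * u) * h v)%:E.
Proof.
move=> u0; rewrite /h; case: ifPn => v0.
  rewrite [X in P X](_ : _ = [set w | (u < Y w)%R /\ (Y w + v < X w ?<= if false)%R]).
    rewrite (exponential_race _ a0 b0)//.
    by congr EFin; rewrite mulrA mulrC -!mulrA (addrC a); ring.
  apply/seteqP; split => w /=; rewrite /M /D lt_min => -[].
    by move=> /andP[_ ?] ?; split => //; lra.
  by move=> ? ?; split; [apply/andP; split => //|]; lra.
have {}v0 : (0 <= - v)%R by rewrite -ltNge in v0; rewrite oppr_ge0 ltW.
have YX : indep2 P Y X by move=> B1 B2 mB1 mB2; rewrite setIC XY// muleC.
have hm : measurable [set w | (u < M w)%R] by exact: mray.
(* For negative [v] the complementary event is a race won by [Y] with lead at least [- v], to which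
   the formula applies with the two variables exchanged. *)
rewrite (_ : _ `&` _ = [set w | (u < M w)%R] `\`
    [set w | (u < X w)%R /\ (X w + - v < Y w ?<= if true)%R]).
  rewrite measureD//; last 2 first.
  - rewrite (_ : [set w | _] = [set w | (u < X w)%R] `&` (Y \- X)%R @^-1` `[(- v)%R, +oo[%classic).
      apply: measurableI; first exact: mray.
      by apply: pm; [exact: measurable_funB|exact: measurable_itv].
    apply/seteqP; split => w /=; rewrite in_itv/= andbT => -[? ?]; split => //; lra.
  - by rewrite (le_lt_trans (probability_le1 _ _)) ?ltry.
  rewrite setIidr; last first.
    by move=> w /= [uX XvY]; rewrite /M lt_min uX/=; lra.
  transitivity ((expR (- (a + b) * u))%:E -
      (expR (- b * - v) * (a / (a + b) * expR (- (a + b) * u)))%:E).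
    by congr (_ - _); [exact: MtE|exact: exponential_race].
  rewrite -EFinB; congr EFin.
  have -> : (- b * - v = b * v)%R by ring.
  by ring.
apply/seteqP; split => w /=; rewrite /M /D lt_min.
  by move=> [/andP[-> ->] vD]; split => // -[_]; lra.
move=> [/andP[uX uY] n]; rewrite uX uY; split => //.
by rewrite ltNge; apply/negP => Dv; apply: n; split => //; lra.
Qed.

(** The joint formula at [u = 0], because the minimum is positive almost surely. Together with
    [MDtE] this factorises the joint tail, so that minimum and difference are independent. *)
Let DtE (v : R) : P [set w | (v < D w)%R] = (h v)%:E.
Proof.
have h0 : P (~` [set w | (0 < M w)%R]) = 0.
  by rewrite probability_setC ?MtE// ?mulr0 ?expR0 ?subee//; exact: mray.
have := @MDtE 0%R v (lexx _); rewrite mulr0 expR0 mul1r => <-.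
apply/eqP; rewrite eq_le; apply/andP; split; last first.
  by rewrite le_measure ?inE//; [apply: measurableI|]; exact: mray.
rewrite -[leRHS]adde0 -h0.
apply: le_trans (measureU2 _ _ _) => //; last 2 first.
- by apply: measurableI; exact: mray.
- by apply: measurableC; exact: mray.
apply: le_measure; rewrite ?inE; [exact: mray| |].
  by apply: measurableU; [apply: measurableI|apply: measurableC]; exact: mray.
by move=> w /= vD; have [?|?] := ltP 0%R (M w); [left|right].
Qed.

Let rayG : @measurable _ R = <<s (@RGenOInfty.G R) >>.
Proof. exact: RGenOInfty.measurableE. Qed.

Let rayI : setI_closed (@RGenOInfty.G R).
Proof.
move=> _ _ [x ->] [y ->]; exists (Num.max x y).
by apply/seteqP; split => z /=; rewrite !in_itv/= !andbT gt_max => /andP.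
Qed.

Let rayT : \bigcup_n `](- n%:R : R)%R, +oo[%classic = setT.
Proof.
apply/seteqP; split => // x _; exists (Num.truncn `|x|).+1 => //=.
rewrite in_itv/= andbT ltrNl (le_lt_trans (ler_norm _))// normrN.
exact: truncnS_gt.
Qed.

Let MD : indep2 P M D.
Proof.
move=> B1 B2 mB1 mB2; rewrite setIC muleC.
pose g (n : nat) : set R := `](- n%:R)%R, +oo[%classic.
have Gg n : RGenOInfty.G (g n) by eexists; reflexivity.
have mray' (u : R) : measurable (M @^-1` `]u, +oo[%classic).
  by apply: pm => //; exact: measurable_itv.
have := @indep_ext _ _ _ P _ R M (@RGenOInfty.G R) g (D @^-1` B2) mM rayG rayI
  Gg rayT (pm mD mB2) _ B1 mB1.
apply => _ [u ->]; rewrite setIC muleC.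
have := @indep_ext _ _ _ P _ R D (@RGenOInfty.G R) g (M @^-1` `]u, +oo[%classic) mD rayG rayI
  Gg rayT (mray' u) _ B2 mB2.
apply => _ [v ->]; rewrite !rayE DtE.
have [u0|u0] := leP 0%R u; first by rewrite MDtE// MtE// -EFinM.
have MT : [set w | (u < M w)%R] = setT.
  by apply/seteqP; split => // w _; rewrite /= /M lt_min !(lt_le_trans u0).
by rewrite MT setTI DtE probability_setT mul1e.
Qed.

(** One has [X = M + max0 D] and [Y = M + max0 (- D)], where the minimum [M] is independent of [D]
    and exponential of rate [a + b]. The fresh [W] has the law of [M] and is also independent of
    [D], so substituting it for [M] leaves the joint law of the pair unchanged. *)
Lemma burke_step (B1 B2 : set R) : measurable B1 -> measurable B2 ->
  P ((fun w => W w + max0 (X w - Y w))%R @^-1` B1 `&`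
     (fun w => W w + max0 (Y w - X w))%R @^-1` B2) =
  P (X @^-1` B1) * P (Y @^-1` B2).
Proof.
move=> mB1 mB2.
pose f1 (z : R * R) := (z.1 + max0 z.2)%R.
pose f2 (z : R * R) := (z.1 + max0 (- z.2))%R.
have mf1 : measurable_fun setT f1.
  by apply: measurable_funD => //; apply: measurable_maxr.
have mf2 : measurable_fun setT f2.
  apply: measurable_funD => //; apply: measurable_maxr => //.
  by apply: measurableT_comp => //.
pose E := f1 @^-1` B1 `&` f2 @^-1` B2.
have mE : measurable E.
  by apply: measurableI; rewrite -[X in measurable X]setTI; [exact: mf1|exact: mf2].
rewrite -XY//.
transitivity (P ((fun w => (W w, D w)) @^-1` E)).
  by congr (P _); apply/seteqP; split => w; rewrite /E /f1 /f2/= /D opprB.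
transitivity (P ((fun w => (M w, D w)) @^-1` E)); last first.
  congr (P _); apply/seteqP; split => w; rewrite /E /f1 /f2 /= /D opprB /M /max0.
    have -> : (Num.min (X w) (Y w) + Num.max (X w - Y w) 0 = X w)%R.
      by case: (leP (X w) (Y w)) => h1; case: (leP (X w - Y w)%R 0%R) => h2; lra.
    have -> // : (Num.min (X w) (Y w) + Num.max (Y w - X w) 0 = Y w)%R.
      by case: (leP (X w) (Y w)) => h1; case: (leP (Y w - X w)%R 0%R) => h2; lra.
  have -> : (Num.min (X w) (Y w) + Num.max (X w - Y w) 0 = X w)%R.
    by case: (leP (X w) (Y w)) => h1; case: (leP (X w - Y w)%R 0%R) => h2; lra.
  have -> // : (Num.min (X w) (Y w) + Num.max (Y w - X w) 0 = Y w)%R.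
  by case: (leP (X w) (Y w)) => h1; case: (leP (Y w - X w)%R 0%R) => h2; lra.
have mMD : measurable_fun setT (fun w => (M w, D w)) by exact/measurable_fun_pair.
pose W' := mfun_Sub (mem_set mW) : {mfun T >-> R}.
pose D' := mfun_Sub (mem_set mD) : {mfun T >-> R}.
have WD : indep2 P W' D'.
  move=> C1 C2 mC1 mC2; have := @WXY C1 ((fun z => z.1 - z.2)%R @^-1` C2) mC1.
  by apply; rewrite -[X in measurable X]setTI; apply: measurable_funB.
rewrite [LHS](indep2_law WD)//.
rewrite (@product_measure_unique _ _ _ _ _ _ _ (distribution P (mfun_Sub (mem_set mMD))))//.
move=> C1 C2 mC1 mC2.
transitivity (P (M @^-1` C1) * P (D @^-1` C2)); first exact: MD.
congr (_ * _); have ab0 : (0 < a + b)%R by rewrite addr_gt0.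
by rewrite (exponential_law ab0 mM MtE)// -(exponential_law ab0 mW Wt).
Qed.

End burke_step.
End burke.

(** * Chernoff bounds for sums of independent exponentials *)

Section chernoff.
Context d (T : measurableType d) (R : realType) (P : probability T R).
Context {I : eqType}.
Implicit Types (S : {pred I}) (Z : I -> T -> R) (s r : seq I).

Let pm (X : T -> R) (B : set R) : measurable_fun setT X -> measurable B ->
  measurable (X @^-1` B).
Proof. by move=> mX mB; rewrite -[X in measurable X]setTI; exact: mX. Qed.

Lemma measurable_sum_seq Z s : {in s, forall p, measurable_fun setT (Z p)} ->
  measurable_fun setT (fun w => \sum_(p <- s) Z p w).
Proof.
elim: s => [|p s IH] mZ.
  rewrite (_ : (fun w => _) = cst 0); first exact: measurable_cst.
  by apply/funext => w; rewrite big_nil.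
rewrite (_ : (fun w => _) = (Z p \+ (fun w => \sum_(p <- s) Z p w))).
  apply: measurable_funD; first by apply: mZ; exact: mem_head.
  by apply: IH => q qs; apply: mZ; rewrite inE qs orbT.
by apply/funext => w; rewrite big_cons.
Qed.

(** Stated with an arbitrary box next to the sum so that the induction can move one summand at a
    time from the sum into the box. *)
Lemma mutind_box_sum S Z s : mutind P S Z ->
  {in S, forall p, measurable_fun setT (Z p)} ->
  forall r B, uniq (r ++ s) -> {subset r ++ s <= S} -> (forall p, measurable (B p)) ->
  forall D, measurable D ->
  (P (box Z r B `&` (fun w => (\sum_(p <- s) Z p w)%R) @^-1` D) =
   P (box Z r B) * P ((fun w => (\sum_(p <- s) Z p w)%R) @^-1` D))%E.
Proof.
move=> ind mZ; elim: s => [|q s IH] r B urs rsS mB D mD.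
  have sE : (fun w : T => \sum_(p <- [::]) Z p w) = cst 0.
    by apply/funext => w; rewrite big_nil.
  rewrite sE preimage_cst; case: ifPn => _.
    by rewrite setIT probability_setT mule1.
  by rewrite setI0 measure0 mule0.
have mr : {in r, forall p, measurable_fun setT (Z p)}.
  by move=> p pr; apply: mZ; apply: rsS; rewrite mem_cat pr.
have ms : {in s, forall p, measurable_fun setT (Z p)}.
  by move=> p pr; apply: mZ; apply: rsS; rewrite mem_cat inE pr !orbT.
have qS : q \in S by apply: rsS; rewrite mem_cat inE eqxx orbT.
have mq : measurable_fun setT (Z q) by exact: mZ.
have msum := measurable_sum_seq ms.
have uq : uniq (q :: r ++ s) by rewrite -cat1s uniq_catCA.
have qr : q \notin r by move: uq; rewrite /= mem_cat negb_or => /andP[/andP[]].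
have sub p : p \in r ++ s -> p \in S.
  by move=> h; apply: rsS; move: h; rewrite !mem_cat inE => /orP[->//|->]; rewrite !orbT.
have step B1 B2 : measurable B1 -> measurable B2 ->
   (P (box Z r B `&` (Z q @^-1` B1 `&` (fun w => (\sum_(p <- s) Z p w)%R) @^-1` B2)) =
   P (box Z r B) * (P (Z q @^-1` B1) * P ((fun w => (\sum_(p <- s) Z p w)%R) @^-1` B2)))%E.
  move=> mB1 mB2.
  pose B' i := if i == q then B1 else B i.
  have mB' p : measurable (B' p) by rewrite /B'; case: ifP.
  have bE : box Z (q :: r) B' = Z q @^-1` B1 `&` box Z r B.
    rewrite box_cons /B' eqxx; congr (_ `&` _); apply: eq_box => p pr.
    by case: eqP => // pq; rewrite -pq pr in qr.
  rewrite setIA [box Z r B `&` _]setIC -bE IH//; last first.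
    by move=> p; rewrite /= inE => /orP[/eqP->//|]; exact: sub.
  rewrite muleA; congr (_ * _)%E.
  rewrite ind//; last 2 first.
  - by move: uq; rewrite /= cat_uniq => /andP[_ /andP[-> _]]; rewrite qr.
  - by move=> p; rewrite inE => /orP[/eqP->//|pr]; apply: sub; rewrite mem_cat pr.
  rewrite big_cons /B' eqxx muleC; congr (_ * _)%E.
  rewrite ind//; last 2 first.
  - by move: uq; rewrite /= cat_uniq => /andP[_ /andP[-> _]].
  - by move=> p pr; apply: sub; rewrite mem_cat pr.
  apply: eq_big_seq => p pr.
  by case: eqP => // pq; rewrite -pq pr in qr.
have step0 B1 B2 : measurable B1 -> measurable B2 ->
   (P (Z q @^-1` B1 `&` (fun w => (\sum_(p <- s) Z p w)%R) @^-1` B2) =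
   P (Z q @^-1` B1) * P ((fun w => (\sum_(p <- s) Z p w)%R) @^-1` B2))%E.
  move=> mB1 mB2.
  have := IH [:: q] (fun=> B1) _ _ (fun=> mB1) B2 mB2.
  rewrite box_cons box_nil setIT; apply.
    by move: uq; rewrite /= mem_cat cat_uniq negb_or => /andP[/andP[_ ->] /and3P[_ _ ->]].
  by move=> p; rewrite inE => /orP[/eqP->//|pr]; apply: sub; rewrite mem_cat pr orbT.
pose E := (fun z : R * R => z.1 + z.2) @^-1` D.
have mE : measurable E.
  by rewrite /E -[X in measurable X]setTI; apply: measurable_funD.
have -> : (fun w => \sum_(p <- (q :: s)) Z p w) @^-1` D =
   (fun w => (Z q w, \sum_(p <- s) Z p w)) @^-1` E.
  by apply/seteqP; split => w /=; rewrite /E/= big_cons.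
apply: indep_pair => //; first exact: measurable_box.
by move=> B1 B2 mB1 mB2; rewrite step// step0.
Qed.

Lemma mutind_sum_mgf S Z s (th m : R) : mutind P S Z ->
  {in S, forall p, measurable_fun setT (Z p)} -> uniq s -> {subset s <= S} ->
  {in s, forall p, (\int[P]_w (expR (th * Z p w))%:E = m%:E)%E} ->
  (\int[P]_w (expR (th * \sum_(p <- s) Z p w))%:E = (m ^+ size s)%:E)%E.
Proof.
move=> ind mZ; elim: s => [|q s IH] us sS hm.
  under eq_integral do rewrite big_nil mulr0 expR0.
  by rewrite integral_cst// mul1e expr0; exact: probability_setT.
under eq_integral do rewrite big_cons mulrDr expRD.
have mexp : measurable_fun setT (fun x : R => expR (th * x)).
  by apply: measurableT_comp => //; exact: mulrl_measurable.
rewrite (@indep2_expect _ _ _ P _ _ _ _ (Z q) (fun w => \sum_(p <- s) Z p w)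
   (fun x => expR (th * x)) (fun x => expR (th * x)))//.
- rewrite hm ?mem_head// IH//; last 3 first.
  + by move: us => /= /andP[].
  + by move=> p ps; apply: sS; rewrite inE ps orbT.
  + by move=> p ps; apply: hm; rewrite inE ps orbT.
  by rewrite -EFinM exprS.
- by apply: mZ; apply: sS; exact: mem_head.
- by apply: measurable_sum_seq => p ps; apply: mZ; apply: sS; rewrite inE ps orbT.
- move=> B1 B2 mB1 mB2.
  have := mutind_box_sum (s := s) ind mZ (r := [:: q]) (B := fun=> B1) us sS (fun=> mB1) mB2.
  by rewrite box_cons box_nil setIT.
Qed.

(** The sign of [th] is free: positive values give upper tails, negative ones lower tails. *)
Lemma markov_expR (X : T -> R) (th x M : R) : measurable_fun setT X ->
  (\int[P]_w (expR (th * X w))%:E = M%:E)%E ->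
  (P [set w | th * x <= th * X w]%R <= (expR (- (th * x)) * M)%:E)%E.
Proof.
move=> mX hM.
have mexp : measurable_fun setT (fun w => expR (th * X w)).
  by apply: measurableT_comp => //; exact: measurable_funM.
have := @markov _ _ _ P (mfun_Sub (mem_set mexp)) (fun x => x) (expR (th * x)).
rewrite expR_gt0 => /(_ isT) /(_ (@measurable_id _ _ _)) /(_ (fun (x : R) (x0 : 0 <= x) => x0)).
have hh : {in Num.nneg &, {homo (fun x : R => x) : x y / x <= y}} by [].
move=> /(_ hh); rewrite [X in (_ <= X)%E -> _](_ : _ = M%:E); last first.
  rewrite -hM unlock; apply: eq_integral => w _ /=.
  by rewrite ger0_norm ?expR_ge0.
move=> hmk; rewrite expRN EFinM -lee_pdivrMl ?invr_gt0 ?expR_gt0// invrK.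
apply: le_trans hmk; rewrite lee_pmul2l// ?lte_fin ?expR_gt0//.
rewrite le_measure ?inE//.
- rewrite (_ : [set w | _] = (fun w => th * X w) @^-1` `[th * x, +oo[%classic).
    by apply: pm; [exact: measurable_funM|exact: measurable_itv].
  by apply/seteqP; split => w /=; rewrite in_itv/= andbT.
- rewrite (_ : [set w | _] = (fun w => expR (th * X w)) @^-1` `[expR (th * x), +oo[%classic).
    by apply: pm => //; exact: measurable_itv.
  by apply/seteqP; split => w /=; rewrite in_itv/= andbT lee_fin ger0_norm ?expR_ge0.
- by move=> w /=; rewrite lee_fin ger0_norm ?expR_ge0// ler_expR.
Qed.

Variables (a : R) (a0 : 0 < a) (S : {pred I}) (Z : I -> T -> R) (s : seq I).
Hypotheses (ind : mutind P S Z) (mZ : {in S, forall p, measurable_fun setT (Z p)}).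
Hypotheses (us : uniq s) (sS : {subset s <= S}).
Hypothesis Zt : forall p, p \in s -> forall t : R, 0 <= t ->
  P [set w | t < Z p w] = (expR (- a * t))%:E.

Let mgf th : th < a -> {in s, forall p, (\int[P]_w (expR (th * Z p w))%:E = (a / (a - th))%:E)%E}.
Proof.
move=> tha p ps.
have := exponential_expect_expR a0 tha (mZ (sS ps)) (Zt ps) measurableT.
under eq_integral do rewrite indicT mulr1.
rewrite /exponential_prob integral_exponential_pdf ?subr_gt0// mule1 => <-.
by [].
Qed.

Let msum : measurable_fun setT (fun w => \sum_(p <- s) Z p w).
Proof. by apply: measurable_sum_seq => p ps; apply: mZ; exact: sS. Qed.

Let chernoff (th x c : R) : th < a -> a / (a - th) <= expR c ->
  (P [set w | th * x <= th * \sum_(p <- s) Z p w]%R <=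
   (expR ((size s)%:R * c - th * x))%:E)%E.
Proof.
move=> tha hc; have := mutind_sum_mgf ind mZ us sS (mgf tha).
move=> /(@markov_expR _ th x _ msum) /le_trans; apply; rewrite lee_fin.
rewrite [in leRHS]addrC [in leRHS]expRD ler_wpM2l ?expR_ge0//.
rewrite expRM_natl lerXn2r// nnegrE ?expR_ge0//.
by rewrite divr_ge0 ?ltW// subr_gt0.
Qed.

Lemma chernoff_upper (tau x : R) : 0 <= tau <= 2^-1 ->
  (P [set w | (size s)%:R / a + x <= \sum_(p <- s) Z p w]%R <=
   (expR ((size s)%:R * (2 * tau ^+ 2) - a * tau * x))%:E)%E.
Proof.
move=> /andP[t0 t1].
have tha : a * tau < a by rewrite -[ltRHS]mulr1 ltr_pM2l//; lra.
(* After [expR x >= 1 + x] this is [(1 - tau) * (1 + tau + 2 * tau ^+ 2) >= 1], that is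
   [tau ^+ 2 * (1 - 2 * tau) >= 0], whence the restriction [tau <= 2^-1]. *)
have hc : a / (a - a * tau) <= expR (tau + 2 * tau ^+ 2).
  rewrite (_ : a / _ = (1 - tau)^-1); last by field; apply/andP; split; lra.
  rewrite -[leLHS]mul1r ler_pdivrMr; last by lra.
  have := expR_ge1Dx (tau + 2 * tau ^+ 2).
  move=> /(ler_wpM2r (_ : 0 <= 1 - tau)) h; apply: le_trans (h _); last by lra.
  by nra.
apply: le_trans (le_trans _ (chernoff ((size s)%:R / a + x) tha hc)) _.
  apply: le_measure; rewrite ?inE.
  - rewrite (_ : [set w | _] = (fun w => \sum_(p <- s) Z p w) @^-1` `[(size s)%:R / a + x, +oo[%classic).
      by apply: pm => //; exact: measurable_itv.
    by apply/seteqP; split => w /=; rewrite in_itv/= andbT.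
  - rewrite (_ : [set w | _] = (fun w => a * tau * \sum_(p <- s) Z p w) @^-1` `[a * tau * ((size s)%:R / a + x), +oo[%classic).
      by apply: pm; [exact: measurable_funM|exact: measurable_itv].
    by apply/seteqP; split => w /=; rewrite in_itv/= andbT.
  - by move=> w /= h; rewrite ler_wpM2l// mulr_ge0// ltW.
rewrite lee_fin ler_expR le_eqVlt; apply/orP; left; apply/eqP.
by field; rewrite gt_eqF.
Qed.

Lemma chernoff_lower (tau x : R) : 0 <= tau <= 2^-1 ->
  (P [set w | \sum_(p <- s) Z p w <= (size s)%:R / a - x]%R <=
   (expR ((size s)%:R * (2 * tau ^+ 2) - a * tau * x))%:E)%E.
Proof.
move=> /andP[t0 t1].
have tha : - (a * tau) < a by rewrite (le_lt_trans _ a0)// oppr_le0 mulr_ge0// ltW.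
have hc : a / (a - - (a * tau)) <= expR (- tau + 2 * tau ^+ 2).
  rewrite (_ : a / _ = (1 + tau)^-1); last by field; apply/andP; split; lra.
  rewrite -[leLHS]mul1r ler_pdivrMr; last by lra.
  have := expR_ge1Dx (- tau + 2 * tau ^+ 2).
  move=> /(ler_wpM2r (_ : 0 <= 1 + tau)) h; apply: le_trans (h _); last by lra.
  by nra.
apply: le_trans (le_trans _ (chernoff ((size s)%:R / a - x) tha hc)) _.
  apply: le_measure; rewrite ?inE.
  - rewrite (_ : [set w | _] = (fun w => \sum_(p <- s) Z p w) @^-1` `]-oo, (size s)%:R / a - x]%classic).
      by apply: pm => //; exact: measurable_itv.
    by apply/seteqP; split => w /=; rewrite in_itv/=.
  - rewrite (_ : [set w | _] = (fun w => - (a * tau) * \sum_(p <- s) Z p w) @^-1` `[- (a * tau) * ((size s)%:R / a - x), +oo[%classic).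
      by apply: pm; [exact: measurable_funM|exact: measurable_itv].
    by apply/seteqP; split => w /=; rewrite in_itv/= andbT.
  - by move=> w /= h; rewrite ler_wnM2l// oppr_le0 mulr_ge0// ltW.
rewrite lee_fin ler_expR le_eqVlt; apply/orP; left; apply/eqP.
by field; rewrite gt_eqF.
Qed.

End chernoff.

(** * Homogeneous last passage percolation *)

Section last_passage.
Context {R : realType}.
Implicit Types (w e : nat -> nat -> R) (s : seq bool).

(** The inner fixpoints reflect a recursion in which either coordinate may decrease. The weights of
    both end points are counted. *)
Fixpoint lpp w (m : nat) : nat -> R :=
  match m with
  | 0%N => fix f n := match n with
                      | 0%N => w 0%N 0%N
                      | n'.+1 => f n' + w 0%N n
                      end
  | m'.+1 => fix f n := match n with
                        | 0%N => lpp w m' 0%N + w m 0%N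
                        | n'.+1 => w m n + Num.max (lpp w m' n) (f n')
                        end
  end.

Lemma lpp00 w : lpp w 0 0 = w 0%N 0%N. Proof. by []. Qed.
Lemma lpp0S w n : lpp w 0 n.+1 = lpp w 0 n + w 0%N n.+1. Proof. by []. Qed.
Lemma lppS0 w m : lpp w m.+1 0 = lpp w m 0 + w m.+1 0%N. Proof. by []. Qed.
Lemma lppSS w m n : lpp w m.+1 n.+1 =
  w m.+1 n.+1 + Num.max (lpp w m n.+1) (lpp w m.+1 n).
Proof. by []. Qed.

#[local] Arguments lpp : simpl never.

Lemma lpp_stepl w m n : lpp w m n + w m.+1 n <= lpp w m.+1 n.
Proof.
case: n => [|n]; first by rewrite lppS0.
by rewrite lppSS addrC lerD2l le_max lexx.
Qed.

Lemma lpp_stepr w m n : lpp w m n + w m n.+1 <= lpp w m n.+1.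
Proof.
case: m => [|m]; first by rewrite lpp0S.
by rewrite lppSS addrC lerD2l le_max lexx orbT.
Qed.

Definition shift w (p q : nat) := fun i j : nat => w (p + i)%N (q + j)%N.

Lemma shiftE w p q i j : shift w p q i j = w (p + i)%N (q + j)%N. Proof. by []. Qed.

Local Notation ups s := (count id s).
Local Notation dns s := (count negb s).

(* The weight of the lattice path starting at [(p, q)], which increments the first
   coordinate on [true] and the second one on [false]. *)
Fixpoint pathw w (p q : nat) s : R :=
  match s with
  | [::] => w p q
  | c :: s' => w p q + (if c then pathw w p.+1 q s' else pathw w p q.+1 s')
  end.

(** The junction belongs to both pieces, hence the subtracted weight. *)
Lemma pathw_cat w p q s1 s2 : pathw w p q (s1 ++ s2) =
  pathw w p q s1 + pathw w (p + ups s1) (q + dns s1) s2 - w (p + ups s1)%N (q + dns s1)%N.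
Proof.
elim: s1 p q => [|c s1 IH] p q /=; first by rewrite !addn0; ring.
by case: c; rewrite IH /= ?addnS ?addSn !add0n ?addn1 ?addSn ?addnS; ring.
Qed.

Lemma pathw_rcons w p q s c : pathw w p q (rcons s c) =
  pathw w p q s + w (p + ups (rcons s c))%N (q + dns (rcons s c))%N.
Proof.
rewrite -cats1 pathw_cat /= !count_cat /=.
by case: c; rewrite /= !addn0 ?addn1 ?addnS; ring.
Qed.

Lemma pathw_le_lpp w p q s : pathw w p q s <= lpp (shift w p q) (ups s) (dns s).
Proof.
elim/last_ind: s => [|s c IH]; first by rewrite /= lpp00 /shift !addn0.
rewrite pathw_rcons -cats1 !count_cat /=; case: c => /=; rewrite !addn0 addn1.
  by apply: le_trans (lpp_stepl _ _ _); rewrite lerD2r.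
by apply: le_trans (lpp_stepr _ _ _); rewrite lerD2r.
Qed.

Lemma lpp_attained w p q m n : exists s,
  [/\ ups s = m, dns s = n & pathw w p q s = lpp (shift w p q) m n].
Proof.
elim: m n => [|m IHm] n.
  elim: n => [|n [s [us ds ws]]].
    by exists [::]; split => //=; rewrite lpp00 /shift !addn0.
  exists (rcons s false); rewrite pathw_rcons lpp0S -ws -cats1 !count_cat us ds /=.
  by split; [lia|lia|rewrite /shift; congr (_ + w _ _); lia].
elim: n => [|n [s [us ds ws]]].
  have [s [us ds ws]] := IHm 0%N.
  exists (rcons s true); rewrite pathw_rcons lppS0 -ws -cats1 !count_cat us ds /=.
  by split; [lia|lia|rewrite /shift; congr (_ + w _ _); lia].
rewrite lppSS; case: leP => _.
  exists (rcons s false); rewrite pathw_rcons -ws -cats1 !count_cat us ds /=.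
  by split; [lia|lia|rewrite addrC /shift; congr (w _ _ + _); lia].
have [s' [us' ds' ws']] := IHm n.+1.
exists (rcons s' true); rewrite pathw_rcons -ws' -cats1 !count_cat us' ds' /=.
by split; [lia|lia|rewrite addrC /shift; congr (w _ _ + _); lia].
Qed.

Lemma pathw_ge_end w p q s : (forall i j, 0 <= w i j) ->
  w (p + ups s)%N (q + dns s)%N <= pathw w p q s.
Proof.
move=> w0; elim/last_ind: s => [|s c IH]; first by rewrite /= !addn0.
rewrite pathw_rcons lerDr; exact: le_trans IH.
Qed.

Lemma pathw_ge0 w p q s : (forall i j, 0 <= w i j) -> 0 <= pathw w p q s.
Proof. by move=> w0; exact: le_trans (pathw_ge_end _ _ _ w0). Qed.

Lemma le_pathw w w' p q s :
  (forall i j, (p <= i <= p + ups s)%N -> (q <= j <= q + dns s)%N -> w i j <= w' i j) ->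
  pathw w p q s <= pathw w' p q s.
Proof.
elim: s p q => [|c s IH] p q h /=; first by apply: h => /=; lia.
apply: lerD; first by apply: h => /=; lia.
by case: c h => /= h; apply: IH => i j hi hj; apply: h; lia.
Qed.

(** An optimal path from [(p, q)] is prolonged back to the origin by an L-shaped path, whose weight
    is nonnegative even without its last point. *)
Lemma lpp_shift_le w p q m n : (forall i j, 0 <= w i j) ->
  lpp (shift w p q) m n <= lpp w (p + m) (q + n).
Proof.
move=> w0; have [s [us ds <-]] := lpp_attained w p q m n.
have [r [ur dr]] : exists r, ups r = p /\ dns r = q.
  by exists (nseq p true ++ nseq q false); rewrite !count_cat !count_nseq /=; lia.
have := pathw_le_lpp w 0 0 (r ++ s).
rewrite !count_cat ur dr us ds pathw_cat ur dr !add0n => h.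
apply: le_trans (le_trans _ h) _; last by rewrite (_ : shift w 0 0 = w).
have := @pathw_ge_end w 0 0 r w0; rewrite ur dr !add0n; lra.
Qed.

(** * The stationary model and its increments *)

Section stationary.
Variables (rho : R) (e : nat -> nat -> R).
Hypothesis rho01 : 0 < rho < 1.

(** For exponential [e] of rate 1 the horizontal axis carries rate [1 - rho] and the vertical one
    rate [rho]. These rates add up to the bulk rate 1, which makes the laws of the increments
    invariant. *)
Definition statw (i j : nat) : R :=
  match i, j with
  | 0%N, 0%N => 0
  | i.+1, 0%N => e i.+1 0%N / (1 - rho)
  | 0%N, j.+1 => e 0%N j.+1 / rho
  | i.+1, j.+1 => e i.+1 j.+1
  end.

Let L := lpp statw.

Definition Hinc (i j : nat) := L i.+1 j - L i j.
Definition Vinc (i j : nat) := L i j.+1 - L i j.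

(** The same map as in [burke_step]: each outgoing increment is the fresh weight plus a positive
    part of the difference of the incoming ones. *)
Lemma HincS i j : Hinc i j.+1 = e i.+1 j.+1 + Num.max (Hinc i j - Vinc i j) 0.
Proof.
rewrite /Hinc /Vinc [L i.+1 j.+1]lppSS /= -/L.
by case: (leP (L i j.+1)) => h; case: (leP _ 0) => h'; lra.
Qed.

Lemma VincS i j : Vinc i.+1 j = e i.+1 j.+1 + Num.max (Vinc i j - Hinc i j) 0.
Proof.
rewrite /Hinc /Vinc [L i.+1 j.+1]lppSS /= -/L.
by case: (leP (L i j.+1)) => h; case: (leP _ 0) => h'; lra.
Qed.

Lemma Hinc0 i : Hinc i 0 = e i.+1 0%N / (1 - rho).
Proof. by rewrite /Hinc /L lppS0 /=; ring. Qed.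

Lemma Vinc0 j : Vinc 0 j = e 0%N j.+1 / rho.
Proof. by rewrite /Vinc /L lpp0S /=; ring. Qed.

(** Telescoping up the vertical axis and then along row [n]. By Burke's property each of the two
    sums will consist of independent exponentials. *)
Lemma statE m n : L m n = \sum_(j < n) e 0%N j.+1 / rho + \sum_(i < m) Hinc i n.
Proof.
elim: m => [|m IH].
  rewrite big_ord0 addr0; elim: n => [|n IH]; first by rewrite big_ord0.
  by rewrite big_ord_recr /= -IH /L lpp0S.
by rewrite big_ord_recr /= addrA -IH /Hinc; ring.
Qed.

Lemma statL m : L m 0 = \sum_(i < m) e i.+1 0%N / (1 - rho).
Proof. by rewrite statE big_ord0 add0r; apply: eq_bigr => i _; rewrite Hinc0. Qed.

(** An optimal stationary path follows one axis for [k.+1] steps and then stays in the bulk, where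
    the weights are those of [e]. The induction follows the last step of the recursion: the exit
    point is inherited, except next to an axis, where the path may exit at this very step. *)
Lemma stat_exit m n : (exists k, [/\ (k <= m)%N &
    L m.+1 n.+1 <= \sum_(i < k.+1) e i.+1 0%N / (1 - rho) + lpp (shift e k.+1 1) (m - k) n]) \/
  (exists k, [/\ (k <= n)%N &
    L m.+1 n.+1 <= \sum_(j < k.+1) e 0%N j.+1 / rho + lpp (shift e 1 k.+1) m (n - k)]).
Proof.
elim: m n => [|m IHm] n.
  elim: n => [|n IHn].
    rewrite /L lppSS -/L; case: leP => h.
      left; exists 0%N; split => //; rewrite big_ord_recl big_ord0 lpp00 shiftE /= in h *; move: h; rewrite ?statL ?statE ?big_ord_recl ?big_ord0 /=; lra.
    right; exists 0%N; split => //; rewrite big_ord_recl big_ord0 lpp00 shiftE /= in h *; move: h; rewrite ?statL ?statE ?big_ord_recl ?big_ord0 /=; lra.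
  rewrite /L lppSS -/L; case: leP => h; last first.
    right; exists n.+1; split => //.
    rewrite subnn lpp00 shiftE !addn0 /= statE big_ord0 addr0; lra.
  case: IHn => -[k [kn hk]].
    left; exists k; split => //; have := lpp_stepr (shift e k.+1 1) (0 - k) n.
    by rewrite shiftE (_ : k.+1 + (0 - k) = 1)%N ?add1n /=; [lra|lia].
  right; exists k; split; first lia; have := lpp_stepr (shift e 1 k.+1) 0 (n - k).
  rewrite subSn// shiftE (_ : k.+1 + (n - k).+1 = n.+2)%N ?addn0 ?add1n /=; [lra|lia].
elim: n => [|n IHn].
  rewrite /L lppSS -/L; case: leP => h.
    left; exists m.+1; split => //.
    rewrite subnn lpp00 shiftE !addn0 /= [L m.+2 0]statL in h *; lra.
  case: (IHm 0%N) => -[k [kn hk]].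
    left; exists k; split; first lia; have := lpp_stepl (shift e k.+1 1) (m - k) 0.
    rewrite subSn// shiftE (_ : k.+1 + (m - k).+1 = m.+2)%N ?addn0 ?add1n /=; [lra|lia].
  right; exists k; split => //; have := lpp_stepl (shift e 1 k.+1) m (0 - k).
  by rewrite shiftE (_ : k.+1 + (0 - k) = 1)%N ?add1n /=; [lra|lia].
rewrite /L lppSS -/L; case: leP => h.
  case: IHn => -[k [kn hk]].
    left; exists k; split => //; have := lpp_stepr (shift e k.+1 1) (m.+1 - k) n.
    rewrite shiftE (_ : k.+1 + (m.+1 - k) = m.+2)%N ?addn0 ?add1n /=; [lra|lia].
  right; exists k; split; first lia; have := lpp_stepr (shift e 1 k.+1) m.+1 (n - k).
  rewrite subSn// shiftE (_ : k.+1 + (n - k).+1 = n.+2)%N ?addn0 ?add1n /=; [lra|lia].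
case: (IHm n.+1) => -[k [kn hk]].
  left; exists k; split; first lia; have := lpp_stepl (shift e k.+1 1) (m - k) n.+1.
  rewrite subSn// shiftE (_ : k.+1 + (m - k).+1 = m.+2)%N ?addn0 ?add1n /=; [lra|lia].
right; exists k; split => //; have := lpp_stepl (shift e 1 k.+1) m (n.+1 - k).
rewrite shiftE (_ : k.+1 + (n.+1 - k) = n.+2)%N ?addn0 ?add1n /=; [lra|lia].
Qed.

Hypothesis e0 : forall i j, 0 <= e i j.

Lemma le_statw i j : (0 < i + j)%N -> e i j <= statw i j.
Proof.
move: rho01 => /andP[r0 r1].
have r0' : 0 < 1 - rho by lra.
case: i j => [|i] [|j]//= _; rewrite ler_pdivlMr// ler_piMr//; lra.
Qed.

(** Dividing by [rho] or [1 - rho] only enlarges the boundary weights; the corner is added by hand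
    because [statw] vanishes there. *)
Lemma lpp_le_stat m n : lpp e m n <= e 0%N 0%N + L m n.
Proof.
have [s [us ds]] := lpp_attained e 0 0 m n; rewrite -[shift e 0 0]/e => <-.
have := pathw_le_lpp statw 0 0 s; rewrite us ds -[shift statw 0 0]/statw -/L.
move=> h; apply: (@le_trans _ _ (e 0%N 0%N + pathw statw 0 0 s)); last by rewrite lerD2l.
case: s {h us ds} => [|c s] /=; first lra.
rewrite add0r lerD2l; case: c; apply: le_pathw => i j hi hj; apply: le_statw; lia.
Qed.

(* Evolution of the stationary increments: slot [(i, 0)] holds the current horizontal
   increment of column [i], slot [(0, j)] the vertical increment of row [j]. *)
Definition cell_step (st : nat * nat -> R) (c : nat * nat) : nat * nat -> R :=
  fun p => if p == (c.1, 0%N) then st c + Num.max (st (c.1, 0%N) - st (0%N, c.2)) 0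
           else if p == (0%N, c.2) then st c + Num.max (st (0%N, c.2) - st (c.1, 0%N)) 0
           else st p.

Definition row_cells m j := [seq (i.+1, j.+1) | i <- iota 0 m].

Definition grid_cells m n := flatten [seq row_cells m j | j <- iota 0 n].

(** Invariant of the row by row sweep after [i] cells of row [j]: the columns already passed hold
    increments at height [j.+1], the others still at height [j], and the slot of the row holds the
    vertical increment at abscissa [i]. *)
Let inv (m j i : nat) (st : nat * nat -> R) := [/\
  forall i', (i' < m)%N -> st (i'.+1, 0%N) = if (i' < i)%N then Hinc i' j.+1 else Hinc i' j,
  st (0%N, j.+1) = Vinc i j,
  forall j', (j < j')%N -> st (0%N, j'.+1) = Vinc 0 j' &
  forall i' j', st (i'.+1, j'.+1) = e i'.+1 j'.+1].

Let inv_step m j i st : (i < m)%N -> inv m j i st ->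
  inv m j i.+1 (cell_step st (i.+1, j.+1)).
Proof.
move=> im [h1 h2 h3 h4]; rewrite /cell_step; split => /=.
- move=> i' i'm; rewrite !xpair_eqE /= !andbT eqSS.
  case: ifPn => [/eqP->|ii']; last by rewrite h1// [in RHS]ltnS [in RHS]leq_eqVlt (negPf ii').
  by rewrite h4 h1// ltnn h2 ltnS leqnn HincS.
- by rewrite eqxx h4 h2 h1// ltnn VincS.
- move=> j' jj'; rewrite !xpair_eqE /= eqSS; case: eqP => [jE|_]; last exact: h3.
  by rewrite jE ltnn in jj'.
- by move=> i' j'; rewrite !xpair_eqE /= andbF.
Qed.

Let inv_row m j k st : (k <= m)%N -> inv m j 0 st ->
  inv m j k (foldl cell_step st (row_cells k j)).
Proof.
elim: k => [//|k IH] km h.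
rewrite /row_cells -addn1 iotaD map_cat foldl_cat /= add0n addn1.
by apply: inv_step => //; apply: IH => //; exact: ltnW.
Qed.

Lemma stationary_state m n st :
  (forall p, p != (0%N, 0%N) -> st p = statw p.1 p.2) ->
  forall i, (i < m)%N -> foldl cell_step st (grid_cells m n) (i.+1, 0%N) = Hinc i n.
Proof.
move=> hst.
suff : inv m n 0 (foldl cell_step st (grid_cells m n)) by case=> h _ _ _ i im; rewrite h.
elim: n => [|n IH].
  split => /=.
  - by move=> i' _; rewrite hst//= Hinc0.
  - by rewrite hst//= Vinc0.
  - by move=> j' _; rewrite hst//= Vinc0.
  - by move=> i' j'; rewrite hst.
rewrite /grid_cells -addn1 iotaD map_cat flatten_cat foldl_cat /= cats0 add0n.
have [h1 h2 h3 h4] := inv_row (leqnn m) IH.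
rewrite addn1; split => //.
- by move=> i' i'm; rewrite h1// i'm.
- by rewrite h3.
- by move=> j' jj'; rewrite h3//; exact: ltnW.
Qed.

End stationary.
End last_passage.
Arguments lpp : simpl never.

(** * Burke's property along a whole grid *)

Section exponential_grid.
Context d (T : measurableType d) (R : realType) (P : probability T R).
Implicit Types (X : nat -> nat -> T -> R).

Lemma mutind_comp (I J : eqType) (S : {pred I}) (S' : {pred J}) (Z : I -> T -> R)
    (f : J -> I) (g : I -> J) : cancel f g -> (forall j, j \in S' -> f j \in S) ->
  mutind P S Z -> mutind P S' (fun j => Z (f j)).
Proof.
move=> fK fS ind s B us sS' mB.
have := ind (map f s) (fun i => B (g i)) _ _ _; rewrite big_map.
have -> : box Z (map f s) (fun i => B (g i)) = box (fun j => Z (f j)) s B.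
  apply/seteqP; split => w h.
    by move=> j js; have := h (f j); rewrite /= fK; apply; apply/mapP; exists j.
  by move=> _ /mapP[j js ->]; rewrite fK; exact: h.
move=> -> //.
- by apply: eq_bigr => j _; rewrite fK.
- by rewrite map_inj_uniq//; exact: can_inj fK.
- by move=> _ /mapP[j js ->]; apply: fS; exact: sS'.
Qed.

Lemma mutind_sub (I : eqType) (S S' : {pred I}) (Z : I -> T -> R) :
  (forall i, i \in S' -> i \in S) -> mutind P S Z -> mutind P S' Z.
Proof. by move=> SS' ind s B us sS' mB; apply: ind => // i /sS'; exact: SS'. Qed.

Lemma mutind_scale (I : eqType) (S : {pred I}) (Z : I -> T -> R) (c : I -> R) :
  mutind P S Z -> mutind P S (fun i w => Z i w * c i).
Proof.
move=> ind s B us sS mB.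
pose B' i := (fun x : R => x * c i) @^-1` B i.
have mB' i : measurable (B' i).
  by rewrite /B' -[X in measurable X]setTI; apply: measurable_funM => //; exact: mB.
exact: (ind s B').
Qed.

(** Nonnegativity is required at every sample point because the comparisons of passage times are
    made pointwise. *)
Record expgrid (U V : nat) X : Prop := ExpGrid {
  expgrid_meas : forall i j, (i <= U)%N -> (j <= V)%N -> measurable_fun setT (X i j);
  expgrid_ge0 : forall i j w, 0 <= X i j w;
  expgrid_tail : forall i j, (i <= U)%N -> (j <= V)%N -> forall t : R, 0 <= t ->
    P [set w | t < X i j w] = (expR (- t))%:E;
  expgrid_ind : mutind P [pred p : nat * nat | (p.1 <= U)%N && (p.2 <= V)%N]
    (fun p => X p.1 p.2) }.

Lemma expgrid_shift U V X p q m n : expgrid U V X -> (p + m <= U)%N -> (q + n <= V)%N ->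
  expgrid m n (fun i j => X (p + i)%N (q + j)%N).
Proof.
move=> [h1 h2 h3 h4] pm qn; split => //.
- by move=> i j im jn; apply: h1; lia.
- by move=> i j im jn t t0; apply: h3 => //; lia.
- apply: (@mutind_comp _ _ _ _ _ (fun x : nat * nat => (p + x.1, q + x.2)%N)
    (fun x => (x.1 - p, x.2 - q)%N) _ _ h4).
    by move=> [a b] /=; rewrite !addKn.
  by move=> [a b]; rewrite !inE /= => /andP[? ?]; apply/andP; split; lia.
Qed.

Section stationary.
Variables (rho : R) (m n : nat) (X : nat -> nat -> T -> R).
Hypotheses (rho01 : 0 < rho < 1) (gX : expgrid m n X).

(** The law of a slot depends only on its kind: horizontal increment, vertical increment or bulk
    weight. Hence it survives each step. *)
Let rate (p : nat * nat) : R := if p.2 == 0%N then 1 - rho else if p.1 == 0%N then rho else 1.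

Let good (S : {pred nat * nat}) (Z : nat * nat -> T -> R) := [/\
  mutind P S Z, {in S, forall p, measurable_fun setT (Z p)},
  {in S, forall p w, 0 <= Z p w} &
  {in S, forall p (t : R), 0 <= t -> P [set w | t < Z p w] = (expR (- rate p * t))%:E}].

Let pmr (Z : T -> R) (B : set R) : measurable_fun setT Z -> measurable B ->
  measurable (Z @^-1` B).
Proof. by move=> mX mB; rewrite -[X in measurable X]setTI; exact: mX. Qed.

(** One use of [burke_step]: the slots of the column and of the row take the outgoing increments
    with unchanged laws, and the weight of the cell, now spent, leaves the independent family. *)
Let good_step S Z i j : good S Z -> (i.+1, 0%N) \in S -> (0%N, j.+1) \in S ->
  (i.+1, j.+1) \in S ->
  good [pred p in S | p != (i.+1, j.+1)]
    (fun p w => cell_step (fun q => Z q w) (i.+1, j.+1) p).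
Proof.
move=> [ind mZ Z0 Zt] aS bS cS.
set a := (i.+1, 0%N); set b := (0%N, j.+1); set c := (i.+1, j.+1).
move: rho01 => /andP[r0 r1].
pose phi (z : R * (R * R)) := z.2.2 + Num.max (z.1 - z.2.1) 0.
pose psi (z : R * (R * R)) := z.2.2 + Num.max (z.2.1 - z.1) 0.
have m21 : measurable_fun setT (fun z : R * (R * R) => z.2.1).
  by apply: (measurableT_comp (f := fst)) => //.
have m22 : measurable_fun setT (fun z : R * (R * R) => z.2.2).
  by apply: (measurableT_comp (f := snd)) => //.
have mphi : measurable_fun setT phi.
  by apply: measurable_funD => //; apply: measurable_maxr => //; apply: measurable_funB.
have mpsi : measurable_fun setT psi.
  by apply: measurable_funD => //; apply: measurable_maxr => //; apply: measurable_funB.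
pose U w := phi (Z a w, (Z b w, Z c w)).
pose V w := psi (Z a w, (Z b w, Z c w)).
have uabc : uniq [:: a; b; c] by rewrite /= !inE /a /b /c !xpair_eqE /= ?eqxx ?andbF.
have ZE : (fun p w => cell_step (fun q => Z q w) c p) = upd2 a b U V Z.
  apply/funext => p; apply/funext => w; rewrite /cell_step /upd2 /= -/a -/b.
  by case: ifP => // _; case: ifP.
have bk (B1 B2 : set R) : measurable B1 -> measurable B2 ->
    P (U @^-1` B1 `&` V @^-1` B2) = (P (Z a @^-1` B1) * P (Z b @^-1` B2))%E.
  have abrate : 1 = (1 - rho) + rho :> R by ring.
  apply: (@burke_step _ _ _ P (Z a) (Z b) (Z c) (1 - rho) rho).
  - lra.
  - lra.
  - exact: mZ.
  - exact: mZ.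
  - exact: mZ.
  - exact: Z0.
  - exact: Z0.
  - by move=> t t0; rewrite Zt.
  - by move=> t t0; rewrite Zt.
  - by move=> t t0; rewrite -abrate Zt.
  - move=> B1' B2' mB1 mB2.
    pose B p := if p == a then B1' else B2'.
    have mB p : measurable (B p) by rewrite /B; case: ifP.
    have := ind [:: a; b] B _ _ mB; rewrite !box_cons box_nil setIT !big_cons big_nil.
    rewrite /B eqxx (_ : b == a = false) ?mule1//; apply => //.
    by move=> p; rewrite !inE => /orP[/eqP->|/eqP->].
  - move=> B1' D mB1 mD.
    apply: indep_pair => //.
    + exact: mZ.
    + exact: mZ.
    + by apply: pmr => //; exact: mZ.
    move=> B2' B3' mB2 mB3.
    pose B p := if p == a then B2' else if p == b then B3' else B1'.
    have mB p : measurable (B p) by rewrite /B; case: ifP => // _; case: ifP.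
    have := ind [:: c; a; b] B _ _ mB; rewrite !box_cons box_nil setIT !big_cons big_nil.
    have Ba : B a = B2' by rewrite /B eqxx.
    have Bb : B b = B3' by rewrite /B /a /b !xpair_eqE /= eqxx.
    have Bc : B c = B1' by rewrite /B /c /a /b !xpair_eqE /= andbF.
    rewrite Ba Bb Bc mule1 => ->//; last by move=> p; rewrite !inE => /or3P[/eqP->|/eqP->|/eqP->].
    have := ind [:: a; b] B _ _ mB; rewrite !box_cons box_nil setIT !big_cons big_nil.
    rewrite Ba Bb mule1 => ->//.
    by move=> p; rewrite !inE => /orP[/eqP->|/eqP->].
have UE (B1 : set R) : measurable B1 -> P (U @^-1` B1) = P (Z a @^-1` B1).
  by move=> mB1; have := bk B1 setT mB1 measurableT; rewrite !preimage_setT !setIT probability_setT mule1.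
have VE (B1 : set R) : measurable B1 -> P (V @^-1` B1) = P (Z b @^-1` B1).
  by move=> mB1; have := bk setT B1 measurableT mB1; rewrite !preimage_setT !setTI probability_setT mul1e.
have mtri : measurable_fun setT (fun w => (Z a w, (Z b w, Z c w))).
  by apply/measurable_fun_pair; [exact: mZ|apply/measurable_fun_pair; exact: mZ].
have rayE (Y : T -> R) (u : R) : Y @^-1` `]u, +oo[%classic = [set w | u < Y w].
  by apply/seteqP; split => w /=; rewrite in_itv/= andbT.
rewrite ZE; split.
- by apply: mutind_upd2 => // B1 B2 mB1 mB2; rewrite bk// UE// VE.
- move=> p; rewrite inE => /andP[pS _]; rewrite /upd2.
  case: ifP => _; first exact: (measurableT_comp mphi mtri).
  by case: ifP => _; [exact: (measurableT_comp mpsi mtri)|exact: mZ].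
- move=> p; rewrite inE => /andP[pS _] w; rewrite /upd2.
  case: ifP => _; first by rewrite addr_ge0 ?Z0//= le_max lexx orbT.
  by case: ifP => _; [rewrite addr_ge0 ?Z0//= le_max lexx orbT|exact: Z0].
- move=> p; rewrite inE => /andP[pS _] t t0; rewrite /upd2.
  case: ifPn => [/eqP->|_].
    by rewrite -rayE UE; [rewrite rayE Zt|exact: measurable_itv].
  case: ifPn => [/eqP->|_]; last exact: Zt.
  by rewrite -rayE VE; [rewrite rayE Zt|exact: measurable_itv].
Qed.

Let good_fold S Z cells : good S Z -> uniq cells ->
  (forall c, c \in cells -> [/\ c \in S, (0 < c.1)%N, (0 < c.2)%N,
      (c.1, 0%N) \in S & (0%N, c.2) \in S]) ->
  good [pred p in S | p \notin cells]
    (fun p w => foldl cell_step (fun q => Z q w) cells p).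
Proof.
elim: cells S Z => [|c cells IH] S Z gZ /=.
  move=> _ _; case: gZ => h1 h2 h3 h4; split.
  - by apply: mutind_sub h1 => p; rewrite !inE andbT.
  - by move=> p; rewrite !inE andbT; exact: h2.
  - by move=> p; rewrite !inE andbT; exact: h3.
  - by move=> p; rewrite !inE andbT; exact: h4.
move=> /andP[cc uc] hc.
have [] := hc c (mem_head _ _); case: c cc hc => [[|i] [|j]]//= cc hc cS _ _ aS bS.
have := IH _ _ (good_step gZ aS bS cS) uc.
have hc' c' : c' \in cells -> [/\ c' \in [pred p in S | p != (i.+1, j.+1)], (0 < c'.1)%N, (0 < c'.2)%N,
      (c'.1, 0%N) \in [pred p in S | p != (i.+1, j.+1)] &
      (0%N, c'.2) \in [pred p in S | p != (i.+1, j.+1)]].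
  move=> c'c; have := hc c'; rewrite inE c'c orbT => /(_ isT) [k1 k2 k3 k4 k5].
  rewrite !inE k1 k4 k5 /= !xpair_eqE /= !andbF /=; split => //.
  by apply/eqP => c'E; move: cc; rewrite -c'E c'c.
move=> /(_ hc') [h1 h2 h3 h4]; split.
- by apply: mutind_sub h1 => p; rewrite !inE negb_or => /and3P[-> -> ->].
- by move=> p; rewrite !inE negb_or => /and3P[p1 p2 p3]; apply: h2; rewrite !inE p1 p2 p3.
- by move=> p; rewrite !inE negb_or => /and3P[p1 p2 p3]; apply: h3; rewrite !inE p1 p2 p3.
- by move=> p; rewrite !inE negb_or => /and3P[p1 p2 p3]; apply: h4; rewrite !inE p1 p2 p3.
Qed.

Let S0 := [pred p : nat * nat | [&& (p.1 <= m)%N, (p.2 <= n)%N & p != (0%N, 0%N)]].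
Let Z0 (p : nat * nat) w := statw rho (fun i j => X i j w) p.1 p.2.

Let good0 : good S0 Z0.
Proof.
move: rho01 => /andP[r0 r1]; have r0' : 0 < 1 - rho by lra.
case: gX => h1 h2 h3 h4.
have rp p : 0 < rate p by rewrite /rate; case: ifP => // _; case: ifP.
have ZE p : p \in S0 -> Z0 p = fun w => X p.1 p.2 w * (rate p)^-1.
  case: p => -[|i] [|j]; rewrite !inE /= ?andbF// => _; apply/funext => w; rewrite /Z0 /rate //=.
  by rewrite invr1 mulr1.
split.
- have ind := mutind_scale (fun p => (rate p)^-1) h4.
  move=> s B us sS mB; have := ind s B us _ mB.
  rewrite (_ : box _ s B = box Z0 s B); last first.
    by apply: eq_box => p /sS pS; rewrite ZE.
  move=> -> ; first by apply: eq_big_seq => p /sS pS; rewrite ZE.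
  by move=> p /sS; rewrite !inE => /and3P[-> ->].
- move=> p pS; rewrite ZE//; apply: measurable_funM => //.
  by move: pS; rewrite !inE => /and3P[? ? _]; exact: h1.
- by move=> p pS w; rewrite ZE// mulr_ge0 ?h2// invr_ge0 ltW.
- move=> p pS t t0; rewrite ZE//.
  rewrite (_ : [set w | _] = [set w | rate p * t < X p.1 p.2 w]); last first.
    by apply/seteqP; split => w /=; rewrite ltr_pdivlMr// mulrC.
  move: pS; rewrite !inE => /and3P[? ? _].
  by rewrite h3// ?mulNr// mulr_ge0// ltW.
Qed.

Let Zn p w := foldl cell_step (fun q => Z0 q w) (grid_cells m n) p.

Let mem_cells c : c \in grid_cells m n -> [/\ (0 < c.1)%N, (0 < c.2)%N, (c.1 <= m)%N & (c.2 <= n)%N].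
Proof.
move=> /flatten_mapP[j]; rewrite mem_iota /= add0n => jn /mapP[i].
by rewrite mem_iota /= add0n => im -> /=.
Qed.

Let uniq_cells : uniq (grid_cells m n).
Proof.
apply: (@allpairs_uniq _ _ _ (fun j i => (i.+1, j.+1))); rewrite ?iota_uniq//.
by move=> [a b] [a' b'] _ _ /= [-> ->].
Qed.

Let goodn : good [pred p in S0 | p \notin grid_cells m n] Zn.
Proof.
apply: (good_fold good0 uniq_cells).
move=> c /mem_cells[c1 c2 c3 c4]; rewrite !inE /= c3 c4 /= !xpair_eqE /= !andbT.
by split => //; rewrite -?lt0n//; apply: contraTneq c1 => ->.
Qed.

Let L w := lpp (statw rho (fun i j => X i j w)) m n.

Let Hs := [seq (i.+1, 0%N) | i <- iota 0 m].
Let Vs := [seq (0%N, j.+1) | j <- iota 0 n].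

Let LE w : L w = \sum_(p <- Vs) Z0 p w + \sum_(p <- Hs) Zn p w.
Proof.
rewrite /L statE; congr (_ + _).
  by rewrite /Vs big_map -(big_mkord predT (fun j => X 0%N j.+1 w / rho)) /index_iota subn0.
rewrite /Hs big_map -(big_mkord predT (fun i => Hinc rho (fun i j => X i j w) i n)) /index_iota subn0.
apply: eq_big_seq => i; rewrite mem_iota add0n => /= im.
by rewrite /Zn (@stationary_state _ rho (fun i j => X i j w)).
Qed.

Let mH : {subset Hs <= [pred p in S0 | p \notin grid_cells m n]}.
Proof.
move=> p /mapP[i]; rewrite mem_iota add0n => /= im ->; rewrite !inE /= im /=.
by apply/negP => /mem_cells[].
Qed.

Let mV : {subset Vs <= S0}.
Proof. by move=> p /mapP[j]; rewrite mem_iota add0n => /= jn ->; rewrite !inE /= jn. Qed.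

Let uH : uniq Hs. Proof. by rewrite map_inj_uniq ?iota_uniq// => i j []. Qed.
Let uV : uniq Vs. Proof. by rewrite map_inj_uniq ?iota_uniq// => i j []. Qed.

Let HsT p : p \in Hs -> forall t : R, 0 <= t ->
  P [set w | t < Zn p w] = (expR (- (1 - rho) * t))%:E.
Proof.
move=> pH t t0; case: goodn => _ _ _ ->//; last exact: mH.
by move: pH => /mapP[i _ ->].
Qed.

Let VsT p : p \in Vs -> forall t : R, 0 <= t ->
  P [set w | t < Z0 p w] = (expR (- rho * t))%:E.
Proof.
move=> pV t t0; case: good0 => _ _ _ ->//; last exact: mV.
by move: pV => /mapP[i _ ->].
Qed.

Let msumH : measurable_fun setT (fun w => \sum_(p <- Hs) Zn p w).
Proof. by apply: measurable_sum_seq => p /mH pS; case: goodn => _ h _ _; exact: h. Qed.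

Let msumV : measurable_fun setT (fun w => \sum_(p <- Vs) Z0 p w).
Proof. by apply: measurable_sum_seq => p /mV pS; case: good0 => _ h _ _; exact: h. Qed.

Lemma measurable_stat : measurable_fun setT
  (fun w => lpp (statw rho (fun i j => X i j w)) m n).
Proof.
rewrite (_ : (fun w => _) = (fun w => \sum_(p <- Vs) Z0 p w) \+ (fun w => \sum_(p <- Hs) Zn p w)).
  exact: measurable_funD msumV msumH.
by apply/funext => w; exact: LE.
Qed.

Lemma measurable_ge_fun (f : T -> R) (x : R) : measurable_fun setT f ->
  measurable [set w | x <= f w].
Proof.
move=> mf; rewrite (_ : [set w | _] = f @^-1` `[x, +oo[%classic).
  by apply: pmr => //; exact: measurable_itv.
by apply/seteqP; split => w /=; rewrite in_itv/= andbT.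
Qed.

Lemma measurable_le_fun (f : T -> R) (x : R) : measurable_fun setT f ->
  measurable [set w | f w <= x].
Proof.
move=> mf; rewrite (_ : [set w | _] = f @^-1` `]-oo, x]%classic).
  by apply: pmr => //; exact: measurable_itv.
by apply/seteqP; split => w /=; rewrite in_itv/=.
Qed.

(** The slack [2 * x] is shared equally between the sum over the vertical axis and the sum over the
    top row; a union bound avoids any question about their joint law. *)
Lemma stat_upper (tau x : R) : 0 <= tau <= 2^-1 ->
  (P [set w | m%:R / (1 - rho) + n%:R / rho + 2 * x <=
              lpp (statw rho (fun i j => X i j w)) m n]%R <=
   (expR (m%:R * (2 * tau ^+ 2) - (1 - rho) * tau * x))%:E +
   (expR (n%:R * (2 * tau ^+ 2) - rho * tau * x))%:E)%E.
Proof.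
move=> ht; have [r0 r1] : 0 < rho /\ 0 < 1 - rho by move: rho01 => /andP[]; split; lra.
case: good0 => i1 i2 _ _; case: goodn => j1 j2 _ _.
have hV := @chernoff_upper _ _ _ P _ rho r0 S0 Z0 Vs i1 i2 uV mV VsT tau x ht.
have hH := @chernoff_upper _ _ _ P _ (1 - rho) r1 _ Zn Hs j1 j2 uH mH HsT tau x ht.
rewrite /Vs size_map size_iota -/Vs in hV; rewrite /Hs size_map size_iota -/Hs in hH.
apply: le_trans (le_trans (measureU2 P _ _) (leeD hH hV)); last 2 first.
- exact: measurable_ge_fun.
- exact: measurable_ge_fun.
apply: le_measure; rewrite ?inE.
- exact/measurable_ge_fun/measurable_stat.
- by apply: measurableU; exact: measurable_ge_fun.
move=> w /=; rewrite -/(L w) LE => h.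
have [h1|h1] := leP (m%:R / (1 - rho) + x) (\sum_(p <- Hs) Zn p w); [by left|right].
move: h h1; lra.
Qed.

Lemma stat_lower (tau x : R) : 0 <= tau <= 2^-1 ->
  (P [set w | lpp (statw rho (fun i j => X i j w)) m n <=
              m%:R / (1 - rho) + n%:R / rho - 2 * x]%R <=
   (expR (m%:R * (2 * tau ^+ 2) - (1 - rho) * tau * x))%:E +
   (expR (n%:R * (2 * tau ^+ 2) - rho * tau * x))%:E)%E.
Proof.
move=> ht; have [r0 r1] : 0 < rho /\ 0 < 1 - rho by move: rho01 => /andP[]; split; lra.
case: good0 => i1 i2 _ _; case: goodn => j1 j2 _ _.
have hV := @chernoff_lower _ _ _ P _ rho r0 S0 Z0 Vs i1 i2 uV mV VsT tau x ht.
have hH := @chernoff_lower _ _ _ P _ (1 - rho) r1 _ Zn Hs j1 j2 uH mH HsT tau x ht.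
rewrite /Vs size_map size_iota -/Vs in hV; rewrite /Hs size_map size_iota -/Hs in hH.
apply: le_trans (le_trans (measureU2 P _ _) (leeD hH hV)); last 2 first.
- exact: measurable_le_fun.
- exact: measurable_le_fun.
apply: le_measure; rewrite ?inE.
- exact/measurable_le_fun/measurable_stat.
- by apply: measurableU; exact: measurable_le_fun.
move=> w /=; rewrite -/(L w) LE => h.
have [h1|h1] := leP (\sum_(p <- Hs) Zn p w) (m%:R / (1 - rho) - x); [by left|right].
move: h h1; lra.
Qed.

End stationary.
End exponential_grid.

(** * The shape function and the characteristic parameter *)

Section shape_algebra.
Context {R : realType}.
Implicit Types (m n k rho : R).

Definition shapeg m n : R := (Num.sqrt m + Num.sqrt n) ^+ 2.

Lemma shapegE m n : 0 <= m -> 0 <= n -> shapeg m n = m + n + 2 * Num.sqrt m * Num.sqrt n.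
Proof.
move=> m0 n0; rewrite /shapeg -{2}(sqr_sqrtr m0) -{2}(sqr_sqrtr n0); ring.
Qed.

Lemma shapegC m n : shapeg m n = shapeg n m. Proof. by rewrite /shapeg addrC. Qed.

Lemma le_shapeg m n m' n' : m <= m' -> n <= n' -> shapeg m n <= shapeg m' n'.
Proof.
move=> mm nn; rewrite /shapeg lerXn2r// ?nnegrE ?addr_ge0 ?sqrtr_ge0//.
by rewrite lerD// ler_wsqrtr.
Qed.

Lemma sqrt_add_le m n : 0 <= m -> 0 <= n -> Num.sqrt (m + n) <= Num.sqrt m + Num.sqrt n.
Proof.
move=> m0 n0; rewrite -(@ler_pXn2r _ 2)// ?nnegrE ?addr_ge0 ?sqrtr_ge0//.
rewrite sqr_sqrtr ?addr_ge0// sqrrD !sqr_sqrtr//.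
have := sqrtr_ge0 m; have := sqrtr_ge0 n; nra.
Qed.

(** The minimiser over [rho] of [m / (1 - rho) + n / rho], the stationary growth rate; the minimum
    is [shapeg m n]. *)
Definition crho m n : R := Num.sqrt n / (Num.sqrt m + Num.sqrt n).

Lemma crho_onem m n : 0 < m -> 0 < n -> 1 - crho m n = Num.sqrt m / (Num.sqrt m + Num.sqrt n).
Proof.
move=> m0 n0; rewrite /crho; field.
by rewrite gt_eqF// addr_gt0 ?sqrtr_gt0.
Qed.

Lemma crho01 m n : 0 < m -> 0 < n -> 0 < crho m n < 1.
Proof.
move=> m0 n0; rewrite /crho divr_gt0 ?addr_gt0 ?sqrtr_gt0//=.
by rewrite ltr_pdivrMr ?addr_gt0 ?sqrtr_gt0// mul1r ltrDr sqrtr_gt0.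
Qed.

Lemma crho_shapeg m n : 0 < m -> 0 < n ->
  m / (1 - crho m n) + n / crho m n = shapeg m n.
Proof.
move=> m0 n0; rewrite crho_onem// /crho /shapeg.
rewrite -{1}(sqr_sqrtr (ltW m0)) -{2}(sqr_sqrtr (ltW n0)); field.
by rewrite !gt_eqF ?addr_gt0 ?sqrtr_gt0.
Qed.

(* Completing the square: [shapeg] is the infimum over [rho] of the stationary
   growth rate, with a quadratic defect away from the characteristic direction. *)
Lemma crho_gap m n k : 0 < m -> 0 < n -> 0 <= k <= m ->
  k / (1 - crho m n) + shapeg (m - k) n +
    Num.sqrt n / (4 * m * Num.sqrt m) * k ^+ 2 <= shapeg m n.
Proof.
move=> m0 n0 /andP[k0 km].
have sm : 0 < Num.sqrt m by rewrite sqrtr_gt0.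
have sn : 0 < Num.sqrt n by rewrite sqrtr_gt0.
rewrite crho_onem// /shapeg.
set a := Num.sqrt m in sm *; set b := Num.sqrt n in sn *; set c := Num.sqrt (m - k).
have aE : m = a ^+ 2 by rewrite sqr_sqrtr// ltW.
have cE : m - k = c ^+ 2 by rewrite sqr_sqrtr// subr_ge0.
have c0 : 0 <= c by exact: sqrtr_ge0.
have ca : c <= a by rewrite ler_wsqrtr// lerBlDr lerDl.
have kE : k = a ^+ 2 - c ^+ 2 by rewrite -aE -cE; ring.
rewrite kE aE -subr_ge0.
(* The exact gap is [b / a * (a - c) ^+ 2]. As [k = (a - c) * (a + c)] with [a + c <= 2 * a], it is
   at least [b / (4 * a ^+ 3) * k ^+ 2]. *)
rewrite (_ : _ - _ = b / a * (a - c) ^+ 2 * (1 - (a + c) ^+ 2 / (4 * a ^+ 2))).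
  apply: mulr_ge0; first by apply: mulr_ge0; [rewrite divr_ge0// ltW|exact: sqr_ge0].
  rewrite subr_ge0 ler_pdivrMr ?mulr_gt0 ?exprn_gt0// mul1r; nra.
by field; rewrite !gt_eqF// addr_gt0.
Qed.

(** A bounded aspect ratio keeps the characteristic parameter away from 0 and 1, so that the
    Chernoff rates are uniform. *)
Lemma crho_ge m n (A ka M : R) : 0 < ka -> 0 < A -> 0 < M ->
  ka * M <= m <= A * M -> ka * M <= n <= A * M ->
  Num.sqrt ka / (2 * Num.sqrt A) <= crho m n /\
  Num.sqrt ka / (2 * Num.sqrt A) <= 1 - crho m n.
Proof.
move=> ka0 A0 M0 /andP[m1 m2] /andP[n1 n2].
have m0 : 0 < m by rewrite (lt_le_trans _ m1)// mulr_gt0.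
have n0 : 0 < n by rewrite (lt_le_trans _ n1)// mulr_gt0.
rewrite crho_onem// /crho.
have sM : 0 < Num.sqrt M by rewrite sqrtr_gt0.
have sA : 0 < Num.sqrt A by rewrite sqrtr_gt0.
have sk : 0 < Num.sqrt ka by rewrite sqrtr_gt0.
have ub x : x <= A * M -> Num.sqrt x <= Num.sqrt A * Num.sqrt M.
  by move=> xA; rewrite -sqrtrM ?(ltW A0)// ler_wsqrtr.
have lb x : ka * M <= x -> Num.sqrt ka * Num.sqrt M <= Num.sqrt x.
  by move=> xA; rewrite -sqrtrM ?(ltW ka0)// ler_wsqrtr.
have main x y z : 0 < y -> 0 < z -> Num.sqrt ka * Num.sqrt M <= x ->
  y <= Num.sqrt A * Num.sqrt M -> z <= Num.sqrt A * Num.sqrt M ->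
  Num.sqrt ka / (2 * Num.sqrt A) <= x / (y + z).
  move=> y0 z0 hx hy hz; rewrite ler_pdivlMr ?addr_gt0// mulrAC ler_pdivrMr ?mulr_gt0//.
  apply: (@le_trans _ _ (Num.sqrt ka * (2 * (Num.sqrt A * Num.sqrt M)))).
    by rewrite ler_pM2l//; lra.
  rewrite [leLHS](_ : _ = (Num.sqrt ka * Num.sqrt M) * (2 * Num.sqrt A)); last by ring.
  by rewrite ler_pM2r// mulr_gt0.
by split; apply: main; rewrite ?sqrtr_gt0//; [exact: lb|exact: ub|exact: ub|exact: lb|exact: ub|exact: ub].
Qed.

(** Half of the exponential rate is spent on absorbing a polynomial factor, which comes from the
    number of events in a union bound. *)
Lemma poly_expR (A c : R) (k : nat) : 0 <= A -> 0 < c -> exists2 C : R, 0 < C &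
  forall M : R, 0 <= M -> (A * M + 1) ^+ k * expR (- c * M) <= C * expR (- (c / 2) * M).
Proof.
move=> A0 c0; have s0 : 0 < c / (2 * k.+1%:R) by rewrite divr_gt0// mulr_gt0// ltr0n.
set s := c / _ in s0.
have D0 : 1 <= 1 + A / s by rewrite lerDl divr_ge0// ltW.
exists ((1 + A / s) ^+ k); first by rewrite exprn_gt0// (lt_le_trans _ D0).
move=> M M0.
have h1 : A * M + 1 <= (1 + A / s) * expR (s * M).
  apply: (@le_trans _ _ ((1 + A / s) * (1 + s * M))); last first.
    by rewrite ler_pM2l ?expR_ge1Dx// (lt_le_trans _ D0).
  rewrite [leRHS](_ : _ = A * M + 1 + s * M + A / s); last by field; rewrite gt_eqF.
  by have : 0 <= s * M; [rewrite mulr_ge0// ltW|have : 0 <= A / s; [rewrite divr_ge0// ltW|lra]].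
have h2 : (A * M + 1) ^+ k <= (1 + A / s) ^+ k * expR (s * M) ^+ k.
  rewrite -exprMn lerXn2r// nnegrE ?addr_ge0 ?mulr_ge0 ?expR_ge0//.
  by rewrite (le_trans _ D0).
apply: (le_trans (ler_wpM2r (expR_ge0 _) h2)).
rewrite -mulrA ler_pM2l ?exprn_gt0 ?(lt_le_trans _ D0)//.
rewrite -expRM_natl -expRD ler_expR.
suff : k%:R * s <= c / 2.
  by move=> ks; have := ler_wpM2r M0 ks; lra.
rewrite /s mulrCA ler_pM2l// ler_pdivrMr ?mulr_gt0 ?ltr0n//.
rewrite (_ : _ * (2 * _) = k.+1%:R); last by field.
by rewrite ler_nat.
Qed.

End shape_algebra.

(** * Upper tail of the homogeneous model *)

Section homogeneous.
Context d (T : measurableType d) (R : realType) (P : probability T R).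
Implicit Types (X : nat -> nat -> T -> R) (A c C M eps : R).

Local Notation lppX X m n := (fun w => lpp (fun i j => X i j w) m n).

Lemma measurable_lpp X m n :
  (forall i j, (i <= m)%N -> (j <= n)%N -> measurable_fun setT (X i j)) ->
  measurable_fun setT (lppX X m n).
Proof.
elim: m n => [|m IHm] n; elim: n => [|n IHn] mX.
- exact: mX.
- apply: (@measurable_funD _ _ _ _ (lppX X 0 n) (X 0%N n.+1)); last exact: mX.
  by apply: IHn => i j hi hj; apply: mX => //; exact: leqW.
- apply: (@measurable_funD _ _ _ _ (lppX X m 0) (X m.+1 0%N)); last exact: mX.
  by apply: IHm => i j hi hj; apply: mX => //; exact: leqW.
- apply: (@measurable_funD _ _ _ _ (X m.+1 n.+1)); first exact: mX.
  apply: (@measurable_maxr _ _ _ _ (lppX X m n.+1) (lppX X m.+1 n)).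
    by apply: IHm => i j hi hj; apply: mX => //; exact: leqW.
  by apply: IHn => i j hi hj; apply: mX => //; exact: leqW.
Qed.

Lemma union_bound (A : nat -> set T) n (b : R) :
  (forall k, (k < n)%N -> measurable (A k)) ->
  (forall k, (k < n)%N -> (P (A k) <= b%:E)%E) ->
  (P [set w | exists2 k, (k < n)%N & A k w] <= (n%:R * b)%:E)%E /\
  measurable [set w | exists2 k, (k < n)%N & A k w].
Proof.
move=> mA hA.
have -> : [set w | exists2 k, (k < n)%N & A k w] = \big[setU/set0]_(k < n) A k.
  by rewrite -bigcup_mkord; apply/seteqP; split => [w [k kn Ak]|w [k kn Ak]]; exists k.
split; last by apply: bigsetU_measurable => k _; exact: mA.
apply: le_trans (Boole_inequality P _) _ => //.
apply: (@le_trans _ _ (\sum_(k < n) b%:E)%E).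
  by apply: lee_sum => k _; exact: hA.
by rewrite sumEFin lee_fin sumr_const card_ord mulr_natl.
Qed.

Lemma chernoff_rate (a A ep : R) : 0 < a -> 0 < A -> 0 < ep ->
  exists2 tau : R, 0 <= tau <= 2^-1 & exists2 c : R, 0 < c &
  forall (k M b : R), 0 <= M -> k <= A * M -> a <= b ->
    expR (k * (2 * tau ^+ 2) - b * tau * (ep * M)) <= expR (- c * M).
Proof.
move=> a0 A0 e0; pose tau := Num.min 2^-1 (a * ep / (4 * A)).
have t0 : 0 < tau by rewrite lt_min invr_gt0 ltr0n /= divr_gt0 ?mulr_gt0.
have t1 : tau <= 2^-1 by rewrite ge_min lexx.
have t2 : tau <= a * ep / (4 * A) by rewrite ge_min lexx orbT.
exists tau; first by rewrite (ltW t0) t1.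
exists (a * tau * ep / 2); first by rewrite divr_gt0 ?mulr_gt0.
move=> k M b M0 kA ab; rewrite ler_expR.
have t3 : 4 * A * tau <= a * ep by rewrite mulrC -ler_pdivlMr// mulr_gt0.
have h1 : k * (2 * tau ^+ 2) <= A * M * (2 * tau ^+ 2).
  by rewrite ler_wpM2r// mulr_ge0// sqr_ge0.
have h2 : a * (tau * (ep * M)) <= b * (tau * (ep * M)).
  by rewrite ler_wpM2r// !mulr_ge0// ltW.
have h3 : (4 * A * tau) * (tau * M) <= (a * ep) * (tau * M).
  by rewrite ler_wpM2r// mulr_ge0// ltW.
move: h1 h2 h3; rewrite expr2; lra.
Qed.

Lemma expgrid_tail_ge X m n i j (t : R) : expgrid P m n X -> (i <= m)%N -> (j <= n)%N ->
  0 < t -> (P [set w | t <= X i j w]%R <= (expR (- (t / 2)))%:E)%E.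
Proof.
move=> gX im jn t0; rewrite -(expgrid_tail gX im jn); last by rewrite divr_ge0// ltW.
apply: le_measure; rewrite ?inE.
- by apply: measurable_ge_fun; exact: (expgrid_meas gX).
- rewrite (_ : [set w | _] = setT `&` X i j @^-1` `]t / 2, +oo[%classic).
    by apply: (expgrid_meas gX).
  by apply/seteqP; split => w /=; rewrite in_itv/= andbT// => -[].
- by move=> w /=; apply: lt_le_trans; lra.
Qed.

(** The stationary passage time dominates up to the corner weight, and at the characteristic
    parameter its mean is the shape function. *)
Lemma lpp_upper_tail A eps : 0 < A -> 0 < eps -> exists2 c : R, 0 < c &
  forall (M : R) m n X, 0 < M -> m%:R <= A * M -> n%:R <= A * M -> expgrid P m n X ->
  (P [set w | shapeg m%:R n%:R + eps * M <= lpp (fun i j => X i j w) m n]%R <=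
   (3 * expR (- c * M))%:E)%E.
Proof.
move=> A0 e0.
(* kappa is small enough for [8 sqrt (kappa A) + 4 kappa <= eps / 2] *)
pose s := Num.min (Num.sqrt A) (eps / (32 * Num.sqrt A)).
have sA : 0 < Num.sqrt A by rewrite sqrtr_gt0.
have s0 : 0 < s by rewrite lt_min sA divr_gt0// mulr_gt0.
pose ka := s ^+ 2.
have ka0 : 0 < ka by rewrite exprn_gt0.
have sk : Num.sqrt ka = s by rewrite sqrtr_sqr gtr0_norm.
have s1 : s <= Num.sqrt A by rewrite ge_min lexx.
have s2 : s * (32 * Num.sqrt A) <= eps.
  by rewrite -ler_pdivlMr ?mulr_gt0// ge_min lexx orbT.
have kA : ka <= A by rewrite /ka -[leRHS](sqr_sqrtr (ltW A0)) lerXn2r// nnegrE ltW.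
pose r0 := Num.sqrt ka / (2 * Num.sqrt (2 * A)).
have r00 : 0 < r0 by rewrite divr_gt0 ?mulr_gt0 ?sqrtr_gt0 ?mulr_gt0.
have e8 : 0 < eps / 8 by rewrite divr_gt0.
have [tau ht [c c0 hc]] := chernoff_rate r00 A0 e8.
exists (Num.min c (eps / 8)); first by rewrite lt_min c0 e8.
move=> M m n X M0 mA nA gX.
have AM : 0 < A * M by rewrite mulr_gt0.
(* The sides may be tiny or 0, where the characteristic parameter degenerates. It is therefore
   computed for enlarged sides, at a cost of [eps / 2 * M] in the shape function. *)
pose m' := m%:R + ka * M; pose n' := n%:R + ka * M.
have kM : 0 < ka * M by rewrite mulr_gt0.
have m'0 : 0 < m' by rewrite ltr_wpDl.
have n'0 : 0 < n' by rewrite ltr_wpDl.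
pose rho := crho m' n'.
have rho01 : 0 < rho < 1 by exact: crho01.
have [r1 r2] : r0 <= rho /\ r0 <= 1 - rho.
  have kAM : ka * M <= A * M by rewrite ler_pM2r.
  by apply: (crho_ge ka0 _ M0); rewrite ?mulr_gt0//; rewrite /m' /n' lerDr ler0n /=; lra.
have gle : m%:R / (1 - rho) + n%:R / rho <= shapeg m%:R n%:R + eps / 2 * M.
  move: rho01 => /andP[rp rp1].
  apply: (@le_trans _ _ (shapeg m' n')).
    rewrite -crho_shapeg// -/rho lerD// ler_pM2r ?invr_gt0 ?subr_gt0// lerDl ltW//.
  have sM : 0 < Num.sqrt M by rewrite sqrtr_gt0.
  have MM : Num.sqrt M ^+ 2 = M by rewrite sqr_sqrtr// ltW.
  have bnd k : k <= A * M -> Num.sqrt k <= Num.sqrt A * Num.sqrt M.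
    by move=> kAM; rewrite -sqrtrM ?(ltW A0)// ler_wsqrtr.
  have h1 : Num.sqrt m' <= Num.sqrt m%:R + s * Num.sqrt M.
    by rewrite -sk -sqrtrM ?(ltW ka0)// sqrt_add_le// ltW.
  have h2 : Num.sqrt n' <= Num.sqrt n%:R + s * Num.sqrt M.
    by rewrite -sk -sqrtrM ?(ltW ka0)// sqrt_add_le// ltW.
  apply: (@le_trans _ _ ((Num.sqrt m%:R + Num.sqrt n%:R + 2 * (s * Num.sqrt M)) ^+ 2)).
    rewrite /shapeg lerXn2r// ?nnegrE ?addr_ge0 ?sqrtr_ge0// ?mulr_ge0 ?(ltW s0) ?sqrtr_ge0//.
    lra.
  have b1 := bnd _ mA; have b2 := bnd _ nA.
  rewrite sqrrD -/(shapeg m%:R n%:R) -addrA lerD2l.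
  have q1 : (Num.sqrt m%:R + Num.sqrt n%:R) * (2 * (s * Num.sqrt M)) *+ 2 <=
            8 * (s * Num.sqrt A) * M.
    rewrite -[X in _ <= _ * X]MM -mulr_natr.
    have : (Num.sqrt m%:R + Num.sqrt n%:R) * (s * Num.sqrt M) <=
        2 * (Num.sqrt A * Num.sqrt M) * (s * Num.sqrt M).
      by apply: ler_wpM2r; [rewrite mulr_ge0 // ltW|lra].
    lra.
  have q2 : (2 * (s * Num.sqrt M)) ^+ 2 <= 4 * (s * Num.sqrt A) * M.
    rewrite !exprMn MM (_ : 2 ^+ 2 = 4 :> R); last by ring.
    rewrite mulrA ler_pM2r// ler_pM2l// expr2 ler_pM2l//.
  have sAM : 0 <= s * Num.sqrt A * M by rewrite !mulr_ge0 // ltW.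
  have := ler_wpM2r (ltW M0) s2; lra.
(* The other half of [eps * M] is divided equally between the stationary fluctuation,
   [2 * (eps / 8 * M)], and the corner weight, [eps / 4 * M]. The three exceptional events give the
   factor 3. *)
have := @stat_upper _ _ _ P rho m n X rho01 gX tau (eps / 8 * M) ht.
set SU := [set w | _] => hSU.
have hX : (P [set w | eps / 4 * M <= X 0%N 0%N w]%R <= (expR (- (eps / 8 * M)))%:E)%E.
  have := @expgrid_tail_ge X m n 0 0 (eps / 4 * M) gX isT isT.
  by rewrite (_ : eps / 4 * M / 2 = eps / 8 * M); [apply; rewrite mulr_gt0// divr_gt0|field].
have mSU : measurable SU by apply: measurable_ge_fun; exact: (measurable_stat rho01 gX).
have mX0 : measurable [set w | eps / 4 * M <= X 0%N 0%N w]%R.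
  by apply: measurable_ge_fun; exact: (expgrid_meas gX).
apply: (@le_trans _ _ (P (SU `|` [set w | eps / 4 * M <= X 0%N 0%N w]%R))).
  apply: le_measure; rewrite ?inE.
  - by apply: measurable_ge_fun; apply: measurable_lpp; exact: (expgrid_meas gX).
  - exact: measurableU.
  move=> w /= h; have [h1|h1] := leP (eps / 4 * M) (X 0%N 0%N w); [by right|left].
  have := @lpp_le_stat _ rho (fun i j => X i j w) rho01 (fun i j => expgrid_ge0 gX i j w) m n.
  rewrite /SU/=; move: gle h h1; lra.
apply: le_trans (le_trans (measureU2 P mSU mX0) (leeD hSU hX)) _.
rewrite -!EFinD lee_fin.
have mc : expR (- c * M) <= expR (- Num.min c (eps / 8) * M).
  by rewrite ler_expR ler_pM2r// lerN2 ge_min lexx.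
have me : expR (- (eps / 8 * M)) <= expR (- Num.min c (eps / 8) * M).
  by rewrite -mulNr ler_expR ler_pM2r// lerN2 ge_min lexx orbT.
have := hc _ _ _ (ltW M0) mA r2; have := hc _ _ _ (ltW M0) nA r1; lra.
Qed.

End homogeneous.

(** * Lower tail and uniformity over all rectangles *)

Section lower_tail.
Context d (T : measurableType d) (R : realType) (P : probability T R).
Implicit Types (X : nat -> nat -> T -> R) (A c C M eps : R).

Lemma lpp_tr (w : nat -> nat -> R) m n : lpp (fun i j => w j i) n m = lpp w m n.
Proof.
elim: m n => [|m IHm] n.
  by elim: n => [//|n IHn]; rewrite lppS0 lpp0S IHn.
by elim: n => [|n IHn]; rewrite ?lppS0 ?lpp0S ?IHm// !lppSS IHm IHn maxC.
Qed.

Lemma expgrid_tr X m n : expgrid P m n X -> expgrid P n m (fun i j => X j i).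
Proof.
move=> [h1 h2 h3 h4]; split => //.
- by move=> i j hi hj; exact: h1.
- by move=> i j hi hj; exact: h3.
- apply: (@mutind_comp _ _ _ P _ _ _ _ _ (fun p : nat * nat => (p.2, p.1)) (fun p => (p.2, p.1)) _ _ h4).
    by case.
  by move=> [i j]; rewrite !inE /= andbC.
Qed.

(** The quadratic defect of [crho_gap] has to fit into the total error [4 * (xi * M)]. For [xi]
    small against [th ^+ 2] this rules out an exit further than [th * M]. *)
Lemma exit_loc (m n k M A ka xi th : R) : 0 < ka -> 0 < A -> 0 < M ->
  ka * M <= m <= A * M -> ka * M <= n <= A * M -> 0 <= k <= m -> 0 < th ->
  xi <= Num.sqrt ka / (4 * A * Num.sqrt A) * th ^+ 2 / 4 ->
  shapeg m n - 2 * (xi * M) < k / (1 - crho m n) + shapeg (m - k) n + 2 * (xi * M) ->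
  k <= th * M.
Proof.
move=> ka0 A0 M0 /andP[m1 m2] /andP[n1 n2] km th0 hxi h.
have m0 : 0 < m by rewrite (lt_le_trans _ m1)// mulr_gt0.
have n0 : 0 < n by rewrite (lt_le_trans _ n1)// mulr_gt0.
have sM : 0 < Num.sqrt M by rewrite sqrtr_gt0.
have sA : 0 < Num.sqrt A by rewrite sqrtr_gt0.
have sk : 0 < Num.sqrt ka by rewrite sqrtr_gt0.
have smm : 0 < Num.sqrt m by rewrite sqrtr_gt0.
have MM : Num.sqrt M ^+ 2 = M by rewrite sqr_sqrtr// ltW.
have gap := crho_gap m0 n0 km.
set c1 := Num.sqrt ka / (4 * A * Num.sqrt A) in hxi.
have c10 : 0 < c1 by rewrite divr_gt0// !mulr_gt0.
have c1le : c1 / M <= Num.sqrt n / (4 * m * Num.sqrt m).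
  rewrite ler_pdivlMr ?mulr_gt0// mulrAC ler_pdivrMr//.
  apply: (@le_trans _ _ (c1 * (4 * (A * M) * (Num.sqrt A * Num.sqrt M)))).
    rewrite ler_pM2l// -2!(mulrA 4) ler_pM2l// ler_pM ?(ltW m0) ?(ltW smm)//.
    by rewrite -sqrtrM ?(ltW A0)// ler_wsqrtr.
  rewrite /c1 (_ : _ / _ * _ = Num.sqrt ka * Num.sqrt M * M); last by field; rewrite !gt_eqF.
  by rewrite ler_pM2r// -sqrtrM ?(ltW ka0)// ler_wsqrtr.
move: km => /andP[k0 km].
have k2 : c1 / M * k ^+ 2 <= 4 * (xi * M).
  apply: le_trans (ler_wpM2r (sqr_ge0 k) c1le) _; lra.
rewrite -(@ler_pXn2r _ 2)// ?nnegrE ?mulr_ge0 ?(ltW th0) ?(ltW M0)//.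
have : c1 * k ^+ 2 <= c1 * (th ^+ 2 * M ^+ 2).
  have : c1 * k ^+ 2 <= 4 * (xi * M) * M.
    by move: k2; rewrite mulrAC ler_pdivrMr.
  have := ler_wpM2r (ltW M0) (ler_wpM2r (ltW M0) hxi); rewrite expr2; lra.
by rewrite ler_pM2l// exprMn.
Qed.

Lemma row_chernoff X m n (s : seq (nat * nat)) (tau x : R) : expgrid P m n X ->
  uniq s -> {subset s <= [pred p : nat * nat | (p.1 <= m)%N && (p.2 <= n)%N]} ->
  0 <= tau <= 2^-1 ->
  (P [set w | (size s)%:R + x <= \sum_(p <- s) X p.1 p.2 w]%R <=
     (expR ((size s)%:R * (2 * tau ^+ 2) - 1 * tau * x))%:E)%E /\
  (P [set w | \sum_(p <- s) X p.1 p.2 w <= (size s)%:R - x]%R <=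
     (expR ((size s)%:R * (2 * tau ^+ 2) - 1 * tau * x))%:E)%E.
Proof.
move=> gX us sS ht.
have mZ : {in [pred p : nat * nat | (p.1 <= m)%N && (p.2 <= n)%N],
    forall p, measurable_fun setT (X p.1 p.2)}.
  by move=> p; rewrite inE => /andP[? ?]; exact: (expgrid_meas gX).
have Zt p : p \in s -> forall t : R, 0 <= t -> P [set w | t < X p.1 p.2 w] = (expR (- 1 * t))%:E.
  by move=> /sS; rewrite inE => /andP[? ?] t t0; rewrite (expgrid_tail gX)// mulN1r.
have hU := @chernoff_upper _ _ _ P _ 1 ltr01 _ _ s (expgrid_ind gX) mZ us sS Zt tau x ht.
have hL := @chernoff_lower _ _ _ P _ 1 ltr01 _ _ s (expgrid_ind gX) mZ us sS Zt tau x ht.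
by rewrite divr1 in hU hL; split.
Qed.

(** A position [k] is bad if the axis up to it, or the bulk after it, is atypically heavy. The slack
    [r0 * xi * M] on the axis becomes at most [xi * M] after division by a boundary rate of at least
    [r0]. *)
Lemma exit_tail A xi r0 : 0 < A -> 0 < xi -> 0 < r0 -> exists2 c : R, 0 < c &
  forall M m n X, 0 < M -> m.+1%:R <= A * M -> n.+1%:R <= A * M -> expgrid P m.+1 n.+1 X ->
  let bad k := [set w | k.+1%:R + r0 * xi * M <= \sum_(i < k.+1) X i.+1 0%N w] `|`
    [set w | shapeg (m - k)%:R n%:R + xi * M <=
             lpp (shift (fun i j => X i j w) k.+1 1) (m - k) n] in
  (P [set w | exists2 k, (k < m.+1)%N & bad k w] <= (m.+1%:R * (4 * expR (- c * M)))%:E)%E /\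
  measurable [set w | exists2 k, (k < m.+1)%N & bad k w].
Proof.
move=> A0 x0 r00.
have [c1 c10 hU] := lpp_upper_tail P A0 x0.
have rx : 0 < r0 * xi by rewrite mulr_gt0.
have [tau ht [c2 c20 hc]] := chernoff_rate ltr01 A0 rx.
exists (Num.min c1 c2); first by rewrite lt_min c10.
move=> M m n X M0 mA nA gX bad.
have msum k : (k < m.+1)%N -> measurable [set w | k.+1%:R + r0 * xi * M <= \sum_(i < k.+1) X i.+1 0%N w].
  move=> km; apply: measurable_ge_fun; apply: measurable_sum => i.
  by apply: (expgrid_meas gX) => //; rewrite ltnS; apply: leq_trans (ltn_ord i) km.
have gS k : (k < m.+1)%N -> expgrid P (m - k) n (fun i j => X (k.+1 + i)%N (1 + j)%N).
  by move=> km; apply: expgrid_shift gX _ _; rewrite ?add1n// addSn subnKC.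
have mlpp k : (k < m.+1)%N -> measurable [set w | shapeg (m - k)%:R n%:R + xi * M <=
             lpp (shift (fun i j => X i j w) k.+1 1) (m - k) n].
  move=> km; apply: measurable_ge_fun.
  by apply: measurable_lpp; exact: (expgrid_meas (gS k km)).
apply: union_bound => k km; first by apply: measurableU; [exact: msum|exact: mlpp].
apply: le_trans (measureU2 P (msum k km) (mlpp k km)) _.
have h1 : (P [set w | k.+1%:R + r0 * xi * M <= \sum_(i < k.+1) X i.+1 0%N w]%R <=
    (expR (- c2 * M))%:E)%E.
  pose s := [seq (i.+1, 0%N) | i <- iota 0 k.+1].
  have us : uniq s by rewrite map_inj_uniq ?iota_uniq// => i j [].
  have sS : {subset s <= [pred p : nat * nat | (p.1 <= m.+1)%N && (p.2 <= n.+1)%N]}.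
    by move=> p /mapP[i]; rewrite mem_iota add0n /= => ik ->; rewrite inE /= andbT (leq_trans ik).
  have [h _] := @row_chernoff X _ _ s tau (r0 * xi * M) gX us sS ht.
  rewrite size_map size_iota in h.
  rewrite (_ : [set w | _] = [set w | k.+1%:R + r0 * xi * M <= \sum_(p <- s) X p.1 p.2 w]).
    apply: le_trans h _; rewrite lee_fin; apply: hc => //; first exact: ltW.
    by rewrite (le_trans _ mA)// ler_nat.
  apply/seteqP; split => w /=; rewrite big_map -(big_mkord predT (fun i => X i.+1 0%N w));
    by rewrite /index_iota subn0.
have h2 := hU M (m - k)%N n _ M0 _ _ (gS k km).
have h3 : (P [set w | shapeg (m - k)%:R n%:R + xi * M <=
             lpp (shift (fun i j => X i j w) k.+1 1) (m - k) n]%R <= (3 * expR (- c1 * M))%:E)%E.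
  by apply: h2; [apply: le_trans mA|apply: le_trans nA]; rewrite ler_nat ?leqnSn// leqW// leq_subr.
apply: le_trans (leeD h1 h3) _; rewrite -EFinD lee_fin.
have e1 : expR (- c1 * M) <= expR (- Num.min c1 c2 * M).
  by rewrite ler_expR ler_pM2r// lerN2 ge_min lexx.
have e2 : expR (- c2 * M) <= expR (- Num.min c1 c2 * M).
  by rewrite ler_expR ler_pM2r// lerN2 ge_min lexx orbT.
lra.
Qed.

(* Far from the diagonal a single straight path is already optimal. *)
Lemma lpp_lower_tail_thin A eps ka : 0 < A -> 0 < eps -> 0 < ka ->
  ka + 2 * Num.sqrt ka * Num.sqrt A <= eps / 2 -> exists2 c : R, 0 < c &
  forall M m n X, 1 <= M -> m%:R <= A * M -> n%:R <= ka * M -> expgrid P m n X ->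
  (P [set w | lpp (fun i j => X i j w) m n <= shapeg m%:R n%:R - eps * M]%R <=
   (expR (- c * M))%:E)%E.
Proof.
move=> A0 e0 ka0 hka.
have A1 : 0 < A + 1 by rewrite addr_gt0.
have e2 : 0 < eps / 2 by rewrite divr_gt0.
have [tau ht [c c0 hc]] := chernoff_rate ltr01 A1 e2.
exists c => // M m n X M1 mA nA gX.
have M0 : 0 < M by exact: lt_le_trans M1.
pose s := [seq (i, 0%N) | i <- iota 0 m.+1].
have us : uniq s by rewrite map_inj_uniq ?iota_uniq// => i j [].
have sS : {subset s <= [pred p : nat * nat | (p.1 <= m)%N && (p.2 <= n)%N]}.
  by move=> p /mapP[i]; rewrite mem_iota add0n /= => ik ->; rewrite inE /= andbT -ltnS.
have [_ h] := @row_chernoff X _ _ s tau (eps / 2 * M) gX us sS ht.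
rewrite size_map size_iota in h.
apply: le_trans (le_trans _ h) _; last first.
  rewrite lee_fin; apply: hc => //; first exact: ltW.
  by rewrite -natr1 mulrDl lerD// mul1r.
apply: le_measure; rewrite ?inE.
- by apply: measurable_le_fun; apply: measurable_lpp; exact: (expgrid_meas gX).
- apply: measurable_le_fun; apply: (measurable_sum_seq (Z := fun p => X p.1 p.2)) => p /sS.
  by rewrite inE => /andP[? ?]; exact: (expgrid_meas gX).
move=> w /= hw.
have gle : shapeg m%:R n%:R <= m%:R + eps / 2 * M.
  rewrite shapegE// -addrA lerD2l.
  have sM : 0 < Num.sqrt M by rewrite sqrtr_gt0.
  have MM : Num.sqrt M ^+ 2 = M by rewrite sqr_sqrtr// ltW.
  have b1 : Num.sqrt m%:R <= Num.sqrt A * Num.sqrt M.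
    by rewrite -sqrtrM ?(ltW A0)// ler_wsqrtr.
  have b2 : Num.sqrt n%:R <= Num.sqrt ka * Num.sqrt M.
    by rewrite -sqrtrM ?(ltW ka0)// ler_wsqrtr.
  have b3 : Num.sqrt m%:R * Num.sqrt n%:R <= Num.sqrt A * Num.sqrt ka * M.
    rewrite -[in leRHS]MM expr2 mulrACA ler_pM ?sqrtr_ge0//.
  have := ler_wpM2r (ltW M0) hka; lra.
have sle : \sum_(p <- s) X p.1 p.2 w <= lpp (fun i j => X i j w) m n.
  apply: (@le_trans _ _ (lpp (fun i j => X i j w) m 0)).
    rewrite big_map le_eqVlt; apply/orP; left; apply/eqP.
    elim: m {mA gX s us sS h hw gle} => [|m IH]; first by rewrite /= big_seq1.
    by rewrite lppS0 -IH -[in iota 0 m.+2]addn1 iotaD big_cat /= big_seq1 add0n.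
  elim: n {nA gX s us sS h hw gle} (fun i j => expgrid_ge0 gX i j w) => [//|n IH] X0.
  apply: le_trans (lpp_stepr _ _ _); rewrite ler_wpDr//; exact: IH.
rewrite -natr1; lra.
Qed.

(** The stationary time is at least the shape value minus a small error. Splitting it at the exit
    point and bounding both pieces from above forces an early exit, so the bulk piece, which is at
    most [lpp], carries nearly everything. *)
Lemma lpp_lower_tail A eps : 0 < A -> 0 < eps -> exists2 c : R, 0 < c & exists2 C : R, 0 < C &
  forall M m n X, 1 <= M -> m%:R <= A * M -> n%:R <= A * M -> expgrid P m n X ->
  (P [set w | lpp (fun i j => X i j w) m n <= shapeg m%:R n%:R - eps * M]%R <=
   (C * expR (- c * M))%:E)%E.
Proof.
move=> A0 e0; have sA : 0 < Num.sqrt A by rewrite sqrtr_gt0.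
(* Chosen so that [ka + 2 * Num.sqrt ka * Num.sqrt A <= 3 * s * Num.sqrt A <= eps / 2], as the thin
   case demands. *)
pose s := Num.min (Num.sqrt A) (eps / (6 * Num.sqrt A)).
have s0 : 0 < s by rewrite lt_min sA divr_gt0// mulr_gt0.
pose ka := s ^+ 2.
have ka0 : 0 < ka by rewrite exprn_gt0.
have sk : Num.sqrt ka = s by rewrite sqrtr_sqr gtr0_norm.
have s1 : s <= Num.sqrt A by rewrite ge_min lexx.
have s2 : s * (6 * Num.sqrt A) <= eps.
  by rewrite -ler_pdivlMr ?mulr_gt0// ge_min lexx orbT.
have hka : ka + 2 * Num.sqrt ka * Num.sqrt A <= eps / 2.
  rewrite sk /ka expr2; have := ler_wpM2l (ltW s0) s1; lra.
have [c1 c10 thin] := lpp_lower_tail_thin A0 e0 ka0 hka.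
pose r0 := Num.sqrt ka / (2 * Num.sqrt A).
have r00 : 0 < r0 by rewrite divr_gt0 ?mulr_gt0 ?sk.
(* An exit before [th * M] leaves at most [th * M / r0 = eps / 2 * M] on the axis. The other losses
   are [3 * xi * M], whence [xi <= eps / 6]. *)
pose th := r0 * eps / 2.
have th0 : 0 < th by rewrite divr_gt0 // mulr_gt0.
pose xi := Num.min (eps / 6) (Num.sqrt ka / (4 * A * Num.sqrt A) * th ^+ 2 / 4).
have xi0 : 0 < xi.
  rewrite lt_min divr_gt0//= divr_gt0// mulr_gt0 ?exprn_gt0// divr_gt0 ?mulr_gt0// sk//.
have xi1 : xi <= eps / 6 by rewrite ge_min lexx.
have xi2 : xi <= Num.sqrt ka / (4 * A * Num.sqrt A) * th ^+ 2 / 4.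
  by rewrite ge_min lexx orbT.
have [tau ht [c2 c20 hc]] := chernoff_rate r00 A0 xi0.
have [c3 c30 hexit] := exit_tail A0 xi0 r00.
pose c := Num.min c1 (Num.min c2 c3).
have c0 : 0 < c by rewrite !lt_min c10 c20 c30.
have [C C0 hC] := @poly_expR R A c 1 (ltW A0) c0.
exists (c / 2); first by rewrite divr_gt0.
(* Two terms come from the stationary lower tail and four from the exit events of each axis. *)
exists (10 * C); first by rewrite mulr_gt0.
move=> M m n X M1 mA nA gX; have M0 : 0 < M by exact: lt_le_trans M1.
have ee (c' : R) : c <= c' -> expR (- c' * M) <= expR (- c * M).
  by move=> cc'; rewrite ler_expR ler_pM2r// lerN2.
have cc1 : c <= c1 by rewrite ge_min lexx.
have cc2 : c <= c2 by rewrite !ge_min lexx orbT.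
have cc3 : c <= c3 by rewrite !ge_min lexx !orbT.
have polyb : (A * M + 1) * expR (- c * M) <= C * expR (- (c / 2) * M).
  by have := hC M (ltW M0); rewrite expr1.
have expb : expR (- c * M) <= C * expR (- (c / 2) * M).
  apply: le_trans polyb; rewrite ler_peMl ?expR_ge0// lerDr mulr_ge0// ltW//.
have CE0 : 0 <= C * expR (- (c / 2) * M) by rewrite mulr_ge0 ?expR_ge0 ?ltW.
(* Thin rectangles, in either direction, need only a straight path; in the remaining ones the aspect
   ratio is bounded. *)
have [nk|nk] := leP n%:R (ka * M).
  apply: le_trans (thin M m n X M1 mA nk gX) _; rewrite lee_fin.
  have := ee _ cc1; lra.
have [mk|mk] := leP m%:R (ka * M).
  have := thin M n m _ M1 nA mk (expgrid_tr gX).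
  rewrite (_ : [set w | _] = [set w | lpp (fun i j => X i j w) m n <= shapeg m%:R n%:R - eps * M]).
    move=> h; apply: le_trans h _; rewrite lee_fin.
    have := ee _ cc1; lra.
  by apply/seteqP; split => w /=; rewrite (@lpp_tr (fun i j => X i j w)) shapegC.
have m0 : 0 < m%:R :> R by apply: le_lt_trans mk; rewrite mulr_ge0// ltW.
have n0 : 0 < n%:R :> R by apply: le_lt_trans nk; rewrite mulr_ge0// ltW.
have mb : ka * M <= m%:R <= A * M by rewrite (ltW mk).
have nb : ka * M <= n%:R <= A * M by rewrite (ltW nk).
case: m n {mk nk} m0 n0 mA nA gX mb nb => [|m] [|n]; rewrite ?ltxx// => m0 n0 mA nA gX mb nb.
pose rho := crho m.+1%:R n.+1%:R : R.
have rho01 : 0 < rho < 1 by exact: crho01.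
have [r1 r2] : r0 <= rho /\ r0 <= 1 - rho by exact: (crho_ge ka0 A0 M0 mb nb).
have := @stat_lower _ _ _ P rho _ _ X rho01 gX tau (xi * M) ht.
rewrite crho_shapeg//; set SL := [set w | _] => hSL.
have mSL : measurable SL by apply: measurable_le_fun; exact: (measurable_stat rho01 gX).
have [] := hexit M m n X M0 mA nA gX; set BH := [set w | _] => hBH mBH.
have [] := hexit M n m _ M0 nA mA (expgrid_tr gX); set BV := [set w | _] => hBV mBV.
apply: (@le_trans _ _ (P (SL `|` (BH `|` BV)))).
  apply: le_measure; rewrite ?inE.
  - by apply: measurable_le_fun; apply: measurable_lpp; exact: (expgrid_meas gX).
  - by apply: measurableU => //; exact: measurableU.
  move=> w /= hw; apply: contrapT => hn.
  have nSL : ~ SL w by move=> ?; apply: hn; left.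
  have nBH : ~ BH w by move=> ?; apply: hn; right; left.
  have nBV : ~ BV w by move=> ?; apply: hn; right; right.
  have {}nSL : shapeg m.+1%:R n.+1%:R - 2 * (xi * M) <
      lpp (statw rho (fun i j => X i j w)) m.+1 n.+1.
    by rewrite ltNge; apply/negP.
  (* A late exit contradicts the upper tail, an early one gives the bound *)
  have fin (k p q : nat) (e : nat -> nat -> R) (r S : R) : (k <= p)%N ->
      (forall i j, 0 <= e i j) -> r = 1 - crho p.+1%:R q.+1%:R ->
      ka * M <= p.+1%:R <= A * M -> ka * M <= q.+1%:R <= A * M ->
      0 < r -> r0 <= r -> S < k.+1%:R + r0 * xi * M ->
      lpp (shift e k.+1 1) (p - k) q < shapeg (p - k)%:R q%:R + xi * M ->
      shapeg p.+1%:R q.+1%:R - 2 * (xi * M) < S / r + lpp (shift e k.+1 1) (p - k) q ->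
      shapeg p.+1%:R q.+1%:R - eps * M < lpp e p.+1 q.+1.
    move=> kp e0' rE pb qb rp rr hS hl hg.
    have Sr : S / r <= k.+1%:R / r + xi * M.
      rewrite ler_pdivrMr// mulrDl divfK ?gt_eqF//.
      apply: le_trans (ltW hS) _; rewrite lerD2l -mulrA mulrC ler_pM2l ?mulr_gt0//.
    have kth : k.+1%:R <= th * M.
      apply: (exit_loc ka0 A0 M0 pb qb _ th0 xi2).
        by rewrite ler0n ler_nat ltnS.
      rewrite -rE.
      have : shapeg (p - k)%:R q%:R <= shapeg (p.+1%:R - k.+1%:R) q.+1%:R :> R.
        by apply: le_shapeg; rewrite ?ler_nat// -natrB ?ltnS// subSS.
      move: hg hl Sr; lra.
    have lle : lpp (shift e k.+1 1) (p - k) q <= lpp e p.+1 q.+1.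
      have := lpp_shift_le k.+1 1 (p - k) q e0'.
      by rewrite addSn subnKC// add1n.
    have kr : k.+1%:R / r <= eps / 2 * M.
      rewrite ler_pdivrMr//; apply: (le_trans kth); rewrite /th.
      have := ler_wpM2r (ltW M0) (ler_wpM2r (ltW e0) rr); lra.
    have := ler_wpM2r (ltW M0) xi1.
    move: hg Sr kr lle; lra.
  have e0w i j : 0 <= X i j w by exact: (expgrid_ge0 gX).
  move: (rho01) => /andP[rp rp1].
  have [[k [kp hk]]|[k [kp hk]]] := @stat_exit _ rho (fun i j => X i j w) rho01 m n.
    have hno : forall S, S = \sum_(i < k.+1) X i.+1 0%N w ->
        S < k.+1%:R + r0 * xi * M /\ lpp (shift (fun i j => X i j w) k.+1 1) (m - k) n <
          shapeg (m - k)%:R n%:R + xi * M.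
      move=> S ->; split; rewrite ltNge; apply/negP => hh; apply: nBH; exists k => //.
        by left.
      by right.
    have [hS hl] := hno _ erefl.
    have := fin k m n (fun i j => X i j w) (1 - rho) _ kp e0w erefl mb nb _ r2 hS hl.
    rewrite mulr_suml => hf; have := hf _ (lt_le_trans nSL hk).
    by rewrite subr_gt0 rp1 => /(_ isT); rewrite ltNge hw.
  have hno : forall S, S = \sum_(i < k.+1) X 0%N i.+1 w ->
      S < k.+1%:R + r0 * xi * M /\ lpp (shift (fun i j => X j i w) k.+1 1) (n - k) m <
        shapeg (n - k)%:R m%:R + xi * M.
    move=> S ->; split; rewrite ltNge; apply/negP => hh; apply: nBV; exists k => //.
      by left.
    by right.
  have [hS hl] := hno _ erefl.
  have rE : rho = 1 - crho n.+1%:R m.+1%:R.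
    by rewrite crho_onem// /rho /crho addrC.
  have := fin k n m (fun i j => X j i w) rho _ kp (fun i j => e0w j i) rE nb mb rp r1 hS hl.
  rewrite mulr_suml [shapeg n.+1%:R _]shapegC (@lpp_tr (fun i j => X i j w)) => hf.
  have lE : lpp (shift (fun i j => X j i w) k.+1 1) (n - k) m =
      lpp (shift (fun i j => X i j w) 1 k.+1) m (n - k).
    exact: (lpp_tr (shift (fun i j => X i j w) 1 k.+1)).
  rewrite lE in hf; have := hf (lt_le_trans nSL hk).
  by rewrite ltNge hw.
apply: le_trans (measureU2 P mSL (measurableU _ _ mBH mBV)) _.
apply: le_trans (leeD hSL (le_trans (measureU2 P mBH mBV) (leeD hBH hBV))) _.
rewrite -!EFinD lee_fin.
have q1 := hc _ _ _ (ltW M0) mA r2; have q2 := hc _ _ _ (ltW M0) nA r1.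
have q3 := ee _ cc2; have q4 := ee _ cc3.
have q5 k : k%:R <= A * M -> k%:R * (4 * expR (- c3 * M)) <= 4 * (C * expR (- (c / 2) * M)).
  move=> kA; apply: (@le_trans _ _ (4 * ((A * M + 1) * expR (- c * M)))).
    rewrite mulrCA ler_pM2l// ler_pM ?expR_ge0// ler_wpDr//.
  by rewrite ler_pM2l.
have := q5 _ mA; have := q5 _ nA; lra.
Qed.

Definition lpp_dev (U V : nat) (x : R) X : set T :=
  [set w | exists p q m n, [/\ (p + m <= U)%N, (q + n <= V)%N &
    let L := lpp (shift (fun i j => X i j w) p q) m n in
    shapeg m%:R n%:R + x <= L \/ L <= shapeg m%:R n%:R - x]].

Lemma lpp_uniform A eps : 0 < A -> 0 < eps -> exists2 c : R, 0 < c & exists2 C : R, 0 < C &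
  forall M U V X, 1 <= M -> U%:R <= A * M -> V%:R <= A * M -> expgrid P U V X ->
  (P (lpp_dev U V (eps * M) X) <= (C * expR (- c * M))%:E)%E /\
  measurable (lpp_dev U V (eps * M) X).
Proof.
move=> A0 e0.
have [c1 c10 hU] := lpp_upper_tail P A0 e0.
have [c2 c20 [C2 C20 hL]] := lpp_lower_tail A0 e0.
pose c := Num.min c1 c2.
have c0 : 0 < c by rewrite lt_min c10 c20.
have [C C0 hC] := @poly_expR R A c 4 (ltW A0) c0.
exists (c / 2); first by rewrite divr_gt0.
exists ((3 + C2) * C); first by rewrite mulr_gt0// addr_gt0.
move=> M U V X M1 UA VA gX; have M0 : 0 < M by exact: lt_le_trans M1.
pose dev p q m n := [set w | let L := lpp (shift (fun i j => X i j w) p q) m n in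
    shapeg m%:R n%:R + eps * M <= L \/ L <= shapeg m%:R n%:R - eps * M].
pose b := (3 + C2) * expR (- c * M).
have hdev p q m n : (p + m <= U)%N -> (q + n <= V)%N ->
    measurable (dev p q m n) /\ (P (dev p q m n) <= b%:E)%E.
  move=> pm qn; have gS := expgrid_shift gX pm qn.
  have mA : m%:R <= A * M.
    by apply: le_trans UA; rewrite ler_nat (leq_trans _ pm)// leq_addl.
  have nA : n%:R <= A * M.
    by apply: le_trans VA; rewrite ler_nat (leq_trans _ qn)// leq_addl.
  have := hU M m n _ M0 mA nA gS; set S1 := [set w | _] => h1.
  have := hL M m n _ M1 mA nA gS; set S2 := [set w | _] => h2.
  have mlpp : measurable_fun setT
      (fun w => lpp (fun i j => X (p + i)%N (q + j)%N w) m n).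
    by apply: (measurable_lpp (X := fun i j => X (p + i)%N (q + j)%N)); exact: (expgrid_meas gS).
  have m1 : measurable S1 by exact: measurable_ge_fun.
  have m2 : measurable S2 by exact: measurable_le_fun.
  have -> : dev p q m n = S1 `|` S2 by [].
  split; first exact: measurableU.
  apply: le_trans (le_trans (measureU2 P m1 m2) (leeD h1 h2)) _.
  rewrite -EFinD lee_fin /b.
  have e1 : expR (- c1 * M) <= expR (- c * M).
    by rewrite ler_expR ler_pM2r// lerN2 ge_min lexx.
  have e2 : C2 * expR (- c2 * M) <= C2 * expR (- c * M).
    by rewrite ler_pM2l// ler_expR ler_pM2r// lerN2 ge_min lexx orbT.
  by rewrite mulrDl; lra.
have b0 : 0 <= b by rewrite mulr_ge0 ?expR_ge0// addr_ge0// ltW.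
pose dev' p q m n := [set w | [/\ (p + m <= U)%N, (q + n <= V)%N & dev p q m n w]].
have hdev' p q m n : measurable (dev' p q m n) /\ (P (dev' p q m n) <= b%:E)%E.
  have [/andP[pm qn]|h] := boolP ((p + m <= U)%N && (q + n <= V)%N).
    have -> : dev' p q m n = dev p q m n.
      by apply/seteqP; split => w /=; [case|split].
    exact: hdev.
  have -> : dev' p q m n = set0.
    by apply/seteqP; split => w //= [pm qn _]; move: h; rewrite pm qn.
  by split; [exact: measurable0|rewrite measure0 lee_fin].
have u1 p q m := @union_bound _ _ _ P (fun n => dev' p q m n) V.+1 b
  (fun n _ => (hdev' p q m n).1) (fun n _ => (hdev' p q m n).2).
have u2 p q := @union_bound _ _ _ P _ U.+1 _ (fun m _ => (u1 p q m).2) (fun m _ => (u1 p q m).1).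
have u3 p := @union_bound _ _ _ P _ V.+1 _ (fun q _ => (u2 p q).2) (fun q _ => (u2 p q).1).
have [h4 m4] := @union_bound _ _ _ P _ U.+1 _ (fun p _ => (u3 p).2) (fun p _ => (u3 p).1).
have devE : lpp_dev U V (eps * M) X = [set w | exists2 p, (p < U.+1)%N &
    exists2 q, (q < V.+1)%N & exists2 m, (m < U.+1)%N & exists2 n, (n < V.+1)%N & dev' p q m n w].
  apply/seteqP; split => w.
    move=> [p [q [m [n [pm qn h]]]]]; exists p; first by rewrite ltnS (leq_trans (leq_addr m p) pm).
    exists q; first by rewrite ltnS (leq_trans (leq_addr n q) qn).
    exists m; first by rewrite ltnS (leq_trans (leq_addl p m) pm).
    by exists n; first by rewrite ltnS (leq_trans (leq_addl q n) qn).
  by move=> [p _ [q _ [m _ [n _ [pm qn h]]]]]; exists p, q, m, n.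
rewrite devE; split => //; apply: le_trans h4 _; rewrite lee_fin /b.
have U1 : U.+1%:R <= A * M + 1 by rewrite -natr1 lerD2r.
have V1 : V.+1%:R <= A * M + 1 by rewrite -natr1 lerD2r.
have AM0 : 0 <= A * M + 1 by rewrite addr_ge0// mulr_ge0// ltW.
have step (x y : R) : 0 <= y -> x <= y -> U.+1%:R * x <= (A * M + 1) * y.
  move=> y0 xy; apply: (@le_trans _ _ (U.+1%:R * y)); first by rewrite ler_pM2l.
  by rewrite ler_wpM2r.
have step' (x y : R) : 0 <= y -> x <= y -> V.+1%:R * x <= (A * M + 1) * y.
  move=> y0 xy; apply: (@le_trans _ _ (V.+1%:R * y)); first by rewrite ler_pM2l.
  by rewrite ler_wpM2r.
apply: (@le_trans _ _ ((A * M + 1) * ((A * M + 1) * ((A * M + 1) * ((A * M + 1) * b))))).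
  have p1 := mulr_ge0 AM0 b0; have p2 := mulr_ge0 AM0 p1; have p3 := mulr_ge0 AM0 p2.
  by apply: (step _ _) => //; apply: (step' _ _) => //; apply: (step _ _) => //; exact: step'.
have C30 : 0 <= 3 + C2 by rewrite addr_ge0 // ltW.
rewrite -[leRHS]mulrA; apply: le_trans (ler_wpM2l C30 (hC M (ltW M0))).
by rewrite le_eqVlt; apply/orP; left; apply/eqP; rewrite /b; ring.
Qed.

End lower_tail.

(** * Comparison with the homogeneous model *)

Section rectangle.
Context {R : realType}.

(** The rotation turns the region into a rectangle, so the lattice points inside form a full
    grid. *)
Lemma inQ_uv (l b u v : R) :
  inQ l b (u + v) (u - v) <-> 0 <= u <= (l + b) / 2 /\ 0 <= v <= (l - b) / 2.
Proof.
rewrite /inQ !ler_norml; split.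
  by move=> [/andP[? ?] [/andP[? ?] /andP[? ?]]]; split; apply/andP; split; lra.
by move=> [/andP[? ?] /andP[? ?]]; split; [|split]; apply/andP; split; lra.
Qed.

Lemma shapeg_gamma (N h d : R) : 0 <= N -> 0 < h -> `|d| <= h ->
  shapeg (N * ((h + d) / 2)) (N * ((h - d) / 2)) = N * (h * gamma (d / h)).
Proof.
move=> N0 h0; rewrite ler_norml => /andP[d1 d2].
have a0 : 0 <= (h + d) / 2 by lra.
have b0 : 0 <= (h - d) / 2 by lra.
have X0 := mulr_ge0 N0 a0; have Y0 := mulr_ge0 N0 b0.
rewrite shapegE// -mulrA -sqrtrM//.
have -> : N * ((h + d) / 2) * (N * ((h - d) / 2)) = (N / 2 * h) ^+ 2 * (1 - (d / h) ^+ 2).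
  by field; rewrite gt_eqF.
rewrite sqrtrM ?sqr_ge0// sqrtr_sqr ger0_norm ?mulr_ge0 ?divr_ge0 ?(ltW h0)//.
by rewrite /gamma; field.
Qed.

(** The 4 is twice the tolerance of [near_curve], one for each end of a cell. Each square root grows
    by at most 2, so the square grows by at most [16 * z + 16] with [z = sqrt (A * N)]; AM-GM bounds
    [16 * z] by [t / 2 * N + 128 * A / t], and a large [N] absorbs the constants. *)
Lemma shapeg_perturb (A t : R) : 0 < A -> 0 < t -> exists N0 : nat,
  forall (N m n m' n' : R), N0%:R <= N -> 0 <= m -> 0 <= n -> 0 <= m' -> 0 <= n' ->
    m' <= A * N -> n' <= A * N -> m <= m' + 4 -> n <= n' + 4 ->
    shapeg m n <= shapeg m' n' + t * N.
Proof.
move=> /[dup] /ltW A0 Ap t0; exists (Num.bound ((16 + 128 * A / t) * 2 / t)).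
move=> N m n m' n' hN m0 n0 m'0 n'0 m'A n'A mm nn.
have c0 : 0 <= 16 + 128 * A / t by rewrite addr_ge0// divr_ge0 ?mulr_ge0// ltW.
have {}hN : (16 + 128 * A / t) * 2 / t <= N.
  by apply: le_trans hN; apply: ltW; apply: archi_boundP; rewrite divr_ge0 ?mulr_ge0 ?(ltW t0).
have N0 : 0 <= N by apply: le_trans hN; rewrite divr_ge0 ?mulr_ge0 ?(ltW t0).
have {}hN : 16 + 128 * A / t <= t / 2 * N.
  by move: hN; rewrite ler_pdivrMr//; lra.
set z := Num.sqrt (A * N).
have z0 : 0 <= z by exact: sqrtr_ge0.
have zz : z ^+ 2 = A * N by rewrite sqr_sqrtr// mulr_ge0.
have hz : 16 * z <= t / 2 * N + 128 * A / t.
  have e1 : t / 2 * N = t / (2 * A) * z ^+ 2 by rewrite zz; field; rewrite gt_eqF.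
  rewrite -subr_ge0 e1.
  have -> : t / (2 * A) * z ^+ 2 + 128 * A / t - 16 * z = (t * z - 16 * A) ^+ 2 / (2 * A * t).
    by field; rewrite !gt_eqF.
  by rewrite divr_ge0 ?sqr_ge0// !mulr_ge0// ltW.
have s4 : Num.sqrt 4 = 2 :> R by rewrite (_ : 4 = 2 ^+ 2) ?sqrtr_sqr ?ger0_norm//; ring.
have sq (x x' : R) : 0 <= x' -> x <= x' + 4 -> Num.sqrt x <= Num.sqrt x' + 2.
  move=> x'0 xx; apply: le_trans (_ : Num.sqrt (x' + 4) <= _).
    by rewrite ler_wsqrtr.
  rewrite -s4; apply: sqrt_add_le => //.
have h1 := sq _ _ m'0 mm; have h2 := sq _ _ n'0 nn.
have h3 : Num.sqrt m' <= z by rewrite ler_wsqrtr.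
have h4 : Num.sqrt n' <= z by rewrite ler_wsqrtr.
have := sqrtr_ge0 m; have := sqrtr_ge0 n; have := sqrtr_ge0 m'; have := sqrtr_ge0 n'.
rewrite /shapeg; move: h1 h2 h3 h4; move: (Num.sqrt m) (Num.sqrt n) (Num.sqrt m') (Num.sqrt n').
move=> a a' c c' h1 h2 h3 h4 p1 p2 p3 p4.
have : (a + a') ^+ 2 <= (c + c' + 4) ^+ 2 by rewrite lerXn2r// ?nnegrE; lra.
have : c + c' <= 2 * z by lra.
nra.
Qed.

Section cell.
Variables (l b : R) (alpha : R * R -> R) (K : nat) (eps : R).
Hypothesis l0 : 0 < l.
Hypothesis K0 : (0 < K)%N.
Hypothesis mesh : fine_mesh l b alpha K eps.
Let h := l / K%:R.
Variables (theta r : R).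
Hypothesis r_unif : forall p q : R * R, inQ l b p.1 p.2 -> inQ l b q.1 q.2 ->
  `|p.1 - q.1| <= r -> `|p.2 - q.2| <= r -> `|alpha p - alpha q| <= theta.
Variables (N : nat) (y : R -> R).
Hypothesis N0 : (0 < N)%N.
Hypothesis rN : 4 / N%:R <= r.
Hypothesis Xy : Xset l b y.

(** The curve point above [k%:R * h] in rotated coordinates, scaled by [N]. The tolerance 2
    accommodates both the rounding of a curve to the grid and the cutting of a lattice path. *)
Definition near_curve (k : nat) (p q : nat) :=
  `|p%:R - N%:R * ((k%:R * h + y (k%:R * h)) / 2)| <= 2 /\
  `|q%:R - N%:R * ((k%:R * h - y (k%:R * h)) / 2)| <= 2.

Let dist_clamp (a c x t : R) : a <= c -> 0 <= t -> a - t <= x -> x <= c + t ->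
  `|x - clamp a c x| <= t.
Proof.
move=> ac t0 h1 h2; rewrite /clamp; case: (leP x c) => h3.
  by case: (leP a x) => h4; rewrite ler_norml; apply/andP; split; lra.
by rewrite (max_idPr ac) ler_norml; apply/andP; split; lra.
Qed.

(** A grid point of the cell may leave the rectangle spanned by the two curve points by [2 / N%:R]
    in each rotated coordinate. It is first clamped into this rectangle, where [mesh] applies; the
    displacement, at most [4 / N%:R], costs [theta]. *)
Lemma cell_alpha (k p q p' q' i j : nat) : (k < K)%N ->
  near_curve k p q -> near_curve k.+1 p' q' ->
  (p <= i <= p')%N -> (q <= j <= q')%N ->
  inQ l b ((i%:R + j%:R) / N%:R) ((i%:R - j%:R) / N%:R) ->
  `|alpha ((i%:R + j%:R) / N%:R, (i%:R - j%:R) / N%:R) - alpha (k%:R * h, y (k%:R * h))| <=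
    eps + theta.
Proof.
move=> kK [p1 p2] [p3 p4] /andP[pi ip] /andP[qj jq] Qij.
have N0' : 0 < N%:R :> R by rewrite ltr0n.
have h0 : 0 < h by rewrite divr_gt0// ltr0n.
have uin := cell_in l0 K0 (ltnW kK); have vin := cell_in l0 K0 kK.
have Qu := Xset_inQ l0 Xy uin; have Qv := Xset_inQ l0 Xy vin.
rewrite -/h in uin vin Qu Qv.
set x := k%:R * h in uin Qu p1 p2 *; set x' := k.+1%:R * h in vin Qv p3 p4 *.
have xx' : x' = x + h by rewrite /x /x' -addn1 natrD mulrDl mul1r.
have lip := Xy.2.2 _ _ vin uin.
rewrite {2}xx' [x + h]addrC addrK (gtr0_norm h0) ler_norml in lip; move/andP : lip => [s1 s2].
pose a := (x + y x) / 2; pose a' := (x' + y x') / 2.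
pose c := (x - y x) / 2; pose c' := (x' - y x') / 2.
have aa : a <= a' by rewrite /a /a'; lra.
have cc : c <= c' by rewrite /c /c'; lra.
have xa : x = a + c by rewrite /a /c; field.
have ya : y x = a - c by rewrite /a /c; field.
have xa' : x' = a' + c' by rewrite /a' /c'; field.
have ya' : y x' = a' - c' by rewrite /a' /c'; field.
rewrite {1}xa {1}ya in Qu; rewrite {1}xa' {1}ya' in Qv.
move/inQ_uv : Qu => [/andP[qa1 qa2] /andP[qc1 qc2]].
move/inQ_uv : Qv => [/andP[qa1' qa2'] /andP[qc1' qc2']].
pose u := i%:R / N%:R : R; pose v := j%:R / N%:R : R.
pose u' := clamp a a' u; pose v' := clamp c c' v.
have /andP[u1 u2] : a <= u' <= a' by have := clamp_in u aa; rewrite in_itv.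
have /andP[v1 v2] : c <= v' <= c' by have := clamp_in v cc; rewrite in_itv.
have t0 : 0 <= 2 / N%:R :> R by rewrite divr_ge0.
have est (z w : R) (n n' m : nat) : (n <= m)%N -> (m <= n')%N -> `|n%:R - N%:R * z| <= 2 ->
    `|n'%:R - N%:R * w| <= 2 -> z - 2 / N%:R <= m%:R / N%:R /\ m%:R / N%:R <= w + 2 / N%:R.
  rewrite -!(ler_nat R) => m1 m2; rewrite !ler_norml => /andP[? ?] /andP[? ?].
  split; first by rewrite lerBlDr -mulrDl ler_pdivlMr//; lra.
  by rewrite -lerBlDr -mulrBl ler_pdivrMr//; lra.
have [eu1 eu2] := est _ _ _ _ _ pi ip p1 p3.
have [ev1 ev2] := est _ _ _ _ _ qj jq p2 p4.
have du : `|u - u'| <= 2 / N%:R by exact: dist_clamp.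
have dv : `|v - v'| <= 2 / N%:R by exact: dist_clamp.
have Q' : inQ l b (u' + v') (u' - v') by apply/inQ_uv; rewrite (le_trans qa1 u1) (le_trans u2 qa2') (le_trans qc1 v1) (le_trans v2 qc2').
rewrite mulrDl mulrBl -/u -/v in Qij *.
have rr : 2 / N%:R + 2 / N%:R <= r by apply: le_trans rN; rewrite -mulrDl; lra.
apply: le_trans (ler_distD (alpha (u' + v', u' - v')) _ _) _.
rewrite addrC; apply: lerD.
  apply: mesh => //=; first exact: Xset_inQ.
    by rewrite -/h xa ler_norml; apply/andP; split; lra.
  by rewrite -/h ya ler_norml; apply/andP; split; lra.
apply: r_unif => //=; apply: le_trans rr.
  rewrite (_ : _ - _ = (u - u') + (v - v')); last by ring.
  exact: le_trans (ler_normD _ _) (lerD du dv).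
rewrite (_ : _ - _ = (u - u') - (v - v')); last by ring.
exact: le_trans (ler_normB _ _) (lerD du dv).
Qed.

Lemma cell_shapeg (t : R) (N1 : nat) (k p q p' q' : nat) : (k < K)%N ->
  (forall (N m n m' n' : R), N1%:R <= N -> 0 <= m -> 0 <= n -> 0 <= m' -> 0 <= n' ->
    m' <= l * N -> n' <= l * N -> m <= m' + 4 -> n <= n' + 4 ->
    shapeg m n <= shapeg m' n' + t * N) -> (N1 <= N)%N ->
  near_curve k p q -> near_curve k.+1 p' q' -> (p <= p')%N -> (q <= q')%N ->
  (p' - p)%:R <= l * N%:R :> R -> (q' - q)%:R <= l * N%:R :> R ->
  `|shapeg (p' - p)%:R (q' - q)%:R -
    N%:R * (h * gamma ((y (k.+1%:R * h) - y (k%:R * h)) / h))| <= t * N%:R.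
Proof.
move=> kK pert NN [p1 p2] [p3 p4] pp qq pl ql.
have N0' : 0 < N%:R :> R by rewrite ltr0n.
have h0 : 0 < h by rewrite divr_gt0// ltr0n.
have hl : h <= l by rewrite ler_pdivrMr ?ltr0n// ler_pMr// ler1n.
have uin := cell_in l0 K0 (ltnW kK); have vin := cell_in l0 K0 kK.
rewrite -/h in uin vin.
set x := k%:R * h in uin p1 p2 *; set x' := k.+1%:R * h in vin p3 p4 *.
have xx' : x' = x + h by rewrite /x /x' -addn1 natrD mulrDl mul1r.
have lip := Xy.2.2 _ _ vin uin; rewrite {2}xx' [x + h]addrC addrK (gtr0_norm h0) in lip.
rewrite -shapeg_gamma ?(ltW N0')//.
move: (lip); rewrite ler_norml => /andP[s1 s2].
move: p1 p2 p3 p4; rewrite !ler_norml => /andP[? ?] /andP[? ?] /andP[? ?] /andP[? ?].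
have m0 : 0 <= N%:R * ((h + (y x' - y x)) / 2) by rewrite mulr_ge0 ?(ltW N0')//; lra.
have n0 : 0 <= N%:R * ((h - (y x' - y x)) / 2) by rewrite mulr_ge0 ?(ltW N0')//; lra.
have m1 : N%:R * ((h + (y x' - y x)) / 2) <= l * N%:R.
  by rewrite mulrC ler_wpM2r ?(ltW N0')//; lra.
have n1 : N%:R * ((h - (y x' - y x)) / 2) <= l * N%:R.
  by rewrite mulrC ler_wpM2r ?(ltW N0')//; lra.
have eh : h = x' - x by lra.
apply/andP; split.
  rewrite lerNl opprB lerBlDl; apply: pert => //; rewrite ?ler_nat//.
    by rewrite natrB// eh; lra.
  by rewrite natrB// eh; lra.
rewrite lerBlDl; apply: pert => //; rewrite ?ler_nat//.
  by rewrite natrB// eh; lra.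
by rewrite natrB// eh; lra.
Qed.

End cell.

End rectangle.

Section scaled_path.
Context {R : realType}.

Lemma pathw_scale (w : nat -> nat -> R) (c : R) p q s :
  pathw (fun i j => c * w i j) p q s = c * pathw w p q s.
Proof.
by elim: s p q => [|d s IH] p q //=; case: d; rewrite IH mulrDr.
Qed.

Lemma count_id_negb (s : seq bool) : (count id s + count negb s)%N = size s.
Proof. exact: (count_predC id s). Qed.

End scaled_path.

(** * Weights of lattice paths against upper sums *)

Section weights.
Context {R : realType}.
Variables (l b : R) (alpha : R * R -> R).
Hypothesis l0 : 0 < l.
Hypothesis bl : `|b| < l.
Hypothesis alpha0 : forall p : R * R, inQ l b p.1 p.2 -> 0 <= alpha p.
Variable M : R.
Hypothesis M0 : 0 <= M.
Hypothesis alphaM : forall p : R * R, inQ l b p.1 p.2 -> alpha p <= M.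
Variables (N U V : nat) (e : nat -> nat -> R).
Hypothesis N0 : (0 < N)%N.
Hypothesis UN : U%:R <= N%:R * ((l + b) / 2).
Hypothesis VN : V%:R <= N%:R * ((l - b) / 2).
Hypothesis e0 : forall i j, 0 <= e i j.
Variable theta : R.
Hypothesis theta0 : 0 < theta.
Hypothesis theta1 : theta <= 1.
Hypothesis good : forall p q m n, (p + m <= U)%N -> (q + n <= V)%N ->
  `|lpp (shift e p q) m n - shapeg m%:R n%:R| <= theta * N%:R.

Definition gridw (i j : nat) : R :=
  alpha ((i%:R + j%:R) / N%:R, (i%:R - j%:R) / N%:R) / N%:R * e i j.

Let N0' : 0 < N%:R :> R. Proof. by rewrite ltr0n. Qed.

Lemma grid_inQ i j : (i <= U)%N -> (j <= V)%N ->
  inQ l b ((i%:R + j%:R) / N%:R) ((i%:R - j%:R) / N%:R).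
Proof.
rewrite -!(ler_nat R) => iU jV; rewrite mulrDl mulrBl; apply/inQ_uv.
by rewrite !divr_ge0//= !ler_pdivrMr// mulrC (le_trans iU UN) mulrC (le_trans jV VN).
Qed.

Lemma gridw_ge0 i j : (i <= U)%N -> (j <= V)%N -> 0 <= gridw i j.
Proof.
by move=> iU jV; rewrite mulr_ge0// divr_ge0// ?(ltW N0')// alpha0//; exact: grid_inQ.
Qed.

(** A rectangle with both sides 0 contains one point and has shape value 0, so the good event also
    bounds single weights. This controls the junctions counted twice. *)
Lemma gridw_le i j : (i <= U)%N -> (j <= V)%N -> gridw i j <= M * theta.
Proof.
move=> iU jV.
have := @good i j 0 0; rewrite !addn0 => /(_ iU jV).
rewrite lpp00 shiftE !addn0 /shapeg sqrtr0 addr0 expr0n/= subr0 ger0_norm// => eN.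
rewrite /gridw -mulrA; apply: ler_pM.
- by apply: alpha0; exact: grid_inQ.
- by rewrite mulr_ge0// invr_ge0 ltW.
- by apply: alphaM; exact: grid_inQ.
- by rewrite mulrC ler_pdivrMr.
Qed.

Section curve.
Variables (K : nat) (eps : R).
Hypothesis K0 : (0 < K)%N.
Hypothesis eps0 : 0 <= eps.
Hypothesis eps1 : eps <= 1.
Hypothesis mesh : fine_mesh l b alpha K eps.
Let h := l / K%:R.
Variable r : R.
Hypothesis r_unif : forall p q : R * R, inQ l b p.1 p.2 -> inQ l b q.1 q.2 ->
  `|p.1 - q.1| <= r -> `|p.2 - q.2| <= r -> `|alpha p - alpha q| <= theta.
Hypothesis rN : 4 / N%:R <= r.
Variable N1 : nat.
Hypothesis pert : forall (N m n m' n' : R), N1%:R <= N -> 0 <= m -> 0 <= n -> 0 <= m' ->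
  0 <= n' -> m' <= l * N -> n' <= l * N -> m <= m' + 4 -> n <= n' + 4 ->
    shapeg m n <= shapeg m' n' + theta * N.
Hypothesis N1N : (N1 <= N)%N.
Variable y : R -> R.
Hypothesis Xy : Xset l b y.
Variables P Q : nat -> nat.
Hypothesis PQnear : forall k, (k <= K)%N -> near_curve l K N y k (P k) (Q k).
Hypothesis Pnd : forall k, (k < K)%N -> (P k <= P k.+1)%N.
Hypothesis Qnd : forall k, (k < K)%N -> (Q k <= Q k.+1)%N.
Hypothesis PU : forall k, (k <= K)%N -> (P k <= U)%N.
Hypothesis QV : forall k, (k <= K)%N -> (Q k <= V)%N.

Let h0 : 0 < h. Proof. by rewrite divr_gt0// ltr0n. Qed.
Let hl : h <= l. Proof. by rewrite ler_pdivrMr ?ltr0n// ler_pMr// ler1n. Qed.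
Let ak k := alpha (k%:R * h, y (k%:R * h)).
Let gk k := h * gamma ((y (k.+1%:R * h) - y (k%:R * h)) / h).

Let gk0 k : 0 <= gk k. Proof. by rewrite mulr_ge0 ?gamma_ge0// ltW. Qed.
Let gk2 k : gk k <= 2 * h. Proof. by rewrite /gk [leRHS]mulrC ler_wpM2l ?gamma_le2// ltW. Qed.

Let ak0 k : (k < K)%N -> 0 <= ak k.
Proof. by move=> kK; apply: alpha0; apply: Xset_inQ => //; apply: cell_in => //; exact: ltnW. Qed.
Let akM k : (k < K)%N -> ak k <= M.
Proof. by move=> kK; apply: alphaM; apply: Xset_inQ => //; apply: cell_in => //; exact: ltnW. Qed.

Lemma cell_lpp k : (k < K)%N ->
  `|lpp (shift e (P k) (Q k)) (P k.+1 - P k) (Q k.+1 - Q k) - N%:R * gk k| <= 2 * theta * N%:R.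
Proof.
move=> kK.
have pp := Pnd kK; have qq := Qnd kK.
have G := @good (P k) (Q k) (P k.+1 - P k) (Q k.+1 - Q k).
rewrite !subnKC// in G; have {}G := G (PU kK) (QV kK).
have lbnd (n W : nat) (c : R) : (n <= W)%N -> W%:R <= N%:R * c -> c <= l -> n%:R <= l * N%:R.
  rewrite -(ler_nat R) => nW Wc cl; apply: le_trans nW (le_trans Wc _).
  by rewrite mulrC ler_wpM2r// ltW.
move: (bl); rewrite ltr_norml => /andP[b1 b2].
have S := @cell_shapeg R l b K l0 K0 N y N0 Xy theta N1 k (P k) (Q k) (P k.+1) (Q k.+1)
  kK pert N1N (PQnear (ltnW kK)) (PQnear kK) pp qq.
have {}S := S (lbnd _ _ _ (leq_trans (leq_subr _ _) (PU kK)) UN ltac:(lra))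
  (lbnd _ _ _ (leq_trans (leq_subr _ _) (QV kK)) VN ltac:(lra)).
apply: le_trans (ler_distD (shapeg (P k.+1 - P k)%:R (Q k.+1 - Q k)%:R) _ _) _.
by rewrite -mulrA mulr2n mulrDl mul1r lerD.
Qed.

Lemma cell_alpha_le k i j : (k < K)%N -> (P k <= i <= P k.+1)%N -> (Q k <= j <= Q k.+1)%N ->
  ak k - eps - theta <= alpha ((i%:R + j%:R) / N%:R, (i%:R - j%:R) / N%:R) <= ak k + eps + theta.
Proof.
move=> kK iP jQ.
have Qij : inQ l b ((i%:R + j%:R) / N%:R) ((i%:R - j%:R) / N%:R).
  case/andP: iP => _ iP; case/andP: jQ => _ jQ.
  by apply: grid_inQ; [exact: leq_trans (PU kK)|exact: leq_trans (QV kK)].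
have := @cell_alpha R l b alpha K eps l0 K0 mesh theta r r_unif N y N0 rN Xy k _ _ _ _ i j
  kK (PQnear (ltnW kK)) (PQnear kK) iP jQ Qij.
rewrite -/h -/(ak k) ler_norml => /andP[h1 h2]; apply/andP; split; lra.
Qed.

Lemma cell_upper k s : (k < K)%N -> count id s = (P k.+1 - P k)%N ->
  count negb s = (Q k.+1 - Q k)%N ->
  pathw gridw (P k) (Q k) s <= (ak k + eps) * gk k + (2 * M + 2 * l + 4) * theta.
Proof.
move=> kK us ds.
have c0 : 0 <= ak k + eps + theta by rewrite !addr_ge0 ?ak0// ltW.
have := @le_pathw R gridw (fun i j => (ak k + eps + theta) / N%:R * e i j) (P k) (Q k) s.
rewrite us ds !subnKC ?Pnd ?Qnd// pathw_scale => H.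
apply: le_trans (H _) _ => {H}.
  move=> i j iP jQ; rewrite /gridw ler_wpM2r// ler_wpM2r ?invr_ge0 ?(ltW N0')//.
  by case/andP: (cell_alpha_le kK iP jQ).
apply: (@le_trans _ _ ((ak k + eps + theta) / N%:R * (N%:R * (gk k + 2 * theta)))).
  rewrite ler_wpM2l ?divr_ge0 ?(ltW N0')//.
  apply: le_trans (pathw_le_lpp _ _ _ _) _; rewrite us ds.
  have := cell_lpp kK; rewrite ler_norml => /andP[_]; lra.
(* Expanding [(ak k + eps + theta) * (gk k + 2 * theta)] with [gk k <= 2 * l], [ak k <= M] and
   [eps, theta <= 1] gives the constant [2 * M + 2 * l + 4]. *)
rewrite mulrA divfK ?gt_eqF//.
have := ak0 kK; have := akM kK; have := gk0 k; have := gk2 k; have := hl; have := theta0.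
move: (ak k) (gk k) => a g *.
have t1 : theta * g <= theta * (2 * l) by rewrite ler_wpM2l ?(ltW theta0)//; lra.
have t2 : a * theta <= M * theta by rewrite ler_wpM2r ?(ltW theta0).
have t3 : eps * theta <= 1 * theta by rewrite ler_wpM2r ?(ltW theta0).
have t4 : theta * theta <= 1 * theta by rewrite ler_wpM2r ?(ltW theta0).
lra.
Qed.

(** The loss [4 * eps * h] is the gap of [2 * eps] between the lowered value of [alpha] and the
    raised one in [usum], times [gk k <= 2 * h]. *)
Lemma cell_lower k : (k < K)%N -> exists s, [/\ count id s = (P k.+1 - P k)%N,
  count negb s = (Q k.+1 - Q k)%N &
  (ak k + eps) * gk k - 4 * eps * h - (2 * M + 2 * l + 8) * theta <= pathw gridw (P k) (Q k) s].
Proof.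
move=> kK.
have [s [us ds ws]] := lpp_attained e (P k) (Q k) (P k.+1 - P k) (Q k.+1 - Q k).
exists s; split => //.
set L := lpp _ _ _ in ws.
have L0 : 0 <= L by rewrite -ws pathw_ge0.
have := cell_lpp kK; rewrite -/L ler_norml => /andP[L1 L2].
pose c := Num.max 0 (ak k - eps - theta).
have c0 : 0 <= c by rewrite /c le_max lexx.
have := @le_pathw R (fun i j => c / N%:R * e i j) gridw (P k) (Q k) s.
rewrite us ds !subnKC ?Pnd ?Qnd// pathw_scale ws => H.
apply: le_trans (H _) => {H}; last first.
  move=> i j iP jQ; rewrite /gridw ler_wpM2r// ler_wpM2r ?invr_ge0 ?(ltW N0')//.
  case/andP: (cell_alpha_le kK iP jQ) => h1 _; rewrite /c ge_max h1 andbT.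
  case/andP: iP => _ iP; case/andP: jQ => _ jQ.
  by apply: alpha0; apply: grid_inQ; [exact: leq_trans (PU kK)|exact: leq_trans (QV kK)].
pose L' := L / N%:R; have L'0 : 0 <= L' by rewrite divr_ge0// ltW.
have {}L1 : gk k - 2 * theta <= L' by rewrite ler_pdivlMr//; lra.
have {}L2 : L' <= gk k + 2 * theta by rewrite ler_pdivrMr//; lra.
apply: (@le_trans _ _ ((ak k - eps - theta) * L')); last first.
  by rewrite -mulrA [N%:R^-1 * _]mulrC ler_wpM2r// /c le_max lexx orbT.
have := ak0 kK; have := akM kK; have := gk0 k; have := gk2 k; have := hl; have := theta0; have := h0.
move: (ak k) (gk k) L1 L2 => a g *.
have t0 : (a + eps) * (g - 2 * theta) <= (a + eps) * L' by rewrite ler_wpM2l ?addr_ge0.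
have t1 : (2 * eps + theta) * L' <= (2 * eps + theta) * (2 * h + 2 * theta).
  by rewrite ler_wpM2l ?addr_ge0 ?mulr_ge0 ?(ltW theta0)//; lra.
have t2 : a * theta <= M * theta by rewrite ler_wpM2r ?(ltW theta0).
have t3 : eps * theta <= 1 * theta by rewrite ler_wpM2r ?(ltW theta0).
have t4 : theta * theta <= 1 * theta by rewrite ler_wpM2r ?(ltW theta0).
have t5 : theta * h <= theta * l by rewrite ler_wpM2l ?(ltW theta0).
lra.
Qed.

(** Error per cell in units of [theta]: the constant of [cell_lower], plus [M] for one junction
    weight. *)
Definition werr : R := 3 * M + 2 * l + 8.

Lemma path_lower : P 0%N = 0%N -> Q 0%N = 0%N -> exists s, [/\ count id s = P K,
  count negb s = Q K &
  usum l alpha K eps y - 4 * eps * l - K%:R * werr * theta <= pathw gridw 0 0 s].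
Proof.
move=> P0 Q0.
suff H n : (n <= K)%N -> exists s, [/\ count id s = P n, count negb s = Q n &
    \sum_(k < n) ((ak k + eps) * gk k - 4 * eps * h - werr * theta) <= pathw gridw 0 0 s].
  have [s [us ds ws]] := H K (leqnn K); exists s; split => //.
  apply: le_trans ws; rewrite big_split /= big_split /= !sumr_const card_ord /usum -/h.
  rewrite -[- (4 * eps * h) *+ K]mulr_natl -[- (werr * theta) *+ K]mulr_natl.
  have -> : K%:R * - (4 * eps * h) = - (4 * eps * l).
    by rewrite /h; field; rewrite pnatr_eq0 -lt0n.
  have -> : K%:R * - (werr * theta) = - (K%:R * werr * theta) by ring.
  by [].
elim: n => [|n IH] nK.
  by exists [::]; rewrite P0 Q0 big_ord0; split => //=; exact: gridw_ge0.
have [s [us ds ws]] := IH (ltnW nK); have [s' [us' ds' ws']] := cell_lower nK.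
exists (s ++ s'); rewrite !count_cat us us' ds ds' !subnKC ?Pnd ?Qnd//; split => //.
rewrite big_ord_recr /= pathw_cat us ds !add0n.
have := @gridw_le (P n) (Q n) (PU (ltnW nK)) (QV (ltnW nK)).
move=> gle; rewrite -[leRHS]addrA; apply: (lerD ws).
by rewrite /werr; lra.
Qed.

Lemma path_upper s (t : nat -> nat) : (forall k, (k < K)%N -> (t k <= t k.+1)%N) ->
  t 0%N = 0%N -> t K = size s ->
  (forall k, (k <= K)%N -> count id (take (t k) s) = P k) ->
  (forall k, (k <= K)%N -> count negb (take (t k) s) = Q k) ->
  pathw gridw 0 0 s <= usum l alpha K eps y + K%:R * werr * theta.
Proof.
move=> tnd t0 tK us ds.
suff H n : (n <= K)%N -> pathw gridw 0 0 (take (t n) s) <=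
    M * theta + \sum_(k < n) ((ak k + eps) * gk k + (2 * M + 2 * l + 4) * theta).
  have := H K (leqnn K); rewrite tK take_size big_split /= sumr_const card_ord /usum -/h.
  rewrite -mulr_natl => /le_trans; apply.
  rewrite addrCA lerD2l /werr.
  have K1 : 1 <= K%:R :> R by rewrite ler1n.
  have : M * theta <= K%:R * (M * theta) by rewrite ler_peMl ?mulr_ge0// ltW.
  have : 0 <= K%:R * theta by rewrite mulr_ge0// ltW.
  lra.
have P0 : P 0%N = 0%N by rewrite -us// t0 take0.
have Q0 : Q 0%N = 0%N by rewrite -ds// t0 take0.
elim: n => [|n IH] nK.
  by rewrite t0 take0 big_ord0 addr0 /=; exact: gridw_le.
have tn : take (t n.+1) s = take (t n) s ++ take (t n.+1 - t n) (drop (t n) s).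
  by rewrite -takeD subnKC// tnd.
have u2 : count id (take (t n.+1 - t n) (drop (t n) s)) = (P n.+1 - P n)%N.
  by rewrite -!us ?(ltnW nK)// tn count_cat addKn.
have d2 : count negb (take (t n.+1 - t n) (drop (t n) s)) = (Q n.+1 - Q n)%N.
  by rewrite -!ds ?(ltnW nK)// tn count_cat addKn.
rewrite tn pathw_cat us ?(ltnW nK)// ds ?(ltnW nK)// !add0n big_ord_recr /=.
have := cell_upper nK u2 d2; have := IH (ltnW nK).
have := @gridw_ge0 (P n) (Q n) (PU (ltnW nK)) (QV (ltnW nK)).
lra.
Qed.

End curve.

End weights.

(** * From lattice paths to curves and back *)

Section mcshane_extension.
Context {R : realType}.
Implicit Types (pts : seq (R * R)) (p : R * R) (x : R).

Definition mcshane pts p0 x : R :=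
  foldr (fun p m => Num.min (p.2 + `|x - p.1|) m) (p0.2 + `|x - p0.1|) pts.

Lemma mcshane_lip pts p0 x x' : `|mcshane pts p0 x - mcshane pts p0 x'| <= `|x - x'|.
Proof.
suff H (z z' : R) : mcshane pts p0 z <= mcshane pts p0 z' + `|z - z'|.
  rewrite ler_norml; have := H x x'; have := H x' x; rewrite (distrC x' x) => *.
  by apply/andP; split; lra.
have D (a : R) : `|z - a| <= `|z' - a| + `|z - z'| by rewrite [leRHS]addrC ler_distD.
elim: pts => [|p pts IH] /=; first by rewrite -addrA lerD2l.
by rewrite addr_minl le_min !ge_min IH orbT andbT -addrA lerD2l D.
Qed.

Lemma mcshane_le pts p0 p x : p \in p0 :: pts -> mcshane pts p0 x <= p.2 + `|x - p.1|.
Proof.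
elim: pts => [|q pts IH] /=; first by rewrite inE => /eqP ->.
rewrite !inE orbCA => /orP[/eqP ->|pin]; rewrite ge_min ?lexx//.
by rewrite IH ?orbT// inE.
Qed.

Lemma mcshane_ge pts p0 x c : (forall p, p \in p0 :: pts -> c <= p.2 + `|x - p.1|) ->
  c <= mcshane pts p0 x.
Proof.
elim: pts => [|q pts IH] /= H; first by apply: H; rewrite inE.
rewrite le_min H ?inE ?eqxx ?orbT//=; apply: IH => p; rewrite inE => /orP[/eqP ->|pin].
  by apply: H; rewrite inE eqxx.
by apply: H; rewrite !inE pin !orbT.
Qed.

Lemma mcshane_id pts p0 p :
  {in p0 :: pts &, forall q q' : R * R, `|q.2 - q'.2| <= `|q.1 - q'.1|} ->
  p \in p0 :: pts -> mcshane pts p0 p.1 = p.2.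
Proof.
move=> H pin; apply/eqP; rewrite eq_le; apply/andP; split.
  by apply: le_trans (mcshane_le _ pin) _; rewrite subrr normr0 addr0.
apply: mcshane_ge => q qin; rewrite -lerBlDl; apply: le_trans (ler_norm _) _; exact: H.
Qed.

End mcshane_extension.

Section boolean_paths.
Context {R : realType}.
Implicit Types s : seq bool.

(** In the word [s], [true] is a step up and [false] a step down; their numbers so far are the
    rotated coordinates, with sum the abscissa and difference the height. *)
Definition heights s : seq int :=
  mkseq (fun i => (count id (take i s))%:Z - (count negb (take i s))%:Z) (size s).+1.

Lemma size_heights s : size (heights s) = (size s).+1. Proof. exact: size_mkseq. Qed.

Lemma nth_heights s i : (i <= size s)%N ->
  nth 0 (heights s) i = (count id (take i s))%:Z - (count negb (take i s))%:Z.
Proof. by move=> iS; rewrite nth_mkseq. Qed.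

Lemma count_take_size s i : (i <= size s)%N ->
  (count id (take i s) + count negb (take i s))%N = i.
Proof. by move=> iS; rewrite count_id_negb size_takel. Qed.

Lemma count_take_le (a : pred bool) s i j : (i <= j)%N -> (count a (take i s) <= count a (take j s))%N.
Proof.
by move=> ij; rewrite -(subnKC ij) takeD count_cat leq_addr.
Qed.

Lemma count_take_leq (a : pred bool) s i : (count a (take i s) <= count a s)%N.
Proof. by rewrite -{2}(cat_take_drop i s) count_cat leq_addr. Qed.

Lemma heights_lip s i j : (i <= size s)%N -> (j <= size s)%N ->
  `|(nth 0 (heights s) i)%:~R - (nth 0 (heights s) j)%:~R| <= `|i%:R - j%:R| :> R.
Proof.
wlog ij : i j / (i <= j)%N.
  by move=> H iS jS; have /orP[ij|ij] := leq_total i j; [exact: H|rewrite distrC [leRHS]distrC; exact: H].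
move=> iS jS; rewrite !nth_heights//.
have u := count_take_le id s ij; have v := count_take_le negb s ij.
have e1 : i%:R = (count id (take i s))%:R + (count negb (take i s))%:R :> R.
  by rewrite -natrD count_take_size.
have e2 : j%:R = (count id (take j s))%:R + (count negb (take j s))%:R :> R.
  by rewrite -natrD count_take_size.
rewrite !intrB -!pmulrn e1 e2; rewrite -!(ler_nat R) in u v.
rewrite [leRHS]ler0_norm; last by lra.
by rewrite ler_norml; apply/andP; split; lra.
Qed.

Lemma pathw_sum (w : nat -> nat -> R) p q s : pathw w p q s =
  \sum_(i < (size s).+1) w (p + count id (take i s))%N (q + count negb (take i s))%N.
Proof.
elim: s p q => [|c s IH] p q /=; first by rewrite big_ord1 /= !addn0.
rewrite big_ord_recl /= !addn0; congr (_ + _); case: c; rewrite IH; apply: eq_bigr => i _.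
  by rewrite /= (add0n i); congr (w _ _); lia.
by rewrite /= (add0n i); congr (w _ _); lia.
Qed.

Lemma pweight_heights (xi : int -> int -> R) s :
  pweight xi (heights s) = pathw (fun u v => xi (u + v)%:Z (u%:Z - v%:Z)) 0 0 s.
Proof.
rewrite pathw_sum /pweight size_heights; apply: eq_bigr => i _.
by rewrite nth_heights -1?ltnS// !add0n count_take_size// -ltnS.
Qed.

Lemma eq_pathw (w w' : nat -> nat -> R) p q s :
  (forall i j, (p <= i <= p + count id s)%N -> (q <= j <= q + count negb s)%N -> w i j = w' i j) ->
  pathw w p q s = pathw w' p q s.
Proof.
by move=> H; apply/eqP; rewrite eq_le !le_pathw// => i j hi hj; rewrite H.
Qed.

Variables (l b : R) (N : nat).
Hypothesis l0 : 0 < l.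
Hypothesis bl : `|b| < l.
Hypothesis N0 : (0 < N)%N.

Definition gridU : nat := Num.truncn (N%:R * ((l + b) / 2)).
Definition gridV : nat := Num.truncn (N%:R * ((l - b) / 2)).

Let N0' : 0 < N%:R :> R. Proof. by rewrite ltr0n. Qed.
Let lb0 : 0 <= (l + b) / 2. Proof. by move: bl; rewrite ltr_norml => /andP[? ?]; lra. Qed.
Let lb1 : 0 <= (l - b) / 2. Proof. by move: bl; rewrite ltr_norml => /andP[? ?]; lra. Qed.

Lemma gridU_itv : gridU%:R <= N%:R * ((l + b) / 2) < gridU%:R + 1.
Proof. by rewrite natr1 truncn_itv// (mulr_ge0 (ltW N0') lb0). Qed.

Lemma gridV_itv : gridV%:R <= N%:R * ((l - b) / 2) < gridV%:R + 1.
Proof. by rewrite natr1 truncn_itv// (mulr_ge0 (ltW N0') lb1). Qed.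

Lemma inSN_grid (u v : nat) : (u <= gridU)%N -> (v <= gridV)%N ->
  inSN l b N (u + v)%:Z (u%:Z - v%:Z).
Proof.
move=> uU vV; split.
  have -> : (u + v)%:Z + (u%:Z - v%:Z) = u%:Z * 2 by rewrite PoszD; ring.
  exact: dvdz_mull.
rewrite PoszD intrD intrB -!pmulrn; apply: (@grid_inQ R l b N gridU gridV) => //.
  by case/andP: gridU_itv.
by case/andP: gridV_itv.
Qed.

Lemma inSN_inv (i j : int) : inSN l b N i j -> exists u v : nat,
  [/\ (u <= gridU)%N, (v <= gridV)%N, i = (u + v)%:Z & j = u%:Z - v%:Z].
Proof.
move=> [/dvdzP[u hu] Q].
have [v hv] : exists v : int, i = u + v by exists (i - u); rewrite addrC subrK.
have hj : j = u - v by move: hu; rewrite hv => hu; lia.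
move: Q; rewrite hv hj intrD intrB mulrDl mulrBl => /inQ_uv[/andP[u0 u1] /andP[v0 v1]].
have {}u0 : 0 <= u by move: u0; rewrite pmulr_lge0 ?invr_gt0// ler0z.
have {}v0 : 0 <= v by move: v0; rewrite pmulr_lge0 ?invr_gt0// ler0z.
exists `|u|%N, `|v|%N; rewrite PoszD !gez0_abs//; split => //.
  rewrite /gridU truncn_ge_nat ?(mulr_ge0 (ltW N0') lb0)//.
  have -> : `|u|%:R = u%:~R :> R by rewrite -{2}(gez0_abs u0).
  by move: u1; rewrite ler_pdivrMr// [leRHS]mulrC.
rewrite /gridV truncn_ge_nat ?(mulr_ge0 (ltW N0') lb1)//.
have -> : `|v|%:R = v%:~R :> R by rewrite -{2}(gez0_abs v0).
by move: v1; rewrite ler_pdivrMr// [leRHS]mulrC.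
Qed.

Lemma heights_is_path s : count id s = gridU -> count negb s = gridV ->
  is_path l b N (heights s).
Proof.
move=> us ds.
have inS i : (i <= size s)%N -> inSN l b N i%:Z (nth 0 (heights s) i).
  move=> iS; rewrite nth_heights// -{1}(count_take_size iS).
  by apply: inSN_grid; [rewrite -us|rewrite -ds]; exact: count_take_leq.
split; rewrite ?size_heights//.
- by rewrite nth_heights// take0.
- move=> i iS; rewrite !nth_heights//; last exact: ltnW.
  rewrite (take_nth false)// -cats1 !count_cat /=; case: (nth false s i) => /=; lia.
- split; first exact: inS.
  move=> i' j' /inSN_inv[u [v [uU vV -> _]]]; rewrite lez_nat /= -count_id_negb us ds.
  exact: leq_add.
Qed.

(** Ending at the rightmost point forces both counts to be maximal, since neither can exceed its
    bound and their sum attains the sum of the bounds. *)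
Lemma is_path_heights js : is_path l b N js -> exists s,
  [/\ js = heights s, count id s = gridU & count negb s = gridV].
Proof.
move=> [sz j0 inS step [lastS lastmax]].
pose s := mkseq (fun i => nth 0 js i.+1 - nth 0 js i == 1) (size js).-1.
have ss : size s = (size js).-1 by rewrite size_mkseq.
have hn i : (i <= size s)%N -> nth 0 (heights s) i = nth 0 js i.
  elim: i => [|i IH] iS; first by rewrite nth_heights// take0 j0.
  have := IH (ltnW iS); rewrite !nth_heights ?(ltnW iS)//.
  rewrite (take_nth false iS) -cats1 !count_cat /= nth_mkseq -?ss//.
  have := step i; rewrite -ltnS ss prednK// in iS *.
  move=> /(_ iS); case: eqP => /=; lia.
have js_s : js = heights s.
  apply: (@eq_from_nth _ 0); first by rewrite size_heights ss prednK.
  by move=> i iS; rewrite hn// ss -ltnS prednK.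
exists s; have [u [v [uU vV e1 e2]]] := inSN_inv lastS.
have e3 : (size s = u + v)%N by rewrite ss; case: e1.
have e4 := lastmax _ _ (inSN_grid (leqnn gridU) (leqnn gridV)).
rewrite lez_nat -ss e3 in e4.
have := @hn (size s) (leqnn _); rewrite nth_heights// take_size ss e2.
have := count_id_negb s; rewrite e3.
split => //; lia.
Qed.

(** The last vertex lies less than [2 / N%:R] to the left of [l], so the constant continuation of
    [path_fun] also stays close to a vertex. *)
Lemma path_fun_near s x : count id s = gridU -> count negb s = gridV -> x \in `[0, l] ->
  exists2 i, (i <= size s)%N & `|x - i%:R / N%:R| <= 2 / N%:R /\
    `|path_fun N (heights s) x - (nth 0 (heights s) i)%:~R / N%:R| <= 1 / N%:R.
Proof.
move=> us ds; rewrite in_itv/= => /andP[x0 xl].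
have T2 : N%:R * l < (size s)%:R + 2.
  case/andP: gridU_itv => _ h1; case/andP: gridV_itv => _ h2.
  by rewrite -count_id_negb us ds natrD; lra.
have Nx : N%:R * x <= N%:R * l by rewrite ler_wpM2l// ltW.
have dN (i : nat) (c : R) : `|N%:R * x - i%:R| <= c -> `|x - i%:R / N%:R| <= c / N%:R.
  move=> H; rewrite ler_pdivlMr// -{2}(gtr0_norm N0') -normrM mulrBl divfK ?gt_eqF//.
  by rewrite [x * _]mulrC.
rewrite /path_fun size_heights succnK; case: ifPn => [Tx|]; last rewrite -ltNge => xT.
  exists (size s) => //; split; last by rewrite subrr normr0 divr_ge0.
  by apply: dN; rewrite ger0_norm ?subr_ge0//; lra.
have s0 : 0 <= N%:R * x by rewrite mulr_ge0// ltW.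
set i := `|Num.floor (N%:R * x)|%N.
have /andP[f1 f2] := floor_itv (N%:R * x).
have fi : (i%:R : R) = (Num.floor (N%:R * x))%:~R.
  by rewrite /i pmulrn gez0_abs// floor_ge0.
rewrite intrD -fi in f2; rewrite -fi in f1.
have iT : (i < size s)%N by rewrite -(ltr_nat R) (le_lt_trans f1).
exists i; first exact: ltnW.
split; first by apply: dN; rewrite ger0_norm ?subr_ge0//; lra.
have := @heights_lip s i.+1 i iT (ltnW iT).
rewrite -addn1 natrD [_ + 1%:R]addrC addrK normr1.
set hi := (nth 0 (heights s) i)%:~R; set hi1 := (nth 0 (heights s) (i + 1))%:~R => hd.
rewrite -mulrBl normrM normfV (gtr0_norm N0') ler_wpM2r ?invr_ge0 ?(ltW N0')//.
have -> : (1 + i%:R - N%:R * x) * hi + (N%:R * x - i%:R) * hi1 - hi = (N%:R * x - i%:R) * (hi1 - hi).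
  by ring.
rewrite normrM mulr_ile1// ger0_norm ?subr_ge0//; lra.
Qed.

End boolean_paths.

Section path_curve.
Context {R : realType}.
Variables (l b : R) (N : nat).
Hypothesis l0 : 0 < l.
Hypothesis bl : `|b| < l.
Hypothesis N0 : (0 < N)%N.
Variable s : seq bool.
Hypothesis us : count id s = gridU l b N.
Hypothesis ds : count negb s = gridV l b N.

Let N0' : 0 < N%:R :> R. Proof. by rewrite ltr0n. Qed.
Let hgt i : R := (nth 0 (heights s) i)%:~R.

(** The interpolated path may stop short of [l] and miss the height [b], so it need not belong to
    [Xset]. Extending its vertices together with the point [(l, b)], which are compatible because
    all vertices lie in [Q], gives a curve in [Xset] through every vertex. *)
Definition path_curve : R -> R :=
  mcshane [seq (i%:R / N%:R, (nth 0 (heights s) i)%:~R / N%:R) | i <- iota 0 (size s).+1] (l, b).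

Let compat : {in (l, b) :: [seq (i%:R / N%:R, hgt i / N%:R) | i <- iota 0 (size s).+1] &,
  forall q q' : R * R, `|q.2 - q'.2| <= `|q.1 - q'.1|}.
Proof.
have Qi i : (i < (size s).+1)%N -> `|b - hgt i / N%:R| <= `|l - i%:R / N%:R|.
  move=> iS; have [_ _ inS _ _] := heights_is_path l0 bl N0 us ds.
  rewrite size_heights in inS.
  have [_ [/andP[_ il] [_ H]]] := inS i iS.
  by rewrite [leRHS]ger0_norm ?subr_ge0.
have mP (q : R * R) : q \in [seq (i%:R / N%:R, hgt i / N%:R) | i <- iota 0 (size s).+1] ->
    exists2 i, (i < (size s).+1)%N & q = (i%:R / N%:R, hgt i / N%:R).
  move=> H; have [i iS ->] := @mapP nat (R * R)%type _ _ _ H.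
  by exists i => //; move: iS; rewrite mem_iota add0n.
move=> q q'; rewrite !in_cons => /orP[/eqP ->|/mP[i iS ->]] /orP[/eqP ->|/mP[j jS ->]] /=.
- by rewrite !subrr.
- exact: Qi.
- by rewrite distrC [leRHS]distrC; exact: Qi.
- rewrite -!mulrBl !normrM ler_wpM2r//; exact: heights_lip.
Qed.

Lemma path_curve_lip (x x' : R) : `|path_curve x - path_curve x'| <= `|x - x'|.
Proof. exact: mcshane_lip. Qed.

Lemma path_curve_grid i : (i <= size s)%N -> path_curve (i%:R / N%:R) = hgt i / N%:R.
Proof.
move=> iS; apply: (@mcshane_id R _ (l, b) (i%:R / N%:R, hgt i / N%:R)) => //.
by rewrite inE; apply/orP; right; apply: (@map_f nat (R * R)%type); rewrite mem_iota add0n ltnS.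
Qed.

Lemma path_curve_Xset : Xset l b path_curve.
Proof.
split; last split.
- have := path_curve_grid (leq0n (size s)); rewrite mul0r => ->.
  by rewrite /hgt nth_heights// take0 mul0r.
- by apply: (@mcshane_id R _ (l, b) (l, b)) => //; rewrite inE eqxx.
- by move=> x1 x2 _ _; exact: path_curve_lip.
Qed.

Lemma path_fun_curve (x : R) : x \in `[0, l] ->
  `|path_fun N (heights s) x - path_curve x| <= 3 / N%:R.
Proof.
move=> xl; have [i iS [h1 h2]] := path_fun_near bl N0 us ds xl.
apply: le_trans (ler_distD (hgt i / N%:R) _ _) _.
have -> : 3 / N%:R = 1 / N%:R + 2 / N%:R :> R by rewrite -mulrDl; congr (_ / _); ring.
apply: lerD => //; rewrite -path_curve_grid//.
by apply: le_trans (path_curve_lip _ _) _; rewrite distrC.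
Qed.

Lemma grid_size : N%:R * l - 2 < (size s)%:R.
Proof.
have /andP[_ h1] := gridU_itv bl N0; have /andP[_ h2] := gridV_itv bl N0.
by rewrite -count_id_negb us ds natrD; lra.
Qed.

Variable K : nat.
Hypothesis K0 : (0 < K)%N.
Let h := l / K%:R.

(** The index of the last vertex not to the right of [k%:R * h], capped at the end of the path,
    which can lie before [l]. *)
Definition cut k : nat := minn (size s) (Num.truncn (N%:R * (k%:R * h))).

Let h0 : 0 < h. Proof. by rewrite divr_gt0// ltr0n. Qed.
Let nonneg k : 0 <= N%:R * (k%:R * h).
Proof. by rewrite mulr_ge0// mulr_ge0// ltW. Qed.

Lemma cut_nd k : (cut k <= cut k.+1)%N.
Proof.
rewrite /cut leq_min geq_minl /=; apply: leq_trans (geq_minr _ _) _.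
by apply: le_truncn; rewrite ler_pM2l// ler_pM2r// ler_nat.
Qed.

Lemma cut0 : cut 0 = 0%N.
Proof. by rewrite /cut mul0r mulr0 truncn0 minn0. Qed.

Lemma cutK : cut K = size s.
Proof.
rewrite /cut; apply/minn_idPl; rewrite truncn_ge_nat//.
have -> : K%:R * h = l by rewrite /h mulrC divfK// gt_eqF// ltr0n.
have /andP[h1 _] := gridU_itv bl N0; have /andP[h2 _] := gridV_itv bl N0.
by rewrite -count_id_negb us ds natrD; lra.
Qed.

Lemma cut_near k : (k <= K)%N -> `|(cut k)%:R - N%:R * (k%:R * h)| <= 2 :> R.
Proof.
move=> kK; have := cell_in l0 K0 kK; rewrite -/h in_itv/= => /andP[_ xl].
have Nx : N%:R * (k%:R * h) <= N%:R * l by rewrite ler_pM2l.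
have /andP[t1] := truncn_itv (nonneg k); rewrite -natr1 => t2.
have := grid_size; rewrite /cut /minn ler_norml.
by case: ltnP => [|_]; rewrite -?(ltr_nat R) => *; apply/andP; split; lra.
Qed.

Lemma cut_curve k : (k <= K)%N -> near_curve l K N path_curve k
  (count id (take (cut k) s)) (count negb (take (cut k) s)).
Proof.
move=> kK; have cS : (cut k <= size s)%N by rewrite geq_minl.
have c2 := cut_near kK.
have e1 : (cut k)%:R = (count id (take (cut k) s))%:R + (count negb (take (cut k) s))%:R :> R.
  by rewrite -natrD count_take_size.
have e2 : N%:R * path_curve ((cut k)%:R / N%:R) =
    (count id (take (cut k) s))%:R - (count negb (take (cut k) s))%:R :> R.
  by rewrite path_curve_grid// mulrC divfK ?gt_eqF// /hgt nth_heights// intrB.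
(* Abscissa and height at the cut are each off by at most 2; the rotated coordinates are half their
   sum and half their difference, so they are off by at most 2 as well. *)
have c3 : `|N%:R * path_curve ((cut k)%:R / N%:R) - N%:R * path_curve (k%:R * h)| <= 2.
  rewrite -mulrBr normrM (gtr0_norm N0').
  apply: le_trans (_ : N%:R * `|(cut k)%:R / N%:R - k%:R * h| <= _).
    by rewrite ler_pM2l//; exact: path_curve_lip.
  by rewrite -{1}(gtr0_norm N0') -normrM mulrBr mulrCA divff ?gt_eqF// mulr1.
rewrite e1 in c2; rewrite e2 in c3.
move: c2 c3; rewrite !ler_norml => /andP[? ?] /andP[? ?].
by rewrite /near_curve -/h !ler_norml; split; apply/andP; split; lra.
Qed.

End path_curve.

Section curve_skeleton.
Context {R : realType}.
Variables (l b : R) (N K : nat) (y : R -> R).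
Hypothesis l0 : 0 < l.
Hypothesis N0 : (0 < N)%N.
Hypothesis K0 : (0 < K)%N.
Hypothesis Xy : Xset l b y.
Let h := l / K%:R.
Let N0' : 0 < N%:R :> R. Proof. by rewrite ltr0n. Qed.
Let h0 : 0 < h. Proof. by rewrite divr_gt0// ltr0n. Qed.

(** Along a 1-Lipschitz curve both rotated coordinates are nondecreasing, so rounding them down
    gives monotone corners, which end exactly at the last corner of the grid. *)
Definition skelP k : nat := Num.truncn (N%:R * ((k%:R * h + y (k%:R * h)) / 2)).
Definition skelQ k : nat := Num.truncn (N%:R * ((k%:R * h - y (k%:R * h)) / 2)).

Let KhE : K%:R * h = l. Proof. by rewrite /h mulrC divfK// gt_eqF// ltr0n. Qed.

Lemma skel0 : skelP 0 = 0%N /\ skelQ 0 = 0%N.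
Proof. by rewrite /skelP /skelQ mul0r Xy.1 addr0 subr0 mul0r mulr0 truncn0. Qed.

Lemma skelK : skelP K = gridU l b N /\ skelQ K = gridV l b N.
Proof. by rewrite /skelP /skelQ KhE Xy.2.1. Qed.

Let incr k : (k < K)%N -> `|y (k.+1%:R * h) - y (k%:R * h)| <= h.
Proof.
move=> kK; apply: le_trans (Xy.2.2 _ _ (cell_in l0 K0 kK) (cell_in l0 K0 (ltnW kK))) _.
by rewrite -mulrBl -natrB// subSnn mul1r gtr0_norm.
Qed.

Let hS k : k.+1%:R * h = k%:R * h + h. Proof. by rewrite -natr1 mulrDl mul1r. Qed.

Lemma skel_nd k : (k < K)%N -> (skelP k <= skelP k.+1)%N /\ (skelQ k <= skelQ k.+1)%N.
Proof.
move=> kK; have := incr kK; rewrite ler_norml hS => /andP[h1 h2].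
by split; apply: le_truncn; rewrite ler_pM2l// hS; lra.
Qed.

Lemma skel_le k : (k <= K)%N -> (skelP k <= gridU l b N)%N /\ (skelQ k <= gridV l b N)%N.
Proof.
move=> kK; have xin := cell_in l0 K0 kK.
have [_ [_ H]] := Xset_inQ l0 Xy xin; rewrite -/h in H.
by move: H; rewrite ler_norml => /andP[h1 h2]; split; apply: le_truncn; rewrite ler_pM2l//; lra.
Qed.

Lemma skel_near k : (k <= K)%N -> near_curve l K N y k (skelP k) (skelQ k).
Proof.
move=> kK; have xin := cell_in l0 K0 kK.
have [_ [H _]] := Xset_inQ l0 Xy xin; rewrite -/h in H.
move: H; rewrite ler_norml => /andP[h1 h2].
have p0 : 0 <= N%:R * ((k%:R * h + y (k%:R * h)) / 2) by rewrite mulr_ge0//; lra.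
have q0 : 0 <= N%:R * ((k%:R * h - y (k%:R * h)) / 2) by rewrite mulr_ge0//; lra.
have := truncn_itv p0; rewrite -[X in _ < X]natr1 -/(skelP k) => /andP[? ?].
have := truncn_itv q0; rewrite -[X in _ < X]natr1 -/(skelQ k) => /andP[? ?].
by rewrite /near_curve -/h !ler_norml; split; apply/andP; split; lra.
Qed.

End curve_skeleton.

Section deterministic_comparison.
Context {R : realType}.
Variables (l b : R) (alpha : R * R -> R).
Hypothesis l0 : 0 < l.
Hypothesis bl : `|b| < l.
Hypothesis cont : {within [set p | inQ l b p.1 p.2], continuous alpha}.
Hypothesis alpha0 : forall p : R * R, inQ l b p.1 p.2 -> 0 <= alpha p.
Variable ys : R -> R.
Hypothesis Xys : Xset l b ys.
Hypothesis ys_uniq : forall y, Xset l b y -> (Gfun l alpha ys <= Gfun l alpha y)%E ->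
  forall x, x \in `[0, l] -> y x = ys x.

Lemma sup_dist_le (f g : R -> R) (c : R) : (forall x, x \in `[0, l] -> `|f x - g x| <= c) ->
  sup_dist l f g <= c.
Proof.
move=> H; apply: sup_le_ub; last by move=> _ [x xl <-]; exact: H.
by exists `|f 0 - g 0|; exists 0 => //=; rewrite in_itv/= lexx ltW.
Qed.

(** If a maximizing path were far away, its weight would be at most the maximum of the functional
    minus [eta], plus [eta / 8]. The path glued along [ys] has at least this maximum minus [eta / 4]
    and [eta / 8], a contradiction. *)
Lemma maxpath_close (delta : R) : 0 < delta -> exists (theta : R) (N0 : nat), 0 < theta /\
  forall N, (N0 <= N)%N -> (0 < N)%N -> forall e : nat -> nat -> R, (forall i j, 0 <= e i j) ->
  (forall p q m n, (p + m <= gridU l b N)%N -> (q + n <= gridV l b N)%N ->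
    `|lpp (shift e p q) m n - shapeg m%:R n%:R| <= theta * N%:R) ->
  forall xi : int -> int -> R,
  (forall u v, (u <= gridU l b N)%N -> (v <= gridV l b N)%N ->
    xi (u + v)%:Z (u%:Z - v%:Z) = gridw alpha N e u v) ->
  forall js, is_maxpath l b N xi js -> sup_dist l (path_fun N js) ys <= delta.
Proof.
move=> d0; have d20 : 0 < delta / 2 by rewrite divr_gt0.
have [K KP] := fine_mesh_exists l0 cont.
have [eta [n0 [eta0 stab]]] := maximizer_stable l0 cont alpha0 KP d20 Xys ys_uniq.
have [M M0 HM] := alpha_bound cont.
(* The mesh used along [ys] is fine enough for the loss [4 * eps * l] of [path_lower] to be at most
   [eta / 4]. *)
pose n1 := Num.bound (16 * l / eta).
have n1P : 4 * n1.+1%:R^-1 * l <= eta / 4.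
  have : 16 * l / eta < n1%:R by apply: archi_boundP; rewrite divr_ge0 ?mulr_ge0 ?ltW.
  rewrite ltr_pdivrMr// => h; have e1 : n1.+1%:R = n1%:R + 1 :> R by rewrite natr1.
  by rewrite mulrAC ler_pdivrMr// e1; lra.
have inv0 n : 0 <= n.+1%:R^-1 :> R by rewrite invr_ge0.
have inv1 n : n.+1%:R^-1 <= 1 :> R by rewrite invf_le1 ?ltr0n// ler1n.
(* The sum that detects the deviation depends on the path, hence [theta] must suit all meshes up to
   [maxn n0 n1] at once. *)
pose B := (\max_(n < (maxn n0 n1).+1) K n)%N.
have BP n : (n <= maxn n0 n1)%N -> (K n <= B)%N.
  by rewrite -ltnS => nn; rewrite /B -[n]/(val (Ordinal nn)) leq_bigmax.
pose W := werr l M.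
have W0 : 0 < W by rewrite /W /werr ltr_wpDl// addr_ge0// mulr_ge0// ltW.
pose theta := Num.min 1 (eta / (8 * (B.+1%:R * W))).
have BW0 : 0 < 8 * (B.+1%:R * W) by rewrite !mulr_gt0.
have th0 : 0 < theta by rewrite lt_min ltr01 divr_gt0.
have th1 : theta <= 1 by rewrite ge_min lexx.
have thK n : (n <= maxn n0 n1)%N -> (K n)%:R * W * theta <= eta / 8.
  move=> nn; apply: (@le_trans _ _ (B.+1%:R * W * (eta / (8 * (B.+1%:R * W))))).
    apply: ler_pM; rewrite ?mulr_ge0 ?(ltW W0) ?(ltW th0)//.
      by rewrite ler_pM2r// ler_nat leqW// BP.
    by rewrite ge_min lexx orbT.
  by rewrite le_eqVlt; apply/orP; left; apply/eqP; field; rewrite gt_eqF//= pnatr_eq0.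
have [r r0 Hr] := alpha_unif cont th0.
have [N1 pert] := shapeg_perturb l0 th0.
exists theta, (maxn N1 (maxn (Num.bound (4 / r)) (Num.bound (6 / delta)))).
split=> // N; rewrite !geq_max => /and3P[N1N Nr Nd] N0 e e0 good xi xiE js [pjs maxjs].
have N0' : 0 < N%:R :> R by rewrite ltr0n.
have rN : 4 / N%:R <= r.
  rewrite ler_pdivrMr// -ler_pdivrMl// mulrC; apply: le_trans (_ : (Num.bound (4 / r))%:R <= _).
    by apply: ltW; apply: archi_boundP; rewrite divr_ge0// ltW.
  by rewrite ler_nat.
have dN : 3 / N%:R <= delta / 2.
  have h6 : 6 / delta <= N%:R.
    apply: le_trans (_ : (Num.bound (6 / delta))%:R <= _); last by rewrite ler_nat.
    by apply: ltW; apply: archi_boundP; rewrite divr_ge0// ltW.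
  by move: h6; rewrite !ler_pdivrMr//; lra.
have [s [jsE us ds]] := is_path_heights l0 bl N0 pjs.
set U := gridU l b N in good xiE us; set V := gridV l b N in good xiE ds.
have /andP[UN _] := gridU_itv bl N0; have /andP[VN _] := gridV_itv bl N0.
have wE s' : count id s' = U -> count negb s' = V ->
    pweight xi (heights s') = pathw (gridw alpha N e) 0 0 s'.
  move=> us' ds'; rewrite pweight_heights; apply: eq_pathw => i j.
  by rewrite !add0n us' ds' => /andP[_ iU] /andP[_ jV]; exact: xiE.
apply: sup_dist_le => x xl; rewrite leNgt; apply/negP => dx.
pose y := path_curve l b N s.
have Xy : Xset l b y by exact: path_curve_Xset.
have [n nn0 Sn] : exists2 n, (n <= n0)%N & usum l alpha (K n) n.+1%:R^-1 y <=
    fine (Gfun l alpha ys) - eta.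
  apply: stab => //; exists x => //.
  have := path_fun_curve l0 bl N0 us ds xl; rewrite -jsE -/y => h1.
  have := lt_le_trans dx (le_trans (ler_distD (y x) _ _) (lerD (le_trans h1 dN) (lexx _))).
  by rewrite {1}[delta]splitr ltrD2l => /ltW.
have nm : (n <= maxn n0 n1)%N by rewrite leq_max nn0.
have n1m : (n1 <= maxn n0 n1)%N by rewrite leq_max leqnn orbT.
have ub : pweight xi js <= usum l alpha (K n) n.+1%:R^-1 y + eta / 8.
  have [Kn HK] := KP n; have Kn0 : (0 < K n)%N by exact: leq_ltn_trans Kn.
  rewrite jsE wE//; apply: le_trans (_ : usum l alpha (K n) n.+1%:R^-1 y + (K n)%:R * W * theta <= _).
    apply: (@path_upper R l b alpha l0 bl alpha0 M M0 HM N U V e N0 UN VN e0 theta th0 th1 good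
      (K n) n.+1%:R^-1 Kn0 (inv0 n) (inv1 n) HK r Hr rN N1 pert N1N y Xy
      (fun k => count id (take (cut l N s (K n) k) s))
      (fun k => count negb (take (cut l N s (K n) k) s)) _ _ _ _ _ s (cut l N s (K n))) => //.
    - by move=> k kK; exact: cut_curve.
    - by move=> k kK; apply: count_take_le; exact: cut_nd.
    - by move=> k kK; apply: count_take_le; exact: cut_nd.
    - by move=> k kK; rewrite -us; exact: count_take_leq.
    - by move=> k kK; rewrite -ds; exact: count_take_leq.
    - by move=> k kK; exact: cut_nd.
    - exact: cut0.
    - exact: (cutK l0 bl N0 us ds Kn0).
  by rewrite lerD2l thK.
have [s' [us' ds' lb]] : exists s', [/\ count id s' = U, count negb s' = V &
    usum l alpha (K n1) n1.+1%:R^-1 ys - eta / 4 - eta / 8 <= pathw (gridw alpha N e) 0 0 s'].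
  have [Kn HK] := KP n1; have Kn0 : (0 < K n1)%N by exact: leq_ltn_trans Kn.
  have [P0 Q0] := skel0 N (K n1) Xys; have [PK QK] := skelK N Kn0 Xys.
  have [|||||s' [us' ds' lb]] := @path_lower R l b alpha l0 bl alpha0 M HM N U V e N0 UN VN e0
      theta th0 th1 good (K n1) n1.+1%:R^-1 Kn0 (inv0 n1) (inv1 n1) HK r Hr rN N1 pert N1N ys Xys
      (skelP l N (K n1) ys) (skelQ l N (K n1) ys) _ _ _ _ _ P0 Q0.
  - by move=> k kK; exact: (skel_near _ l0 Kn0 Xys).
  - by move=> k kK; case: (skel_nd l0 N0 Kn0 Xys kK).
  - by move=> k kK; case: (skel_nd l0 N0 Kn0 Xys kK).
  - by move=> k kK; case: (skel_le l0 N0 Kn0 Xys kK).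
  - by move=> k kK; case: (skel_le l0 N0 Kn0 Xys kK).
  exists s'; rewrite us' ds' PK QK; split => //; apply: le_trans lb.
  by apply: lerB; [rewrite lerD2l lerN2|exact: thK].
have := maxjs _ (heights_is_path l0 bl N0 us' ds'); rewrite wE//.
have G := Gfun_le_usum_mesh l0 cont alpha0 KP n1 Xys.
rewrite -(fineK (Gfun_fin l0 cont alpha0 KP Xys)) lee_fin in G.
lra.
Qed.

End deterministic_comparison.

(** * Probability estimates for the inhomogeneous model *)

Section percolation.
Context {R : realType} (l b : R) (alpha : R * R -> R).
Hypothesis l0 : 0 < l.
Hypothesis bl : `|b| < l.
Hypothesis cont : {within [set p | inQ l b p.1 p.2], continuous alpha}.
Hypothesis alpha0 : forall p : R * R, inQ l b p.1 p.2 -> 0 <= alpha p.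
Variable ys : R -> R.
Hypothesis Xys : Xset l b ys.
Hypothesis ys_uniq : forall y, Xset l b y -> (Gfun l alpha ys <= Gfun l alpha y)%E ->
  forall x, x \in `[0, l] -> y x = ys x.
Context (d : measure_display) (T : measurableType d) (P : probability T R).
Variable E : nat -> int * int -> T -> R.
Hypothesis E_meas : forall N p, (0 < N)%N -> inSN l b N p.1 p.2 -> measurable_fun setT (E N p).
Hypothesis E_tail : forall N p, (0 < N)%N -> inSN l b N p.1 p.2 ->
  forall t, 0 <= t -> P [set w | t < E N p w] = (expR (- t))%:E.
Hypothesis E_ind : forall N, (0 < N)%N ->
  forall (s : seq (int * int)) (B : int * int -> set R),
  uniq s -> (forall p, p \in s -> inSN l b N p.1 p.2) -> (forall p, measurable (B p)) ->
  P (\bigcap_(p in [set` s]) (E N p @^-1` B p)) = (\prod_(p <- s) P (E N p @^-1` B p))%E.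

Let xi N w := fun i j : int => alpha (i%:~R / N%:R, j%:~R / N%:R) / N%:R * E N (i, j) w.
Let U N := gridU l b N.
Let V N := gridV l b N.

Definition lattice (p : nat * nat) : int * int := ((p.1 + p.2)%:Z, p.1%:Z - p.2%:Z).

Lemma lattice_cancel : cancel lattice (fun q => (`|(q.1 + q.2)%R|%N./2, `|(q.1 - q.2)%R|%N./2)).
Proof.
move=> [u v]; rewrite /lattice /=; congr (_, _).
  by rewrite (_ : (u + v)%:Z + (u%:Z - v%:Z) = u.*2%:Z); [rewrite absz_nat doubleK|lia].
by rewrite (_ : (u + v)%:Z - (u%:Z - v%:Z) = v.*2%:Z); [rewrite absz_nat doubleK|lia].
Qed.

(** The given variables are positive only almost surely. Absolute values are nonnegative everywhere,
    have the same tails and stay independent. *)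
Let absE N (u v : nat) (w : T) : R := `|E N (lattice (u, v)) w|.

Lemma lattice_inSN N u v : (0 < N)%N -> (u <= U N)%N -> (v <= V N)%N ->
  inSN l b N (lattice (u, v)).1 (lattice (u, v)).2.
Proof. by move=> N0 uU vV; exact: inSN_grid. Qed.

Lemma E_le0 N p : (0 < N)%N -> inSN l b N p.1 p.2 ->
  measurable [set w | E N p w <= 0] /\ P [set w | E N p w <= 0] = 0%E.
Proof.
move=> N0 pS; have mE := E_meas N0 pS.
have m1 : measurable [set w | 0 < E N p w].
  rewrite -[X in measurable X]setTI.
  have := mE measurableT `]0, +oo[%classic (measurable_itv _).
  by rewrite set_itvE.
have -> : [set w | E N p w <= 0] = ~` [set w | 0 < E N p w].
  by apply/seteqP; split => w /=; rewrite leNgt => /negP.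
split; first exact: measurableC.
by rewrite probability_setC// E_tail// oppr0 expR0 subee.
Qed.

Lemma mutind_measurable_fun (I : eqType) (S : {pred I}) (Z : I -> T -> R) (f : R -> R) :
  measurable_fun setT f -> mutind P S Z -> mutind P S (fun i w => f (Z i w)).
Proof.
move=> mf ind s B us sS mB; apply: (ind s (fun i => f @^-1` B i)) => // i.
by rewrite -[X in measurable X]setTI; exact: mf.
Qed.

Lemma absE_expgrid N : (0 < N)%N -> expgrid P (U N) (V N) (absE N).
Proof.
move=> N0; split.
- move=> i j iU jV; apply: measurableT_comp; first exact: normr_measurable.
  by apply: E_meas => //; exact: lattice_inSN.
- by move=> i j w; exact: normr_ge0.
- move=> i j iU jV t t0; have S := lattice_inSN N0 iU jV.
  rewrite -(E_tail N0 S t0); have [mN PN] := E_le0 N0 S.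
  have PN' : (P [set w | E N (lattice (i, j)) w <= 0]%R <= 0)%E by rewrite PN.
  have mE := E_meas N0 S.
  have m1 : measurable [set w | t < E N (lattice (i, j)) w].
    rewrite -[X in measurable X]setTI.
    have := mE measurableT `]t, +oo[%classic (measurable_itv _).
    by rewrite set_itvE.
  have m2 : measurable [set w | t < absE N i j w].
    rewrite -[X in measurable X]setTI.
    have mA : measurable_fun setT (absE N i j).
      by apply: measurableT_comp => //; exact: normr_measurable.
    have := mA measurableT `]t, +oo[%classic (measurable_itv _).
    by rewrite set_itvE.
  apply/eqP; rewrite eq_le; apply/andP; split.
    apply: (@le_trans _ _ (P ([set w | t < E N (lattice (i, j)) w] `|`
        [set w | E N (lattice (i, j)) w <= 0]))).
      apply: le_measure; rewrite ?inE//; first exact: measurableU.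
      move=> w /=; rewrite /absE; case: (lerP (E N (lattice (i, j)) w) 0) => [|h]; first by right.
      by rewrite gtr0_norm// => ?; left.
    apply: le_trans (measureU2 P m1 mN) _; rewrite -[leRHS]adde0.
    by apply: leeD; [exact: lexx|exact: PN'].
  apply: le_measure; rewrite ?inE// => w /= tE.
  exact: lt_le_trans tE (ler_norm _).
- pose S := [pred p : int * int | `[< inSN l b N p.1 p.2 >]].
  have indE : mutind P S (E N).
    move=> s B us sS mB; by apply: (E_ind N0) => // p /sS pS; apply/asboolP.
  have := mutind_measurable_fun (@normr_measurable R setT) indE.
  apply: (mutind_comp lattice_cancel) => -[i j]; rewrite !inE/= => /andP[iU jV].
  exact: (lattice_inSN N0 iU jV).
Qed.

Definition far (N : nat) (delta : R) : set T :=
  [set w | exists js, is_maxpath l b N (xi N w) js /\ delta < sup_dist l (path_fun N js) ys].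

Lemma measurable_pweight N s : (0 < N)%N -> count id s = U N -> count negb s = V N ->
  measurable_fun setT (fun w => pweight (xi N w) (heights s)).
Proof.
move=> N0 us ds; have [_ _ inS _ _] := heights_is_path l0 bl N0 us ds.
apply: measurable_sum => i; apply: measurable_funM; first exact: measurable_cst.
by apply: E_meas => //=; exact: inS.
Qed.

(** Paths correspond to boolean words of a fixed length. The event is thus a finite union of finite
    intersections of comparisons between measurable weights, the distance being deterministic for
    each word. *)
Lemma measurable_far N delta : (0 < N)%N -> measurable (far N delta).
Proof.
move=> N0; set n := (U N + V N)%N.
pose A := [set s : n.-tuple bool | count id s = U N /\ count negb s = V N].
pose D (s s' : n.-tuple bool) := [set w | pweight (xi N w) (heights s') <= pweight (xi N w) (heights s)].
have -> : far N delta = \bigcup_(s in A `&` [set s | delta < sup_dist l (path_fun N (heights s)) ys])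
    \bigcap_(s' in A) D s s'.
  have tup s : count id s = U N -> count negb s = V N -> size s == n.
    by move=> us ds; rewrite -count_id_negb us ds.
  apply/seteqP; split => [w [js [[pjs mjs] dist]]|w [s [[us ds] dist] mx]].
    have [s [jsE us ds]] := is_path_heights l0 bl N0 pjs.
    exists (Tuple (tup s us ds)); first by rewrite /= -jsE.
    move=> s' [us' ds']; rewrite /D /= -jsE; apply: mjs; exact: heights_is_path.
  exists (heights s); split => //; split; first exact: heights_is_path.
  move=> js' pjs'; have [s' [-> us' ds']] := is_path_heights l0 bl N0 pjs'.
  exact: (mx (Tuple (tup s' us' ds'))).
apply: fin_bigcup_measurable; first exact: finite_finset.
move=> s [[us ds] _]; apply: fin_bigcap_measurable; first exact: finite_finset.
move=> s' [us' ds'].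
have m1 := measurable_pweight N0 us ds; have m2 := measurable_pweight N0 us' ds'.
have := measurable_funB m1 m2 => /(_ measurableT `[0, +oo[%classic (measurable_itv _)).
rewrite setTI; congr (measurable _); apply/seteqP; split => w /=.
  by rewrite in_itv/= andbT subr_ge0.
by rewrite /D /= in_itv/= andbT subr_ge0.
Qed.

Lemma far_bound (delta : R) : 0 < delta -> exists c C : R, 0 < c /\ 0 < C /\
  forall N, (0 < N)%N -> (P (far N delta) < (C * expR (- c * N%:R))%:E)%E.
Proof.
move=> d0.
have [theta [N0 [th0 close]]] := maxpath_close l0 bl cont alpha0 Xys ys_uniq d0.
have [c c0 [C C0 H]] := lpp_uniform P l0 th0.
(* The exponential term makes the bound exceed 1 for the small [N], to which the comparison does not
   apply; the final 1 makes the inequality strict. *)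
exists c, (C + expR (c * N0%:R) + 1); split => //; split.
  by rewrite !addr_gt0// expR_gt0.
move=> N N1; have N1' : 0 < N%:R :> R by rewrite ltr0n.
have eN : 0 < expR (- c * N%:R) by exact: expR_gt0.
have [NN|NN] := leqP N0 N; last first.
  apply: (@le_lt_trans _ _ 1%E); first exact: probability_le1 (measurable_far delta N1).
  rewrite lte_fin; apply: (@le_lt_trans _ _ (expR (c * N0%:R) * expR (- c * N%:R))).
    rewrite -expRD -[leLHS]expR0 ler_expR mulNr -mulrBr mulr_ge0 ?(ltW c0)// subr_ge0 ler_nat.
    exact: ltnW.
  by rewrite ltr_pM2r//; lra.
have gX := absE_expgrid N1.
have bl' : - l < b /\ b < l by move: bl; rewrite ltr_norml => /andP.
have Ul : (U N)%:R <= l * N%:R.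
  case/andP: (gridU_itv bl N1) => h _; apply: le_trans h _.
  by rewrite mulrC ler_pM2r//; lra.
have Vl : (V N)%:R <= l * N%:R.
  case/andP: (gridV_itv bl N1) => h _; apply: le_trans h _.
  by rewrite mulrC ler_pM2r//; lra.
have [PD mD] := H N%:R (U N) (V N) (absE N) ltac:(by rewrite ler1n) Ul Vl gX.
(* The null event on which some weight differs from its absolute value or vanishes. *)
pose neg := [set w | exists2 u, (u < (U N).+1)%N & exists2 v, (v < (V N).+1)%N &
  E N (lattice (u, v)) w <= 0].
have [Pneg mneg] : (P neg <= 0%:E)%E /\ measurable neg.
  pose F u v := [set w | E N (lattice (u, v)) w <= 0].
  have u1 u : (u < (U N).+1)%N -> (P [set w | exists2 v, (v < (V N).+1)%N & F u v w] <= 0%:E)%E /\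
      measurable [set w | exists2 v, (v < (V N).+1)%N & F u v w].
    move=> uU; have := @union_bound _ _ _ P (F u) (V N).+1 0; rewrite mulr0; apply => v vV.
      by have [] := E_le0 N1 (lattice_inSN N1 uU vV).
    by have [_ ->] := E_le0 N1 (lattice_inSN N1 uU vV).
  have := @union_bound _ _ _ P (fun u => [set w | exists2 v, (v < (V N).+1)%N & F u v w]) (U N).+1 0.
  by rewrite mulr0; apply => u uU; have [] := u1 u uU.
apply: (@le_lt_trans _ _ (P (lpp_dev (U N) (V N) (theta * N%:R) (absE N) `|` neg))).
  apply: le_measure; rewrite ?inE; [exact: measurable_far|exact: measurableU|].
  move=> w [js [mjs dist]]; apply: contrapT => /not_orP[ndev nneg].
  have Epos u v : (u <= U N)%N -> (v <= V N)%N -> absE N u v w = E N (lattice (u, v)) w.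
    move=> uU vV; rewrite /absE gtr0_norm// ltNge; apply/negP => h.
    by apply: nneg; exists u => //; exists v.
  have good p q m n : (p + m <= U N)%N -> (q + n <= V N)%N ->
      `|lpp (shift (fun i j => absE N i j w) p q) m n - shapeg m%:R n%:R| <= theta * N%:R.
    move=> pm qn; rewrite ler_distl; apply/andP; split; apply: ltW; rewrite ltNge; apply/negP => h.
      by apply: ndev; exists p, q, m, n; split => //=; right.
    by apply: ndev; exists p, q, m, n; split => //=; left.
  have agree u v : (u <= U N)%N -> (v <= V N)%N ->
      xi N w (u + v)%:Z (u%:Z - v%:Z) = gridw alpha N (fun i j => absE N i j w) u v.
    move=> uU vV; rewrite /xi /gridw Epos// PoszD intrD intrB.
    by rewrite /lattice /= PoszD.
  have := close N NN N1 (fun i j => absE N i j w) (fun i j => normr_ge0 _) good (xi N w) agree js mjs.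
  by rewrite leNgt dist.
apply: le_lt_trans (measureU2 _ mD mneg) _.
apply: (@le_lt_trans _ _ (C * expR (- c * N%:R))%:E); last first.
  by rewrite lte_fin ltr_pM2r// -addrA ltrDl addr_gt0// expR_gt0.
by rewrite -[leRHS]adde0; exact: leeD.
Qed.

(** Borel-Cantelli for each threshold [k.+1%:R^-1], followed by a countable union of null sets.
    Indices are shifted by one because [N = 0] is excluded. *)
Lemma far_ae : {ae P, forall w, forall e : R, 0 < e -> exists N0 : nat,
  forall N : nat, (N0 <= N)%N -> (0 < N)%N -> forall js, is_maxpath l b N (xi N w) js ->
    sup_dist l (path_fun N js) ys < e}.
Proof.
pose F k n := far n.+1 k.+1%:R^-1.
have mF k n : measurable (F k n) by exact: measurable_far.
have F0 k : P (lim_sup_set (F k)) = 0%E.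
  apply: lim_sup_set_cvg0 => //.
  have k0 : 0 < k.+1%:R^-1 :> R by rewrite invr_gt0.
  have [c [C [c0 [C0 H]]]] := far_bound k0.
  pose q := expR (- c); have q0 : 0 < q by exact: expR_gt0.
  have q1 : q < 1 by rewrite /q -expR0 ltr_expR oppr_lt0.
  (* The bounds of [far_bound] form a geometric series of ratio [q], whose partial sums are computed
     exactly. *)
  have part m : \sum_(0 <= n < m) C * expR (- c * n.+1%:R) <= C / (1 - q).
    suff -> : \sum_(0 <= n < m) C * expR (- c * n.+1%:R) = C * q * (1 - q ^+ m) / (1 - q).
      rewrite ler_pM2r ?invr_gt0 ?subr_gt0// -mulrA ler_piMr ?(ltW C0)//.
      have : 0 <= q ^+ m by rewrite exprn_ge0 ?(ltW q0).
      have : q ^+ m <= 1 by rewrite exprn_ile1 ?(ltW q0) ?(ltW q1).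
      by move=> z1 z0; rewrite mulr_ile1 ?subr_ge0 ?(ltW q0) ?(ltW q1)// lerBlDr lerDl.
    elim: m => [|m IH]; first by rewrite big_nil expr0 subrr mulr0 mul0r.
    rewrite big_nat_recr//= IH.
    have -> : expR (- c * m.+1%:R) = q * q ^+ m.
      by rewrite /q -exprS -expRM_natl mulrC.
    by rewrite exprS; field; rewrite subr_eq0 eq_sym lt_eqF.
  apply: (@le_lt_trans _ _ (C / (1 - q))%:E); last exact: ltry.
  apply: lime_le; first by apply: is_cvg_nneseries.
  apply: nearW => m; apply: (@le_trans _ _ (\sum_(0 <= n < m) (C * expR (- c * n.+1%:R))%:E)%E).
    by apply: lee_sum => n _; apply: ltW; exact: H.
  by rewrite sumEFin lee_fin.
have mL k : measurable (lim_sup_set (F k)).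
  by apply: bigcapT_measurable => n; apply: bigcup_measurable.
exists (\bigcup_k lim_sup_set (F k)); split.
- exact: bigcup_measurable.
- apply/eqP; rewrite eq_le measure_ge0 andbT.
  apply: le_trans (measure_sigma_subadditive P mL _ (@subset_refl _ _)) _.
    exact: bigcup_measurable.
  by rewrite eseries0// => k _ _; exact: F0.
move=> w /= /existsNP[e /not_implyP[e0 /forallNP H]].
have [k ke] : exists k, k.+1%:R^-1 < e.
  exists (Num.bound e^-1); rewrite invf_plt ?posrE//.
  apply: lt_trans (archi_boundP _) _; first by rewrite invr_ge0 ltW.
  by rewrite ltr_nat.
exists k => // n _; have /existsNP[N /not_implyP[nN /not_implyP[N0 /existsNP[js /not_implyP[mjs far_js]]]]] := H n.+1.
exists N.-1; first by rewrite /= -ltnS prednK.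
rewrite /F prednK//; exists js; split => //.
by rewrite (lt_le_trans ke)// leNgt; apply/negP.
Qed.

End percolation.

Theorem theorem2 (R : realType) (l b : R) (alpha : R * R -> R) :
  0 < l -> `|b| < l ->
  {within [set p | inQ l b p.1 p.2], continuous alpha} ->
  (forall p : R * R, inQ l b p.1 p.2 -> 0 <= alpha p) ->
  (exists ystar, Xset l b ystar /\
     Gfun l alpha ystar = ereal_sup [set Gfun l alpha y | y in Xset l b]) /\
  (forall ystar, Xset l b ystar ->
     Gfun l alpha ystar = ereal_sup [set Gfun l alpha y | y in Xset l b] ->
     (forall y, Xset l b y ->
        Gfun l alpha y = ereal_sup [set Gfun l alpha y | y in Xset l b] ->
        forall x, x \in `[0, l] -> y x = ystar x) ->
     forall (d : measure_display) (T : measurableType d)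
            (P : probability T R) (E : nat -> int * int -> T -> R),
       (* for each N >= 1 the E_p, p in S_N, are measurable, Exp(1)
          distributed and mutually independent *)
       (forall N p, (0 < N)%N -> inSN l b N p.1 p.2 ->
          measurable_fun setT (E N p)) ->
       (forall N p, (0 < N)%N -> inSN l b N p.1 p.2 ->
          forall t, 0 <= t -> P [set w | t < E N p w] = (expR (- t))%:E) ->
       (forall N, (0 < N)%N ->
          forall (s : seq (int * int)) (B : int * int -> set R),
            uniq s -> (forall p, p \in s -> inSN l b N p.1 p.2) ->
            (forall p, measurable (B p)) ->
            P (\bigcap_(p in [set` s]) (E N p @^-1` B p)) =
            (\prod_(p <- s) P (E N p @^-1` B p))%E) ->
       let xi N w := fun i j : int =>
         alpha (i%:~R / N%:R, j%:~R / N%:R) / N%:R * E N (i, j) w in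
       (* ||pi^N - y*||_sup -> 0 almost surely *)
       {ae P, forall w, forall e : R, 0 < e ->
          exists N0 : nat, forall N : nat, (N0 <= N)%N -> (0 < N)%N ->
            forall js, is_maxpath l b N (xi N w) js ->
              sup_dist l (path_fun N js) ystar < e} /\
       (* exponential bound *)
       (forall delta : R, 0 < delta ->
          exists c C : R, 0 < c /\ 0 < C /\
            forall N : nat, (0 < N)%N ->
              (P [set w | exists js, is_maxpath l b N (xi N w) js /\
                            (delta < sup_dist l (path_fun N js) ystar)%R]
               < (C * expR (- c * N%:R))%:E)%E)).
Proof.
move=> l0 bl cont alpha0; have [K KP] := fine_mesh_exists l0 cont.
split; first exact: (maximizer_exists l0 bl cont alpha0 KP).
move=> ys Xys ysmax ysuniq d T P E E_meas E_tail E_ind xi.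
have uniq y : Xset l b y -> (Gfun l alpha ys <= Gfun l alpha y)%E ->
    forall x, x \in `[0, l] -> y x = ys x.
  move=> Xy le_y; apply: (ysuniq y Xy); apply: le_anti; apply/andP; split.
    by apply: ereal_sup_ubound; exists y.
  by rewrite -ysmax.
split; first exact: (far_ae l0 bl cont alpha0 Xys uniq E_meas E_tail E_ind).
exact: (far_bound l0 bl cont alpha0 Xys uniq E_meas E_tail E_ind).
Qed.
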